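(* Let $\varphi:M^2\to\mathbb{H}^4$ be a PNMC biconservative immersion with $C>0$ (where $C$ is the integration constant attached to $\varphi$, as defined in the context), and let $\Phi=\iota\circ\varphi:M\to\mathbb{R}^5_1$. Identifying $M$ with its image, the surface $M$ can be locally (around each of its points) parametrized as $$ \Phi(u,t)=\hat{\sigma}(u)+\frac{1}{\hat{\kappa}(u)}\left(\sin t\ \overline{b}_1+(\cos t-1)\,\overline{b}_2\right), $$ where: (i) $f=f(u)$ (the mean curvature function) is a positive solution of the first-order ordinary differential equation $$ f'=\frac{4}{3}f\sqrt{1+9Cf^{3/2}-9f^2-c^2f^3}>0, $$ where $c$ is a non-zero real constant and $C$ is a positive real constant; (ii) $\hat{\kappa}=\hat{\kappa}(u)$ is the positive function given by $\hat{\kappa}(u)=3\sqrt{C}f^{3/4}(u)$; (iii) $\overline{b}_1$ and $\overline{b}_2$ are two constant vectors in $\mathbb{R}^5_1$ such that $$ \langle\overline{b}_1,\overline{b}_2\rangle=0\qquad\text{and}\qquad\langle\overline{b}_1,\overline{b}_1\rangle=\langle\overline{b}_2,\overline{b}_2\rangle=1; $$ (iv) $\hat{\sigma}=\hat{\sigma}(u)$ is a curve in $\mathbb{R}^5_1$ such that $\hat{\sigma}=\iota\circ\tilde{\sigma}$, where $\tilde{\sigma}$ is a curve parametrized by arc-length which lies in a totally geodesic hypersurface $\mathbb{H}^3=\mathbb{H}^4\cap\Pi$ of $\mathbb{H}^4$, the hyperplane $\Pi\subset\mathbb{R}^5_1$ containing the origin and being orthogonal to $\overline{b}_1$. Moreover,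 the curvature and torsion of $\tilde{\sigma}$, as a curve in $\mathbb{H}^3$, are $$ \kappa(u)=f(u)\sqrt{1+c^2f(u)},\qquad \tau(u)=\frac{2|c|\sqrt{f(u)}}{3\left(1+c^2f(u)\right)}\sqrt{1+9Cf^{3/2}(u)-9f^2(u)-c^2f^3(u)}, $$ and the curve $\hat{\sigma}$ satisfies $$ \langle\hat{\sigma}(u),\overline{b}_2\rangle=\frac{1}{\hat{\kappa}(u)}. $$
   Context: $\mathbb{R}^5_1$ is $\mathbb{R}^5$ with the bilinear form $\langle\overline{x},\overline{y}\rangle=\sum_{i=1}^4x^iy^i-x^5y^5$; orthogonality in $\mathbb{R}^5_1$ is with respect to this form. $\mathbb{H}^4=\{\overline{x}\in\mathbb{R}^5_1:\langle\overline{x},\overline{x}\rangle=-1,\ x^5>0\}$ is the hyperboloid model of hyperbolic space, and $\iota:\mathbb{H}^4\to\mathbb{R}^5_1$ is the canonical inclusion. Surfaces $M$ are connected and oriented; immersions are smooth and isometric. For an isometric immersion $\varphi:M^2\to\mathbb{H}^4$ with second fundamental form $B$, let $H=\frac12\operatorname{trace}B$ be the mean curvature vector field, $f=|H|$ the mean curvature function, $\nabla^\perp$ the normal connection. The bitension field is $\tau_2(\varphi)=-\Delta^\varphi\tau(\varphi)-\operatorname{trace}R^{\mathbb{H}^4}(\varphi_*,\tau(\varphi))\varphi_*$, with $\tau(\varphi)=2H$, $\Delta^\varphi=-\operatorname{trace}(\nabla^\varphi\nabla^\varphi-\nabla^\varphi_\nabla)$ and $R(X,Y)Z=[\nabla_X,\nabla_Y]Z-\nabla_{[X,Y]}Z$;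 $\varphi$ is biconservative if the tangential part $\tau_2(\varphi)^\top$ vanishes. ''PNMC biconservative immersion (surface)'' means: $\varphi$ is biconservative, $f>0$ on $M$, $\operatorname{grad}f$ is nowhere zero, $\nabla^\perp(H/|H|)=0$, and $M$ is completely contained in $\mathbb{H}^4$, i.e. no open subset of $M$ lies in a totally geodesic hypersurface $\mathbb{H}^3\subset\mathbb{H}^4$. Set $E_1=\operatorname{grad}f/|\operatorname{grad}f|$, $E_3=H/f$, and let $\{E_1,E_2\}$, $\{E_3,E_4\}$ be positively oriented orthonormal frame fields of the tangent and the normal bundle of $\varphi$. With this notation, biconservativity is equivalent to $A_3(\operatorname{grad}f)=-f\operatorname{grad}f$, where $A_3$ is the shape operator of $E_3$. Constants attached to $\varphi$: it is known that $E_2f=0$ and that the shape operator of $E_4$ is $A_4=\operatorname{diag}(cf^{3/2},-cf^{3/2})$ with respect to $\{E_1,E_2\}$, for a non-zero real constant $c$; moreover there is a real constant $C$ (integration constant) such that $E_1f=\frac43f\sqrt{1+9Cf^{3/2}-9f^2-c^2f^3}>0$ on $M$. For a unit speed curve in a Riemannian $3$-manifold, curvature and torsion are its first and second Frenet curvatures, the torsion here being taken non-negative (i.e. up to the choice of orientation). *)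

(* Defs.v *)
From HB Require Import structures.
From mathcomp Require Import all_boot all_order all_algebra.
From mathcomp Require Import all_classical all_reals all_analysis.

Set Implicit Arguments.
Unset Strict Implicit.
Unset Printing Implicit Defensive.

Import Order.TTheory GRing.Theory Num.Theory.
Import numFieldNormedType.Exports.

Local Open Scope classical_set_scope.
Local Open Scope ring_scope.

(* [Ck_on k U f] is only meant for open [U]; [f] may be arbitrary outside. *)
Fixpoint Ck_on (R : realType) (V W : normedModType R) (k : nat) (U : set V)
    (f : V -> W) : Prop :=
  if k is k'.+1 then
    (forall x, U x -> differentiable f x) /\
    (forall v : V, Ck_on k' U (fun x => 'D_v f x))
  else forall x, U x -> {for x, continuous f}.

Definition smooth_on (R : realType) (V W : normedModType R) (U : set V)
  (f : V -> W) : Prop := forall k : nat, Ck_on k U f.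

(* [crd] is the coordinate map, only meaningful on the open set
   [par @` dom]; [par] is its inverse, only meaningful on [dom]. *)
Record chart (R : realType) (M : topologicalType) := Chart {
  dom : set 'rV[R]_2;
  par : 'rV[R]_2 -> M;
  crd : M -> 'rV[R]_2;
  dom_open : open dom;
  img_open : open (par @` dom);
  parK : forall x, dom x -> crd (par x) = x;
  par_continuous : forall x, dom x -> {for x, continuous par};
  crd_continuous : forall m, (par @` dom) m -> {for m, continuous crd}
}.

Definition transition (R : realType) (M : topologicalType) (a b : chart R M) :
  'rV[R]_2 -> 'rV[R]_2 := crd b \o par a.

Definition overlap (R : realType) (M : topologicalType) (a b : chart R M) :
  set 'rV[R]_2 := [set x | dom a x /\ (par b @` dom b) (par a x)].

Definition compatible (R : realType) (M : topologicalType) (a b : chart R M) :=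
  smooth_on (overlap a b) (transition a b) /\
  smooth_on (overlap b a) (transition b a).

Record riemannian_surface (R : realType) (M : topologicalType) := Surface {
  surface_hausdorff : hausdorff_space M;
  surface_second_countable : @second_countable M;
  surface_connected : connected [set: M];
  atlas : set (chart R M);
  atlas_cover : forall m : M, exists2 a, atlas a & (par a @` dom a) m;
  atlas_compatible : forall a b, atlas a -> atlas b -> compatible a b;
  atlas_oriented : forall a b x, atlas a -> atlas b -> overlap a b x ->
    0 < \det (jacobian (transition a b) x);
  (* [metric a x] is the Gram matrix of the coordinate fields of the chart
     [a]; it is only meaningful when [a] is in the atlas and [dom a x]. *)
  metric : chart R M -> 'rV[R]_2 -> 'M[R]_2;
  metric_smooth : forall a, atlas a -> smooth_on (dom a) (metric a);
  metric_sym : forall a x, atlas a -> dom a x -> (metric a x)^T = metric a x;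
  metric_pos : forall a x (v : 'rV[R]_2), atlas a -> dom a x -> v != 0 ->
    0 < (v *m metric a x *m v^T) 0 0;
  metric_transition : forall a b x (v w : 'rV[R]_2),
    atlas a -> atlas b -> overlap a b x ->
    (v *m metric a x *m w^T) 0 0 =
    ('D_v (transition a b) x *m metric b (transition a b x)
      *m ('D_w (transition a b) x)^T) 0 0
}.

Definition lor (R : realType) (x y : 'rV[R]_5) : R :=
  \sum_(i < 4) x 0 (lift ord_max i) * y 0 (lift ord_max i)
  - x 0 ord_max * y 0 ord_max.

Definition H4 (R : realType) : set 'rV[R]_5 :=
  [set x | lor x x = -1 /\ 0 < x 0 ord_max].
Arguments H4 R : clear implicits.

Definition iota4 (R : realType) (p : H4 R) : 'rV[R]_5 := set_val p.

(* Orthogonal projection of [w] onto the tangent space of [H4] at [p]. *)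
Definition tanH (R : realType) (p w : 'rV[R]_5) : 'rV[R]_5 :=
  w + lor w p *: p.

(* Levi-Civita connection of [H4], for vector fields given on all of R^5_1 but
   tangent to [H4] along [H4]. *)
Definition nablaH (R : realType) (Y Z : 'rV[R]_5 -> 'rV[R]_5) (p : 'rV[R]_5) :=
  tanH p ('D_(Y p) Z p).

Definition lie_bracket (R : realType) (Y Z : 'rV[R]_5 -> 'rV[R]_5)
  (p : 'rV[R]_5) := 'D_(Y p) Z p - 'D_(Z p) Y p.

(* Curvature tensor R(y,z)w of [H4] at [p]: the tangent vectors y, z, w at [p]
   are extended to the vector fields q |-> [tanH q y], etc. *)
Definition curvH (R : realType) (p y z w : 'rV[R]_5) : 'rV[R]_5 :=
  let Y := fun q => tanH q y in
  let Z := fun q => tanH q z in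
  let W := fun q => tanH q w in
  nablaH Y (nablaH Z W) p - nablaH Z (nablaH Y W) p
  - nablaH (lie_bracket Y Z) W p.

(* The totally geodesic hypersurfaces of [H4] are the sets [H3 n] with
   [lor n n = 1]. *)
Definition H3 (R : realType) (n : 'rV[R]_5) : set 'rV[R]_5 :=
  H4 R `&` [set x | lor x n = 0].

(* In what follows, [X] is an immersion into [H4] and [G] the Gram matrix of the metric, both
   read in a chart. Tangent vectors of the surface are given by their
   coordinates, vectors tangent to [H4] as elements of R^5_1. *)

Definition ebase (R : realType) (i : 'I_2) : 'rV[R]_2 := delta_mx 0 i.

Definition pd (R : realType) (W : normedModType R) (i : 'I_2)
  (F : 'rV[R]_2 -> W) (x : 'rV[R]_2) : W := 'D_(ebase R i) F x.

Definition inner (R : realType) (G : 'rV[R]_2 -> 'M[R]_2) (x v w : 'rV[R]_2) :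
  R := (v *m G x *m w^T) 0 0.

(* Metric trace of a bilinear form given by its values on the coordinate
   fields. *)
Definition gtrace (R : realType) (W : lmodType R) (G : 'rV[R]_2 -> 'M[R]_2)
  (x : 'rV[R]_2) (b : 'I_2 -> 'I_2 -> W) : W :=
  \sum_i \sum_j invmx (G x) i j *: b i j.

(* Coordinates of the Levi-Civita derivative of the [j]-th coordinate field
   along the [i]-th one. *)
Definition christoffel (R : realType) (G : 'rV[R]_2 -> 'M[R]_2)
  (x : 'rV[R]_2) (i j : 'I_2) : 'rV[R]_2 :=
  \row_k (2^-1 * \sum_l invmx (G x) k l *
    (pd i (fun y => G y j l : R^o) x + pd j (fun y => G y i l : R^o) x
     - pd l (fun y => G y i j : R^o) x)).

Definition gradient (R : realType) (G : 'rV[R]_2 -> 'M[R]_2)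
  (h : 'rV[R]_2 -> R) (x : 'rV[R]_2) : 'rV[R]_2 :=
  \row_i \sum_j invmx (G x) i j * pd j (h : 'rV[R]_2 -> R^o) x.

(* Connection of the pulled-back bundle, for a section [V] along [X]. *)
Definition nablaX (R : realType) (X V : 'rV[R]_2 -> 'rV[R]_5)
  (v x : 'rV[R]_2) : 'rV[R]_5 := tanH (X x) ('D_v V x).

Definition sff_coord (R : realType) (X : 'rV[R]_2 -> 'rV[R]_5)
  (G : 'rV[R]_2 -> 'M[R]_2) (x : 'rV[R]_2) (i j : 'I_2) : 'rV[R]_5 :=
  nablaX X (pd j X) (ebase R i) x - 'D_(christoffel G x i j) X x.

Definition sff (R : realType) (X : 'rV[R]_2 -> 'rV[R]_5)
  (G : 'rV[R]_2 -> 'M[R]_2) (x v w : 'rV[R]_2) : 'rV[R]_5 :=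
  \sum_i \sum_j (v 0 i * w 0 j) *: sff_coord X G x i j.

Definition mean_curvature_field (R : realType) (X : 'rV[R]_2 -> 'rV[R]_5)
  (G : 'rV[R]_2 -> 'M[R]_2) (x : 'rV[R]_2) : 'rV[R]_5 :=
  2^-1 *: gtrace G x (sff_coord X G x).

Definition mean_curvature (R : realType) (X : 'rV[R]_2 -> 'rV[R]_5)
  (G : 'rV[R]_2 -> 'M[R]_2) (x : 'rV[R]_2) : R :=
  Num.sqrt (lor (mean_curvature_field X G x) (mean_curvature_field X G x)).

Definition tension (R : realType) (X : 'rV[R]_2 -> 'rV[R]_5)
  (G : 'rV[R]_2 -> 'M[R]_2) (x : 'rV[R]_2) : 'rV[R]_5 :=
  2 *: mean_curvature_field X G x.

(* The rough Laplacian of the section [V] along [X], with the sign convention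
   Laplacian = - trace (nabla nabla - nabla_nabla). *)
Definition laplacianX (R : realType) (X : 'rV[R]_2 -> 'rV[R]_5)
  (G : 'rV[R]_2 -> 'M[R]_2) (V : 'rV[R]_2 -> 'rV[R]_5) (x : 'rV[R]_2) :
  'rV[R]_5 :=
  - gtrace G x (fun i j =>
      nablaX X (nablaX X V (ebase R j)) (ebase R i) x
      - nablaX X V (christoffel G x i j) x).

Definition bitension (R : realType) (X : 'rV[R]_2 -> 'rV[R]_5)
  (G : 'rV[R]_2 -> 'M[R]_2) (x : 'rV[R]_2) : 'rV[R]_5 :=
  - laplacianX X G (tension X G) x
  - gtrace G x (fun i j =>
      curvH (X x) (pd i X x) (tension X G x) (pd j X x)).

(* Tangential and normal parts (with respect to the surface) of a vector [w]
   tangent to [H4] at [X x]. *)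
Definition tangent_part (R : realType) (X : 'rV[R]_2 -> 'rV[R]_5)
  (G : 'rV[R]_2 -> 'M[R]_2) (x : 'rV[R]_2) (w : 'rV[R]_5) : 'rV[R]_5 :=
  gtrace G x (fun i j => lor w (pd i X x) *: pd j X x).

Definition normal_part (R : realType) (X : 'rV[R]_2 -> 'rV[R]_5)
  (G : 'rV[R]_2 -> 'M[R]_2) (x : 'rV[R]_2) (w : 'rV[R]_5) : 'rV[R]_5 :=
  w - tangent_part X G x w.

Definition nabla_perp (R : realType) (X : 'rV[R]_2 -> 'rV[R]_5)
  (G : 'rV[R]_2 -> 'M[R]_2) (xi : 'rV[R]_2 -> 'rV[R]_5) (v x : 'rV[R]_2) :
  'rV[R]_5 := normal_part X G x (nablaX X xi v x).

(* Shape operator: the vector A with <A, w> = <B(v, w), xi> for all w. *)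
Definition shape (R : realType) (X : 'rV[R]_2 -> 'rV[R]_5)
  (G : 'rV[R]_2 -> 'M[R]_2) (x : 'rV[R]_2) (xi : 'rV[R]_5) (v : 'rV[R]_2) :
  'rV[R]_2 :=
  \row_i \sum_j invmx (G x) i j * lor (sff X G x v (ebase R j)) xi.

Definition E1 (R : realType) (X : 'rV[R]_2 -> 'rV[R]_5)
  (G : 'rV[R]_2 -> 'M[R]_2) (x : 'rV[R]_2) : 'rV[R]_2 :=
  let g := gradient G (mean_curvature X G) x in
  (Num.sqrt (inner G x g g))^-1 *: g.

Definition E3 (R : realType) (X : 'rV[R]_2 -> 'rV[R]_5)
  (G : 'rV[R]_2 -> 'M[R]_2) (x : 'rV[R]_2) : 'rV[R]_5 :=
  (mean_curvature X G x)^-1 *: mean_curvature_field X G x.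

(* [v2] and [n4] are the values at [x] of E_2 and E_4. The normal bundle is
   oriented so that a positive tangent frame followed by a positive normal
   frame and the position vector is a positive basis of R^5. *)
Definition positive_frames (R : realType) (X : 'rV[R]_2 -> 'rV[R]_5)
  (G : 'rV[R]_2 -> 'M[R]_2) (x v2 : 'rV[R]_2) (n4 : 'rV[R]_5) : Prop :=
  [/\ inner G x (E1 X G x) v2 = 0, inner G x v2 v2 = 1
    & 0 < \det (\matrix_(i < 2) [:: E1 X G x; v2]`_i)] /\
  [/\ lor n4 (X x) = 0, forall i, lor n4 (pd i X x) = 0,
      lor (E3 X G x) n4 = 0, lor n4 n4 = 1
    & 0 < \det (\matrix_(i < 5)
        [:: 'D_(E1 X G x) X x; 'D_v2 X x; E3 X G x; n4; X x]`_i)].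

Section PNMC.
Context (R : realType) (M : topologicalType) (S : riemannian_surface R M).
Implicit Type phi : M -> H4 R.

Definition local_rep phi (a : chart R M) : 'rV[R]_2 -> 'rV[R]_5 :=
  @iota4 R \o phi \o par a.

Definition isometric_immersion phi : Prop :=
  forall a, atlas S a ->
    smooth_on (dom a) (local_rep phi a) /\
    forall x, dom a x ->
      (forall v, 'D_v (local_rep phi a) x = 0 -> v = 0) /\
      (forall v w, lor ('D_v (local_rep phi a) x) ('D_w (local_rep phi a) x) =
                   inner (metric S a) x v w).

Definition pnmc_biconservative phi : Prop :=
  isometric_immersion phi /\
  (forall a x, atlas S a -> dom a x ->
    let X := local_rep phi a in
    let G := metric S a in
    [/\ tangent_part X G x (bitension X G x) = 0,
        0 < mean_curvature X G x,
        gradient G (mean_curvature X G) x != 0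
      & forall v, nabla_perp X G (E3 X G) v x = 0]) /\
  (forall U : set M, open U -> U !=set0 ->
    forall n, lor n n = 1 -> ~ (forall m, U m -> H3 n (iota4 (phi m)))).

Definition radicand (c C f : R) : R :=
  1 + 9 * C * f `^ (3 / 2) - 9 * f ^+ 2 - c ^+ 2 * f ^+ 3.

Definition attached_constants phi (c C : R) : Prop :=
  c != 0 /\
  forall a x, atlas S a -> dom a x ->
    let X := local_rep phi a in
    let G := metric S a in
    let f := mean_curvature X G in
    [/\ forall v2 n4, positive_frames X G x v2 n4 ->
          shape X G x n4 (E1 X G x) = (c * f x `^ (3 / 2)) *: E1 X G x /\
          shape X G x n4 v2 = - (c * f x `^ (3 / 2)) *: v2,
        'D_(E1 X G x) (f : 'rV[R]_2 -> R^o) x =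
          4 / 3 * f x * Num.sqrt (radicand c C (f x))
      & 0 < 'D_(E1 X G x) (f : 'rV[R]_2 -> R^o) x].

End PNMC.

(* Covariant derivative in [H3 n], [lor n n = 1], of the field [V] along the
   curve [s]. *)
Definition covD (R : realType) (n : 'rV[R]_5) (s V : R -> 'rV[R]_5) (u : R) :
  'rV[R]_5 :=
  let W := tanH (s u) (derive1 V u) in W - lor W n *: n.

Definition frenet_curvature (R : realType) (n : 'rV[R]_5) (s : R -> 'rV[R]_5)
  (u : R) : R :=
  let A := covD n s (derive1 s) u in Num.sqrt (lor A A).

Definition frenet_normal (R : realType) (n : 'rV[R]_5) (s : R -> 'rV[R]_5)
  (u : R) : 'rV[R]_5 :=
  (frenet_curvature n s u)^-1 *: covD n s (derive1 s) u.

(* The non-negative torsion: the norm of N' + kappa T. *)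
Definition frenet_torsion (R : realType) (n : 'rV[R]_5) (s : R -> 'rV[R]_5)
  (u : R) : R :=
  let A := covD n s (frenet_normal n s) u
           + frenet_curvature n s u *: derive1 s u in
  Num.sqrt (lor A A).

(* Main.v *)
(* Let E1, E2, E3, E4 be the adapted frame, X the position vector, A_4 = diag(m, -m)
   and p = sqrt(1 + 9 C f^(3/2) - 9 f^2 - c^2 f^3). Comparing the components of
   D_1 D_2 - D_2 D_1 = D_[E1, E2] applied to E4 shows that the integral curves of E1
   are geodesics of M, that those of E2 have geodesic curvature -p, and that A_3 is
   diagonal. The equations of Gauss and Codazzi, together with the equation satisfied by
   f, then leave <A_3 E1, E1> = -f as the only possibility. Hence E2 is constant along
   E1, while D_2 E2 = k n and D_2 n = -k E2 for the unit vector field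
   n = (p E1 + 3 f E3 - m E4 + X) / k, with k = 3 sqrt(C) f^(3/4), and n is constant
   along E1 as well. Thus E2 and n rotate in the fixed plane spanned by their values
   b1 = E2 and -b2 = n at the given point. The angle t of this rotation and the arc
   length u of the integral curves of E1 are local coordinates on M, and X + n / k
   depends on u only, which is the parametrization. The curve t = 0 is an integral curve
   of E1 orthogonal to b1, with Frenet data read off from the structure equations. *)

Require Import Defs.
From HB Require Import structures.
From mathcomp Require Import all_boot all_order all_algebra.
From mathcomp Require Import all_classical all_reals all_analysis.
From mathcomp Require Import ring lra.
Import Order.TTheory GRing.Theory Num.Theory.
Import numFieldNormedType.Exports.
Local Open Scope classical_set_scope.
Local Open Scope ring_scope.

Set Implicit Arguments.
Unset Strict Implicit.
Unset Printing Implicit Defensive.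

(** * Smooth maps between normed spaces *)

Section SmoothMaps.
Context {R : realType}.
Implicit Types V W : normedModType R.

(** No flow of a vector field is used to build the coordinates. The forms dual to E1 and to E2 / k
    are locally exact with explicit primitives: f satisfies an autonomous equation along E1 and is
    constant along E2, so the arc length is an antiderivative evaluated at f, and the angle is asin
    <E2, n(x0)>. The inverse function theorem turns this pair into a chart. The value of k comes
    from D_2 E2 = p E1 + 3 f E3 - m E4 + X, whose square is p^2 + 9 f^2 + m^2 - 1 = 9 C f^(3/2), all
    other terms of the radicand cancelling; C > 0 makes D_2 E2 spacelike. Moreover D_1 (D_2 E2) = p
    D_2 E2 and E1 k = p k, so the quotient n is constant along E1. One obstacle is that E4 is given
    only point by point, through an orientation. It becomes a differentiable field as the normal
    remainder of D_1 E1 divided by m, which is non-zero because c is. Another is that the new chart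
    need not lie in the atlas carrying the metric; f is therefore compared across atlas charts, by
    testing mean curvature vectors against normal vectors, which removes the Christoffel symbols. *)

Lemma diff_approx V W (f : V -> W) (x : V) (df : {linear V -> W}) :
  continuous df ->
  (forall e, 0 < e -> \forall h \near (0 : V),
     `|f (h + x) - f x - df h| <= e * `|h|) ->
  differentiable f x /\ forall v, 'D_v f x = df v.
Proof.
move=> cdf fE.
have H : f \o shift x = cst (f x) + df +o_ (0 : V) id.
  apply/eqaddoP => e e0; near=> h => /=.
  rewrite /cst /= [X in `|X|](_ : _ = f (h + x) - f x - df h) ?opprD ?addrA //.
  by near: h; exact: fE.
have Ed := diff_unique cdf H.
suff dfx : differentiable f x by split=> // v; rewrite deriveE // Ed.
by apply/diff_locallyP; rewrite Ed.
Unshelve. all: by end_near. Qed.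

Lemma diff_err V W (f : V -> W) (x : V) : differentiable f x ->
  forall e, 0 < e -> \forall h \near (0 : V),
     `|f (h + x) - f x - 'D_h f x| <= e * `|h|.
Proof.
move=> dfx e e0; have /eqaddoP/(_ e e0) := diff_locally dfx.
apply: filterS => h /=.
by rewrite deriveE // [X in `|X|](_ : _ = f (h + x) - f x - 'd f x h) //= opprD addrA.
Qed.

Lemma near_differentiable V W (f g : V -> W) (x : V) :
  (\near x, f x = g x) -> differentiable f x -> differentiable g x.
Proof.
move=> fg dfx.
apply: (proj1 (@diff_approx V W g x ('d f x) _ _)); first exact: diff_continuous.
move=> e e0; have := diff_err dfx e0.
have fgx : f x = g x by exact: (nbhs_singleton fg).
move: fg; rewrite (near_shift 0 x) => fg.
apply: filterS2 fg => h /=; rewrite subr0 => ->.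
by rewrite fgx deriveE.
Qed.

Lemma deriveDv V W (f : V -> W) (x v w : V) : differentiable f x ->
  'D_(v + w) f x = 'D_v f x + 'D_w f x.
Proof. by move=> df; rewrite !deriveE // linearD. Qed.

Lemma deriveZv V W (f : V -> W) (x v : V) (k : R) : differentiable f x ->
  'D_(k *: v) f x = k *: 'D_v f x.
Proof. by move=> df; rewrite !deriveE // linearZ. Qed.

Lemma derive_sumv n V W (f : V -> W) (x : V) (k : 'I_n -> R) (v : 'I_n -> V) :
  differentiable f x ->
  'D_(\sum_i k i *: v i) f x = \sum_i k i *: 'D_(v i) f x.
Proof.
by move=> df; rewrite deriveE // linear_sum; apply: eq_bigr => i _; rewrite linearZ deriveE.
Qed.

Lemma derive_comp (U V W : normedModType R) (g : U -> V) (f : V -> W) (x v : U) :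
  differentiable g x -> differentiable f (g x) ->
  'D_v (f \o g) x = 'D_('D_v g x) f (g x).
Proof.
move=> dg df; have dfg : differentiable (f \o g) x by exact: differentiable_comp.
by rewrite (deriveE v dfg) (deriveE v dg) (deriveE _ df) diff_comp.
Qed.

Lemma Ck_onW V W k U (f : V -> W) : Ck_on k.+1 U f -> Ck_on k U f.
Proof.
elim: k f => [|k IH] f [df Df] /=.
  by move=> x Ux; apply: differentiable_continuous; exact: df.
by split=> // v; apply: IH; exact: Df.
Qed.

Lemma Ck_onS V W k U U' (f : V -> W) : U' `<=` U -> Ck_on k U f -> Ck_on k U' f.
Proof.
move=> UU; elim: k f => [|k IH] f /=; first by move=> cf x /UU; exact: cf.
by move=> [df Df]; split=> [x /UU|v]; [exact: df|apply: IH; exact: Df].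
Qed.

Lemma Ck_on_eq V W k U (f g : V -> W) : open U -> (forall x, U x -> f x = g x) ->
  Ck_on k U f -> Ck_on k U g.
Proof.
move=> oU; elim: k f g => [|k IH] f g fg /=.
  move=> cf x Ux; rewrite /prop_for /continuous_at -fg //.
  apply: cvg_trans (cf x Ux); apply: near_eq_cvg.
  by apply: filterS (open_nbhs_nbhs (conj oU Ux)) => y /fg.
move=> [df Df]; split=> [x Ux|v].
  apply: near_differentiable (df x Ux).
  by apply: filterS (open_nbhs_nbhs (conj oU Ux)) => y /fg.
apply: IH (Df v) => x Ux; apply: near_eq_derive.
by apply: filterS (open_nbhs_nbhs (conj oU Ux)) => y /fg.
Qed.

(** Off [U] the derivative may be anything, so a formula for it can be demanded on [U] only. This is
    the induction step of the closure properties below. *)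
Lemma Ck_onSE V W k U (f : V -> W) (Df : V -> V -> W) : open U ->
  (forall x, U x -> differentiable f x) ->
  (forall v x, U x -> 'D_v f x = Df v x) ->
  (forall v, Ck_on k U (Df v)) -> Ck_on k.+1 U f.
Proof.
move=> oU df DfE CDf; split=> // v; apply: Ck_on_eq (CDf v) => // x Ux.
by rewrite DfE.
Qed.

Lemma Ck_on_cst V W k U (a : W) : Ck_on k U (fun _ : V => a).
Proof.
(* [U] is arbitrary here, whereas [Ck_onSE] needs an open set; hence the passage to the whole
   space. *)
apply: (@Ck_onS _ _ _ setT) => //.
elim: k a => [|k IH] a; first by move=> x _; exact: cst_continuous.
apply: (@Ck_onSE _ _ _ _ _ (fun v x => 0)) => [|x _|v x _|v].
- exact: openT.
- exact: differentiable_cst.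
- exact: derive_cst.
- exact: IH.
Qed.

Lemma Ck_onD V W k U (f g : V -> W) : open U -> Ck_on k U f -> Ck_on k U g ->
  Ck_on k U (fun x => f x + g x).
Proof.
move=> oU; elim: k f g => [|k IH] f g.
  by move=> cf cg x Ux; apply: cvgD; [exact: cf|exact: cg].
move=> [df Df] [dg Dg].
apply: (@Ck_onSE _ _ _ _ _ (fun v x => 'D_v f x + 'D_v g x)) => // [x Ux|v x Ux|v].
- by apply: differentiableD; [exact: df|exact: dg].
- by rewrite deriveD //; apply: diff_derivable; [exact: df|exact: dg].
- by apply: IH; [exact: Df|exact: Dg].
Qed.

Lemma Ck_on_sum V W k U n (f : 'I_n -> V -> W) : open U ->
  (forall i, Ck_on k U (f i)) -> Ck_on k U (fun x => \sum_i f i x).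
Proof.
move=> oU; elim: n f => [|n IH] f Cf.
  by rewrite (_ : (fun x => _) = fun=> 0) ?funeqE => [|x]; [exact: Ck_on_cst|rewrite big_ord0].
rewrite (_ : (fun x => _) = fun x => f ord0 x + \sum_i f (lift ord0 i) x).
  by apply: Ck_onD => //; apply: IH.
by apply/funext => x; rewrite big_ord_recl.
Qed.

Lemma derivable_mx_coord V m n (f : V -> 'M[R]_(m, n)) (x v : V) i j :
  differentiable f x -> 'D_v (fun x => f x i j : R^o) x = 'D_v f x i j.
Proof.
by move=> df; rewrite derive_mx ?mxE //; exact: diff_derivable.
Qed.

Lemma differentiable_mx_coord V m n (f : V -> 'M[R]_(m, n)) (x : V) i j :
  differentiable f x -> differentiable (fun x => f x i j : R^o) x.
Proof.
move=> df; apply: (@differentiable_comp _ _ _ _ f (fun N => N i j)) => //.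
exact: differentiable_coord.
Qed.

Lemma differentiable_mx V m n (f : V -> 'M[R]_(m, n)) (x : V) :
  (forall i j, differentiable (fun x => f x i j : R^o) x) -> differentiable f x.
Proof.
move=> df.
rewrite (_ : f = \sum_(i < m) (fun y => \sum_(j < n) f y i j *: delta_mx i j)).
  apply: differentiable_sum => i.
  rewrite (_ : (fun y => _) = \sum_(j < n) (fun y => f y i j *: delta_mx i j)).
    by apply: differentiable_sum => j; apply: differentiableZl; exact: df.
  by apply/funext => y; rewrite fct_sumE.
by apply/funext => y; rewrite fct_sumE; exact: matrix_sum_delta.
Qed.

Lemma Ck_on_coord V m n k U (f : V -> 'M[R]_(m, n)) i j : open U ->
  Ck_on k U f -> Ck_on k U (fun x => f x i j : R^o).
Proof.
move=> oU; elim: k f => [|k IH] f.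
  move=> cf x Ux; apply: (@continuous_comp _ _ _ f (fun N => N i j)); first exact: cf.
  exact: coord_continuous.
move=> [df Df]; apply: (@Ck_onSE _ _ _ _ _ (fun v x => 'D_v f x i j)) => // [x Ux|v x Ux|v].
- by apply: differentiable_mx_coord; exact: df.
- by apply: derivable_mx_coord; exact: df.
- by apply: IH; exact: Df.
Qed.

Lemma Ck_on_mx V m n k U (f : V -> 'M[R]_(m, n)) : open U ->
  (forall i j, Ck_on k U (fun x => f x i j : R^o)) -> Ck_on k U f.
Proof.
move=> oU; elim: k f => [|k IH] f Cf.
  move=> x Ux; apply/cvgrPdist_le => e e0.
  near=> y.
  rewrite [leLHS]/Num.Def.normr /= mx_normrE (bigmax_le _ (ltW e0)) // => -[i j] _ /=.
  rewrite !mxE; move: (i) (j); near: y.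
  apply: filter_forall => i'; apply: filter_forall => j'.
  exact: ((cvgrPdist_le _ _).1 (Cf i' j' x Ux)).
have df x : U x -> differentiable f x.
  by move=> Ux; apply: differentiable_mx => i j; have [+ _] := Cf i j; apply.
split=> // v; apply: IH => i j.
have [_ /(_ v)] := Cf i j; apply: Ck_on_eq => // x Ux.
by rewrite derivable_mx_coord //; exact: df.
Unshelve. all: by end_near. Qed.

(** Scaling is a continuous bilinear map; once it is packaged as one, the product rule is the chain
    rule for it and a pair of maps. *)
Lemma differentiable_scale V W (f : V -> R^o) (g : V -> W) (x : V) :
  differentiable f x -> differentiable g x ->
  differentiable (fun x => f x *: g x) x /\
  forall v, 'D_v (fun x => f x *: g x) x = 'D_v f x *: g x + f x *: 'D_v g x.
Proof.
move=> df dg.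
have bilin : bilinear_for (GRing.Scale.Law.clone _ _ *:%R _)
    (GRing.Scale.Law.clone _ _ *:%R _) (fun (a : R^o) (w : W) => a *: w).
  split=> [w|k] a y z /=; first by rewrite scalerDl scalerA.
  by rewrite scalerDr !scalerA mulrC.
pose bM := bilinear_isBilinear.Build R R^o W W _ _ (fun (a : R^o) (w : W) => a *: w) bilin.
pose b : {bilinear R^o -> W -> W} := HB.pack (fun (a : R^o) (w : W) => a *: w) bM.
have cb : continuous (fun p : R^o * W => b p.1 p.2) by move=> p; exact: scale_continuous.
have dp := differentiable_pair df dg.
have db := @differentiable_bilin _ _ _ _ b (f x, g x) cb.
rewrite (_ : (fun x => f x *: g x) = (fun p : R^o * W => b p.1 p.2) \o (fun y => (f y, g y))) //.
split=> [|v]; first exact: differentiable_comp.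
rewrite derive_comp // (deriveE _ db) (diff_bilin _ cb) (deriveE _ dp) (diff_pair df dg) /=.
by rewrite !deriveE // addrC.
Qed.

Lemma Ck_onZ V W k U (f : V -> R^o) (g : V -> W) : open U ->
  Ck_on k U f -> Ck_on k U g -> Ck_on k U (fun x => f x *: g x).
Proof.
move=> oU; elim: k f g => [|k IH] f g.
  by move=> cf cg x Ux; apply: cvgZ; [exact: cf|exact: cg].
move=> Cf Cg; have [df Df] := Cf; have [dg Dg] := Cg.
apply: (@Ck_onSE _ _ _ _ _ (fun v x => 'D_v f x *: g x + f x *: 'D_v g x)) => // [x Ux|v x Ux|v].
- by have [] := differentiable_scale (df _ Ux) (dg _ Ux).
- by have [_ ->] := differentiable_scale (df _ Ux) (dg _ Ux).
- by apply: Ck_onD => //; apply: IH => //; [exact: Df|exact: Ck_onW|exact: Ck_onW|exact: Dg].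
Qed.

Lemma Ck_onM V k U (f g : V -> R^o) : open U -> Ck_on k U f -> Ck_on k U g ->
  Ck_on k U (fun x => f x * g x : R^o).
Proof. exact: Ck_onZ. Qed.

Lemma Ck_onV V k U (f : V -> R^o) : open U -> (forall x, U x -> f x != 0) ->
  Ck_on k U f -> Ck_on k U (fun x => (f x)^-1 : R^o).
Proof.
move=> oU f0; elim: k => [|k IH].
  by move=> cf x Ux; apply: cvgV; [exact: f0|exact: cf].
move=> Cf; have [df Df] := Cf.
(* The derivative is written with products of inverses instead of a square, so that the induction
   hypothesis and closure under products cover it. *)
apply: (@Ck_onSE _ _ _ _ _ (fun v x => -1 * ((f x)^-1 * (f x)^-1) * 'D_v f x)) => // [x Ux|v x Ux|v].
- by apply: differentiableV; [exact: df|exact: f0].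
- rewrite deriveV; [|exact: f0|by apply: diff_derivable; exact: df].
  by rewrite scaleNr expr2 invfM mulN1r mulNr.
- have Ci : Ck_on k U (fun x => (f x)^-1 : R^o) by apply: IH; exact: Ck_onW.
  by apply: Ck_onM (Df v) => //; apply: Ck_onM => //; [exact: Ck_on_cst|exact: Ck_onM].
Qed.

Lemma differentiable_comp1 V (f : V -> R^o) (g : R^o -> R^o) (x : V) (dg : R) :
  differentiable f x -> is_derive (f x) 1 g dg ->
  differentiable (fun x => g (f x) : R^o) x /\
  forall v, 'D_v (fun x => g (f x) : R^o) x = dg * 'D_v f x.
Proof.
move=> df [dg1 dgE].
have Dg : differentiable g (f x) by exact/derivable1_diffP.
split=> [|v]; first exact: (@differentiable_comp _ _ _ _ f g).
rewrite [LHS](derive_comp v df Dg) -[X in 'D_X g _](_ : 'D_v f x *: (1 : R^o) = _).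
  by rewrite deriveZv // dgE mulrC.
by rewrite /GRing.scale /= mulr1.
Qed.

Lemma Ck_on_sqrt V k U (f : V -> R^o) : open U -> (forall x, U x -> 0 < f x) ->
  Ck_on k U f -> Ck_on k U (fun x => Num.sqrt (f x) : R^o).
Proof.
move=> oU f0; elim: k => [|k IH].
  move=> cf x Ux; apply: (@continuous_comp _ _ _ f (@Num.sqrt R)); first exact: cf.
  exact: sqrt_continuous.
move=> Cf; have [df Df] := Cf.
have DE x : U x -> _ := fun Ux => differentiable_comp1 (df x Ux) (is_derive1_sqrt (f0 x Ux)).
apply: (@Ck_onSE _ _ _ _ _ (fun v x => (2 * Num.sqrt (f x))^-1 * 'D_v f x)) => // [x Ux|v x Ux|v].
- by have [] := DE x Ux.
- by have [_ ->] := DE x Ux.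
- apply: Ck_onM (Df v) => //; apply: Ck_onV => // [x Ux|].
    by rewrite mulf_neq0 ?pnatr_eq0 // gt_eqF // sqrtr_gt0 f0.
  by apply: Ck_onM => //; [exact: Ck_on_cst|apply: IH; exact: Ck_onW].
Qed.

Lemma derive_rv m W (f : 'rV[R]_m -> W) (x v : 'rV[R]_m) : differentiable f x ->
  'D_v f x = \sum_i v 0 i *: 'D_(delta_mx 0 i) f x.
Proof. by move=> df; rewrite {1}(row_sum_delta v) derive_sumv. Qed.

Lemma Ck_on_comp V m W k U U' (g : V -> 'rV[R]_m) (f : 'rV[R]_m -> W) :
  open U -> open U' -> (forall x, U x -> U' (g x)) ->
  Ck_on k U g -> Ck_on k U' f -> Ck_on k U (f \o g).
Proof.
move=> oU oU' gU; elim: k f => [|k IH] f.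
  move=> cg cf x Ux; apply: continuous_comp; first exact: cg.
  by apply: cf; exact: gU.
move=> Cg [df Df]; have [dg Dg] := Cg.
(* The chain rule differentiates [f] in the moving direction ['D_v g x], while [Ck_on] controls
   fixed directions; expanding on the basis reconciles the two. *)
apply: (@Ck_onSE _ _ _ _ _ (fun v x => \sum_i ('D_v g x) 0 i *: ('D_(delta_mx 0 i) f \o g) x)) => // [x Ux|v x Ux|v].
- by apply: differentiable_comp; [exact: dg|apply: df; exact: gU].
- rewrite derive_comp; [|exact: dg|by apply: df; exact: gU].
  by rewrite derive_rv //; apply: df; exact: gU.
- apply: Ck_on_sum => // i; apply: Ck_onZ => //.
    by apply: Ck_on_coord => //; exact: Dg.
  by apply: IH; [exact: Ck_onW|exact: Df].
Qed.

End SmoothMaps.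

(** * Mean value theorem and symmetry of second derivatives *)

Section MeanValue.
Context {R : realType}.
Implicit Types V W : normedModType R.

Lemma differentiable_line V (p v : V) (r : R^o) :
  differentiable (fun r : R^o => p + r *: v) r /\ 'D_1 (fun r : R^o => p + r *: v) r = v.
Proof.
have d1 : differentiable (fun=> p : V) r by exact: differentiable_cst.
have did : differentiable (id : R^o -> R^o) r by exact: ex_diff.
have [d2 E2] := differentiable_scale did (differentiable_cst v r).
split; first exact: differentiableD.
rewrite deriveD ?derive_cst ?add0r; [|exact: diff_derivable..].
by rewrite E2 derive_id derive_cst scaler0 addr0 scale1r.
Qed.

Lemma is_derive_line V W (f : V -> W) (p v : V) (r : R^o) :
  differentiable f (p + r *: v) ->
  is_derive r 1 (fun r : R^o => f (p + r *: v)) ('D_v f (p + r *: v)).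
Proof.
move=> df; have [dl El] := differentiable_line p v r.
split; first by apply: diff_derivable; exact: (differentiable_comp dl df).
by rewrite [LHS](derive_comp _ dl df) El.
Qed.

Lemma MVT_line V (f : V -> R^o) (p v : V) (s : R) : 0 <= s ->
  (forall r, 0 <= r <= s -> differentiable f (p + r *: v)) ->
  exists r, 0 <= r <= s /\ f (p + s *: v) - f p = s * 'D_v f (p + r *: v).
Proof.
move=> s0 df.
have D (r : R^o) : 0 <= r <= s -> is_derive r 1 (fun r : R^o => f (p + r *: v)) ('D_v f (p + r *: v)).
  by move=> rs; apply: is_derive_line; exact: df.
have [r rs0||r rs] := @MVT_segment R (fun r => f (p + r *: v)) (fun r => 'D_v f (p + r *: v)) 0 s s0.
- by apply: D; move: rs0; rewrite in_itv /= => /andP[/ltW -> /ltW ->].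
- by apply: derivable_within_continuous => r; rewrite in_itv /= => /D [].
rewrite scale0r addr0 subr0 mulrC => E.
by exists r; move: rs; rewrite in_itv.
Qed.

(** Two mean value steps: along [v] for the increment of [f] by [s *: w], then along [w] for the
    resulting derivative. The second difference is symmetric in [v] and [w], which is what equates
    the mixed derivatives. *)
Lemma second_difference V (U : set V) (f : V -> R^o) (x v w : V) (s : R) :
  0 <= s -> (forall a b, 0 <= a <= s -> 0 <= b <= s -> U (x + a *: v + b *: w)) ->
  (forall x, U x -> differentiable f x) ->
  (forall x, U x -> differentiable ('D_v f : V -> R^o) x) ->
  exists a b, [/\ 0 <= a <= s, 0 <= b <= s &
    f (x + s *: v + s *: w) - f (x + s *: v) - f (x + s *: w) + f x
      = s ^+ 2 * 'D_w ('D_v f) (x + a *: v + b *: w)].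
Proof.
move=> s0 UU df dDf.
have ss : 0 <= s <= s by rewrite s0 lexx.
have zs : 0 <= (0 : R) <= s by rewrite s0 lexx.
have dg y : U y -> U (y + s *: w) -> differentiable (fun y => f (y + s *: w) - f y) y /\
   'D_v (fun y => f (y + s *: w) - f y) y = 'D_v f (y + s *: w) - 'D_v f y.
  move=> Uy Uyw.
  have ds : differentiable (fun y => y + s *: w) y by apply: differentiableD.
  have dfs : differentiable (fun y => f (y + s *: w)) y.
    by apply: (differentiable_comp ds); exact: df.
  split; first by apply: differentiableB => //; exact: df.
  rewrite deriveB; [|by apply: diff_derivable..|by apply: diff_derivable; exact: df].
  rewrite [in LHS](derive_comp _ ds) ?deriveD ?derive_id ?derive_cst ?addr0 //; exact: df.
have [|a [a0s Ea]] := @MVT_line V (fun y => f (y + s *: w) - f y) x v s s0.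
  move=> r rs; have Ur : U (x + r *: v) by have := UU r 0 rs zs; rewrite scale0r addr0.
  by have [] := dg _ Ur (UU _ _ rs ss).
have [|b [b0s Eb]] := @MVT_line V ('D_v f) (x + a *: v) w s s0.
  by move=> r rs; apply: dDf; exact: UU.
exists a, b; split => //.
have Ua : U (x + a *: v) by have := UU a 0 a0s zs; rewrite scale0r addr0.
have [_ Ed] := dg _ Ua (UU _ _ a0s ss).
by rewrite expr2 -mulrA -Eb -Ed -Ea; ring.
Qed.

Lemma Ck_on_differentiable V W k (U : set V) (f : V -> W) x :
  Ck_on k.+1 U f -> U x -> differentiable f x.
Proof. by case=> + _; apply. Qed.

Lemma Ck_on_derive V W k (U : set V) (f : V -> W) v :
  Ck_on k.+1 U f -> Ck_on k U ('D_v f).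
Proof. by move=> [_ +]; apply. Qed.

Lemma Ck_on_continuous V W k (U : set V) (f : V -> W) x :
  Ck_on k U f -> U x -> {for x, continuous f}.
Proof. by elim: k f => [|k IH] f; [exact|move/Ck_onW; exact: IH]. Qed.

(** If the values differed at [x], disjoint neighbourhoods would separate them. The points [y] and
    [z] are independent because two intermediate points of the mean value theorem are not known to
    coincide. *)
Lemma eq_of_meeting_values V W (A B : V -> W) (x : V) :
  {for x, continuous A} -> {for x, continuous B} ->
  (forall P, nbhs x P -> exists y z, [/\ P y, P z & A y = B z]) -> A x = B x.
Proof.
move=> cA cB AB; apply: (@norm_hausdorff _ W) => U1 U2 nU1 nU2.
have n1 : nbhs x (A @^-1` U1) := cA _ nU1.
have n2 : nbhs x (B @^-1` U2) := cB _ nU2.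
have n12 : nbhs x (A @^-1` U1 `&` B @^-1` U2) by exact: (filterI n1 n2).
have [y [z [[yU _] [_ zU] yz]]] := AB _ n12.
by exists (A y); split=> //; rewrite yz.
Qed.

Lemma derive_sym_scalar V (U : set V) (f : V -> R^o) (x v w : V) : open U -> U x ->
  Ck_on 2 U f -> 'D_v ('D_w f) x = 'D_w ('D_v f) x.
Proof.
move=> oU Ux Cf.
have df y : U y -> differentiable f y by exact: Ck_on_differentiable Cf.
have dDf u y : U y -> differentiable ('D_u f : V -> R^o) y.
  by apply: Ck_on_differentiable (Ck_on_derive u Cf).
have cDD u1 u2 : {for x, continuous ('D_u1 ('D_u2 f) : V -> R^o)}.
  exact: Ck_on_continuous (Ck_on_derive u1 (Ck_on_derive u2 Cf)) Ux.
apply: (@eq_of_meeting_values V R^o ('D_v ('D_w f)) ('D_w ('D_v f))) => // P nP.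
have PU : nbhs x (U `&` P) by exact: (filterI (open_nbhs_nbhs (conj oU Ux)) nP).
have [r /= r0 rP] := (nbhs_ballP _ _).1 PU.
(* Keeps the parallelogram with sides [s *: v] and [s *: w] inside the ball; the added 1 makes the
   bound strict and covers [v = w = 0]. *)
pose s := r / (`|v| + `|w| + 1).
have dn0 : 0 < `|v| + `|w| + 1 by rewrite ltr_pwDr // addr_ge0.
have s0 : 0 < s by rewrite divr_gt0.
have inb a b : 0 <= a <= s -> 0 <= b <= s -> ball x r (x + a *: v + b *: w).
  move=> /andP[a0 a_s] /andP[b0 bs].
  rewrite -ball_normE /= opprD opprD !addrA subrr sub0r -opprD normrN.
  apply: le_lt_trans (ler_normD _ _) _; rewrite !normrZ !ger0_norm //.
  apply: (@le_lt_trans _ _ (s * (`|v| + `|w|))).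
    by rewrite mulrDr lerD // ler_wpM2r.
  by rewrite /s mulrAC ltr_pdivrMr // ltr_pM2l // ltrDl.
have [a [b [a_s b_s E1]]] : exists a b, _ :=
  @second_difference V U f x v w s (ltW s0) (fun a b h1 h2 => (rP _ (inb a b h1 h2)).1) df (dDf v).
have inb' c d : 0 <= c <= s -> 0 <= d <= s -> ball x r (x + c *: w + d *: v).
  by move=> cs ds; rewrite addrAC; exact: inb.
have [c [d [c_s d_s E2]]] : exists a b, _ :=
  @second_difference V U f x w v s (ltW s0) (fun a b h1 h2 => (rP _ (inb' a b h1 h2)).1) df (dDf w).
exists (x + c *: w + d *: v), (x + a *: v + b *: w); split.
- exact: (rP _ (inb' c d c_s d_s)).2.
- exact: (rP _ (inb a b a_s b_s)).2.
apply: (@mulfI _ (s ^+ 2)); first by rewrite expf_neq0 // gt_eqF.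
apply: etrans (etrans (esym E2) _) E1.
by rewrite (addrAC x (s *: w)) [X in X + _ = _]addrAC.
Qed.

Lemma derive_sym V m n (U : set V) (f : V -> 'M[R]_(m, n)) (x v w : V) : open U -> U x ->
  Ck_on 2 U f -> 'D_v ('D_w f) x = 'D_w ('D_v f) x.
Proof.
move=> oU Ux Cf; apply/matrixP => i j.
have dD u : differentiable ('D_u f) x.
  exact: Ck_on_differentiable (Ck_on_derive u Cf) Ux.
have E u1 u2 : 'D_u1 ('D_u2 f) x i j = 'D_u1 ('D_u2 (fun z => f z i j : R^o)) x.
  apply: etrans (esym (derivable_mx_coord _ _ _ (dD u2))) _.
  apply: near_eq_derive.
  apply: filterS (open_nbhs_nbhs (conj oU Ux)) => y Uy.
  by apply/esym/derivable_mx_coord; exact: Ck_on_differentiable Cf Uy.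
apply: etrans (E v w) (etrans _ (esym (E w v))).
by apply: (derive_sym_scalar v w oU Ux); exact: Ck_on_coord.
Qed.
End MeanValue.

(** * Convexity of balls and Lipschitz estimates *)

Section Balls.
Context {R : realType}.
Implicit Types V W : normedModType R.

Lemma ball_segment V (x0 x y : V) (e r : R) : ball x0 e x -> ball x0 e y ->
  0 <= r <= 1 -> ball x0 e (y + r *: (x - y)).
Proof.
rewrite -!ball_normE /= => xe ye /andP[r0 r1].
rewrite (_ : x - y = (x0 - y) - (x0 - x)); last by rewrite opprB [RHS]addrC subrKA.
rewrite opprD addrA; set a := x0 - y in ye *; set b := x0 - x in xe *.
rewrite [X in `|X|](_ : _ = (1 - r) *: a + r *: b); last first.
  by rewrite scalerBr opprB scalerBl scale1r (addrC (r *: b)) addrA.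
apply: le_lt_trans (ler_normD _ _) _; rewrite !normrZ !ger0_norm ?subr_ge0 //.
have [M [Me aM bM]] : exists M, [/\ M < e, `|a| <= M & `|b| <= M].
  by exists (Num.max `|a| `|b|); rewrite gt_max ye xe !le_max !lexx orbT.
apply: le_lt_trans Me; rewrite [leRHS](_ : M = (1 - r) * M + r * M); last by ring.
by rewrite lerD // ler_wpM2l // subr_ge0.
Qed.

Lemma normr_coord m n (A : 'M[R]_(m, n)) i j : `|A i j| <= `|A|.
Proof.
rewrite [leRHS]/Num.Def.normr /= mx_normrE.
exact: (le_bigmax _ (fun k => `|A k.1 k.2|) (i, j)).
Qed.

Lemma normr_mx_le m n (A : 'M[R]_(m, n)) (e : R) : 0 <= e ->
  (forall i j, `|A i j| <= e) -> `|A| <= e.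
Proof.
move=> e0 Ae; rewrite [leLHS]/Num.Def.normr /= mx_normrE bigmax_le // => -[i j] _ /=.
Qed.

(** The norm of a matrix is the maximum over its entries, so the scalar mean value theorem, with its
    own intermediate point for each entry, loses no constant. *)
Lemma lipschitz_ball V m n (f : V -> 'M[R]_(m, n)) (x0 : V) (e k : R) : 0 <= k ->
  (forall x, ball x0 e x -> differentiable f x) ->
  (forall x v, ball x0 e x -> `|'D_v f x| <= k * `|v|) ->
  forall x y, ball x0 e x -> ball x0 e y -> `|f x - f y| <= k * `|x - y|.
Proof.
move=> k0 df Df x y xe ye; apply: normr_mx_le => [|i j]; first by rewrite mulr_ge0.
have [|r rs|r [r1]] := @MVT_line R V (fun z => f z i j : R^o) y (x - y) 1 _ _ => //.
  by apply: differentiable_mx_coord; apply: df; exact: ball_segment.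
rewrite scale1r (addrC y) subrK mul1r !mxE => ->.
rewrite derivable_mx_coord; last by apply: df; exact: ball_segment.
by apply: le_trans (normr_coord _ _ _) _; apply: Df; exact: ball_segment.
Qed.

Lemma constant_on_ball V m n (f : V -> 'M[R]_(m, n)) (x0 : V) (e : R) :
  (forall x, ball x0 e x -> differentiable f x) ->
  (forall x v, ball x0 e x -> 'D_v f x = 0) ->
  forall x y, ball x0 e x -> ball x0 e y -> f x = f y.
Proof.
move=> df Df x y xe ye; apply/eqP; rewrite -subr_eq0 -normr_le0.
rewrite -(mul0r `|x - y|); apply: (lipschitz_ball _ df) => // z v ze.
by rewrite Df // normr0 mul0r.
Qed.

Lemma derive_mulmx V n p (f : V -> 'rV[R]_n) (B : 'M[R]_(n, p)) (x : V) :
  differentiable f x -> differentiable (fun y => f y *m B) x /\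
  forall v, 'D_v (fun y => f y *m B) x = 'D_v f x *m B.
Proof.
move=> df.
have E y : f y *m B = \sum_i f y 0 i *: row i B by rewrite mulmx_sum_row.
have dfi i : differentiable (fun y => f y 0 i : R^o) x by exact: differentiable_mx_coord.
have D i : differentiable (fun y => f y 0 i *: row i B) x /\
    forall v, 'D_v (fun y => f y 0 i *: row i B) x = 'D_v f x 0 i *: row i B.
  have [d Dd] := differentiable_scale (dfi i) (differentiable_cst (row i B) x).
  by split=> // v; rewrite Dd derive_cst scaler0 addr0 derivable_mx_coord.
have -> : (fun y => f y *m B) = \sum_i (fun y => f y 0 i *: row i B).
  by apply/funext => y; rewrite fct_sumE E.
split=> [|v]; first by apply: differentiable_sum => i; have [] := D i.
rewrite derive_sum => [|i]; last by apply: diff_derivable; have [] := D i.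
by rewrite mulmx_sum_row; apply: eq_bigr => i _; have [_ ->] := D i.
Qed.
End Balls.

(** * The inverse function theorem *)

(** Completeness of the normed space of matrices, for the Banach fixed point theorem. *)
HB.instance Definition _ (R : realType) (m n : nat) := Complete.on 'M[R]_(m, n).

Section InverseFunction.
Context {R : realType}.
Implicit Types V W : normedModType R.

(** The derivative of [x - G x] has norm at most 1/2, so this map is a contraction; both injectivity
    and surjectivity of [G] come from that. *)
Lemma expansive_near_id n (G : 'rV[R]_n -> 'rV[R]_n) (x0 : 'rV[R]_n) (e : R) :
  (forall x, ball x0 e x -> differentiable G x) ->
  (forall x v, ball x0 e x -> `|v - 'D_v G x| <= 2^-1 * `|v|) ->
  forall x y, ball x0 e x -> ball x0 e y ->
    `|(x - G x) - (y - G y)| <= 2^-1 * `|x - y|.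
Proof.
move=> dG DG x y xe ye.
have D z : ball x0 e z -> differentiable (fun x => x - G x) z /\
    forall v, 'D_v (fun x => x - G x) z = v - 'D_v G z.
  move=> ze; split=> [|v]; first by apply: differentiableB => //; exact: dG.
  by rewrite deriveB ?derive_id //; apply: diff_derivable; exact: dG.
have k0 : 0 <= 2^-1 :> R by rewrite invr_ge0.
have D1 z ze := (D z ze).1.
have D2 z v : ball x0 e z -> `|'D_v (fun x => x - G x) z| <= 2^-1 * `|v|.
  by move=> ze; rewrite (D z ze).2; exact: DG.
exact: (lipschitz_ball k0 D1 D2 xe ye).
Qed.

Lemma injective_near_id n (G : 'rV[R]_n -> 'rV[R]_n) (x0 : 'rV[R]_n) (e : R) :
  (forall x, ball x0 e x -> differentiable G x) ->
  (forall x v, ball x0 e x -> `|v - 'D_v G x| <= 2^-1 * `|v|) ->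
  forall x y, ball x0 e x -> ball x0 e y -> `|x - y| <= 2 * `|G x - G y|.
Proof.
move=> dG DG x y xe ye.
have H := expansive_near_id dG DG xe ye.
have : `|x - y| <= `|(x - G x) - (y - G y)| + `|G x - G y|.
  apply: le_trans (ler_normD _ _); rewrite le_eqVlt; apply/orP; left; apply/eqP.
  by congr (`|_|); apply/rowP => i; rewrite !mxE; ring.
lra.
Qed.

Lemma surjective_near_id n (G : 'rV[R]_n -> 'rV[R]_n) (x0 : 'rV[R]_n) (e : R) : 0 < e ->
  (forall x, ball x0 e x -> differentiable G x) ->
  (forall x v, ball x0 e x -> `|v - 'D_v G x| <= 2^-1 * `|v|) ->
  forall y, ball (G x0) (e / 8) y -> exists2 x, ball x0 e x & G x = y.
Proof.
move=> e0 dG DG y ye.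
(* A fixed point of [T] solves [G x = y], and the fixed point theorem wants a closed set. It is
   stable under [T] because half of e/2 plus e/8 is less than e/2. *)
pose K : set 'rV[R]_n := closed_ball_ Num.norm x0 (e / 2).
have e20 : 0 < e / 2 by rewrite divr_gt0.
have KE x : K x <-> `|x0 - x| <= e / 2 by [].
have Ke x : K x -> ball x0 e x.
  by move=> /KE xK; rewrite -ball_normE /=; lra.
have x0e : ball x0 e x0 by exact: ballxx.
pose T x := x - G x + y.
have TK : set_fun K K T.
  move=> x Kx; apply/KE; rewrite /T.
  have H := expansive_near_id dG DG x0e (Ke _ Kx).
  have : `|x0 - (x - G x + y)| <= `|(x0 - G x0) - (x - G x)| + `|G x0 - y|.
    apply: le_trans (ler_normD _ _); rewrite le_eqVlt; apply/orP; left; apply/eqP.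
    by congr (`|_|); apply/rowP => i; rewrite !mxE; ring.
  move: ye; rewrite -ball_normE /= => ye; have := (KE x).1 Kx; lra.
have ctrT : is_contraction (mkfun TK).
  exists (2^-1)%:nng; split=> /=; first by rewrite invf_lt1 ?ltr1n.
  move=> [a b] /= [Ka Kb]; rewrite /T opprD addrACA subrr addr0.
  exact: (expansive_near_id dG DG (Ke _ Ka) (Ke _ Kb)).
have [|p Kp Tp] := banach_fixed_point ctrT (@closed_closed_ball_ _ _ x0 (e / 2)).
  by exists x0; apply/KE; rewrite subrr normr0 ltW.
exists p; first exact: Ke.
have pE : p = p - G p + y := Tp.
by apply/rowP => i; move: (congr1 (fun q : 'rV[R]_n => q 0 i) pE); rewrite !mxE; lra.
Qed.

Lemma Ck_onN V W k (U : set V) (f : V -> W) : open U -> Ck_on k U f -> Ck_on k U (fun x => - f x).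
Proof.
move=> oU Cf; apply: (@Ck_on_eq _ _ _ _ _ (fun x => (-1 : R^o) *: f x)) => // [x _|].
  by rewrite scaleN1r.
by apply: Ck_onZ => //; exact: Ck_on_cst.
Qed.

Lemma Ck_on_mulmx V n p k (U : set V) (f : V -> 'rV[R]_n) (B : 'M[R]_(n, p)) : open U ->
  Ck_on k U f -> Ck_on k U (fun x => f x *m B).
Proof.
move=> oU Cf; apply: (@Ck_on_eq _ _ _ _ _ (fun x => \sum_i f x 0 i *: row i B)) => // [x _|].
  by rewrite mulmx_sum_row.
by apply: Ck_on_sum => // i; apply: Ck_onZ => //; [exact: Ck_on_coord|exact: Ck_on_cst].
Qed.

Lemma mulmx_bounded n p (B : 'M[R]_(n, p)) :
  exists2 k : R, 0 < k & forall v : 'rV[R]_n, `|v *m B| <= k * `|v|.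
Proof.
exists (\sum_i `|row i B| + 1) => [|v]; first by rewrite ltr_wpDl // sumr_ge0.
rewrite mulmx_sum_row; apply: le_trans (ler_norm_sum _ _ _) _.
rewrite mulrDl mul1r ler_wpDr // mulr_suml; apply: ler_sum => i _.
by rewrite normrZ mulrC ler_wpM2l // normr_coord.
Qed.

Lemma unitmx_inj n (A : 'M[R]_n) : (forall v : 'rV[R]_n, v *m A = 0 -> v = 0) -> A \in unitmx.
Proof.
move=> A0; rewrite -row_free_unit -kermx_eq0; apply/rowV0P => v /sub_kermxP.
exact: A0.
Qed.

Lemma mul_jacobian n p (F : 'rV[R]_n -> 'rV[R]_p) (x v : 'rV[R]_n) :
  differentiable F x -> 'D_v F x = v *m jacobian F x.
Proof. by move=> dF; rewrite deriveEjacobian. Qed.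

(* The linear change of coordinates given by the inverse of the differential at
   [x0] reduces to a map whose differential is close to the identity. *)
Lemma inverse_function_homeo n (U : set 'rV[R]_n) (F : 'rV[R]_n -> 'rV[R]_n) (x0 : 'rV[R]_n) :
  open U -> U x0 -> Ck_on 1 U F -> (forall v, 'D_v F x0 = 0 -> v = 0) ->
  exists e r k, [/\ 0 < e, 0 < r, 0 < k, ball x0 e `<=` U &
    (forall x y, ball x0 e x -> ball x0 e y -> `|x - y| <= k * `|F x - F y|) /\
    forall y, ball (F x0) r y -> exists2 x, ball x0 e x & F x = y].
Proof.
move=> oU Ux0 CF inj0.
have dF x : U x -> differentiable F x by exact: Ck_on_differentiable CF.
pose A := jacobian F x0.
have uA : A \in unitmx.
  by apply: unitmx_inj => v; rewrite -mul_jacobian; [exact: inj0|exact: dF].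
pose B := invmx A.
pose G x := F x *m B.
have DG x : U x -> differentiable G x /\ forall v, 'D_v G x = 'D_v F x *m B.
  by move=> Ux; exact: derive_mulmx (dF _ Ux).
have DG0 v : v - 'D_v G x0 = 0.
  have [_ ->] := DG _ Ux0; rewrite mul_jacobian; last exact: dF.
  by rewrite mulmxK // subrr.
(* Summing over the [n] basis directions multiplies the error by [n], and n * d stays below 1/2; the
   successor covers n = 0. *)
pose d := (2 * n.+1%:R)^-1 : R.
have d0 : 0 < d by rewrite invr_gt0 mulr_gt0.
have CDG v : Ck_on 0 U (fun x => v - 'D_v F x *m B).
  exact: (Ck_onD oU (Ck_on_cst 0 U v) (Ck_onN oU (Ck_on_mulmx B oU (Ck_on_derive v CF)))).
pose P i : set 'rV[R]_n := [set x | `|delta_mx 0 i - 'D_(delta_mx 0 i) F x *m B| <= d].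
have nP i : nbhs x0 (P i).
  have /cvgrPdist_le/(_ d d0) := CDG (delta_mx 0 i) x0 Ux0.
  by apply: filterS => x; rewrite -(DG _ Ux0).2 DG0 sub0r normrN.
have nearb : nbhs x0 (fun x => forall i, P i x).
  exact: (@filter_forall _ _ P (nbhs x0) _ nP).
have nb : nbhs x0 (U `&` [set x | forall i : 'I_n, `|delta_mx 0 i - 'D_(delta_mx 0 i) F x *m B| <= d]).
  exact: (filterI (open_nbhs_nbhs (conj oU Ux0)) nearb).
have [e /= e0 eP] := (nbhs_ballP _ _).1 nb.
have eU x : ball x0 e x -> U x by move=> /eP[].
have dGe x : ball x0 e x -> differentiable G x by move=> /eU /DG[].
have DGe x v : ball x0 e x -> `|v - 'D_v G x| <= 2^-1 * `|v|.
  move=> xe; have [_ Gb] := eP _ xe.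
  rewrite {1}(row_sum_delta v) derive_rv; last exact: dGe.
  rewrite -sumrB; apply: le_trans (ler_norm_sum _ _ _) _.
  apply: (@le_trans _ _ (\sum_(i < n) `|v| * d)).
    apply: ler_sum => i _; rewrite -scalerBr normrZ (DG _ (eU _ xe)).2.
    by apply: ler_pM => //; exact: normr_coord.
  rewrite sumr_const card_ord -[leLHS]mulr_natr -mulrA mulrC ler_wpM2r //.
  rewrite /d invfM -mulrA -[leRHS]mulr1 ler_wpM2l ?invr_ge0 //.
  by rewrite mulrC ler_pdivrMr // mul1r ler_nat.
have [k k0 Bk] : exists2 k, 0 < k & forall v : 'rV[R]_n, `|v *m B| <= k * `|v|.
  exact: mulmx_bounded.
have k20 : 0 < 2 * k by rewrite mulr_gt0.
(* Multiplication by [B] expands norms at most by [k], which accounts for passing from the constants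
   e / 8 and 2, valid for [G], to those for [F]. *)
exists e, (e / 8 / k), (2 * k); split => //; first by rewrite divr_gt0 // divr_gt0.
split=> [x y xe ye|y].
  apply: le_trans (injective_near_id dGe DGe xe ye) _.
  by rewrite -mulrA ler_wpM2l // -mulmxBl.
rewrite -ball_normE /= ltr_pdivlMr // => ye.
have [|x xe Gx] := surjective_near_id e0 dGe DGe (y := y *m B).
  by rewrite -ball_normE /= -mulmxBl; apply: le_lt_trans ye; rewrite mulrC.
exists x; first by rewrite -ball_normE in xe.
apply: etrans (esym (mulmxKV uA (F x))) (etrans _ (mulmxKV uA y)).
exact: (congr1 (fun w : 'rV[R]_n => w *m A) Gx).
Qed.

Lemma inverse_function n (U : set 'rV[R]_n) (F : 'rV[R]_n -> 'rV[R]_n) (x0 : 'rV[R]_n) :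
  open U -> U x0 -> Ck_on 1 U F -> (forall x v, U x -> 'D_v F x = 0 -> v = 0) ->
  exists e r (h : 'rV[R]_n -> 'rV[R]_n), [/\ 0 < e, 0 < r, ball x0 e `<=` U,
    (forall x y, ball x0 e x -> ball x0 e y -> F x = F y -> x = y) &
    forall y, ball (F x0) r y -> [/\ ball x0 e (h y), F (h y) = y & differentiable h y]].
Proof.
move=> oU Ux0 CF inj0.
have dF x : U x -> differentiable F x by exact: Ck_on_differentiable CF.
have [e [r [k [e0 r0 k0 eU [injF surjF]]]]] := inverse_function_homeo oU Ux0 CF (fun v => inj0 x0 v Ux0).
(* Off the ball nothing is asked of [h]; [x0] merely witnesses existence there. *)
have /choice[h hP] : forall y, exists x, ball (F x0) r y -> ball x0 e x /\ F x = y.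
  move=> y; have [yr|] := pselect (ball (F x0) r y); last by exists x0.
  by have [x xe xy] := surjF y yr; exists x.
exists e, r, h; split => // [x y xe ye Fxy|y yr].
  by apply/eqP; rewrite -subr_eq0 -normr_le0 (le_trans (injF _ _ xe ye)) // Fxy subrr normr0 mulr0.
have [he Fh] := hP y yr; split => //.
have Uh := eU _ he.
pose A := jacobian F (h y).
have uA : A \in unitmx.
  by apply: unitmx_inj => v; rewrite -mul_jacobian; [exact: inj0|exact: dF].
pose B := invmx A.
have [c c0 cB] := mulmx_bounded B.
have cmB : continuous (mulmxr B : 'rV[R]_n -> 'rV[R]_n).
  have C0 : Ck_on 0 [set: 'rV[R]_n] (fun v : 'rV[R]_n => v) by move=> x _; exact: cvg_id.
  by move=> v; exact: (Ck_on_mulmx B openT C0 v I).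
apply: (proj1 (@diff_approx R _ _ h y (mulmxr B) cmB _)) => eps eps0.
have near_y : \forall z \near (0 : 'rV[R]_n), ball (F x0) r (z + y).
  have : \forall z \near y, ball (F x0) r z by apply: open_nbhs_nbhs; split; [exact: ball_open|].
  by rewrite (near_shift 0 y); apply: filterS => z /=; rewrite subr0.
(* Put s = h (z + y) - h y. Then z = s *m A + o(s) and |s| <= k |z|, hence s = z *m B + o(z), where
   [c] bounds the effect of [B] on the remainder. *)
pose eta := eps / (c * k).
have eta0 : 0 < eta by rewrite divr_gt0 // mulr_gt0.
have [d /= d0 dP] := (nbhs_ballP _ _).1 (diff_err (dF _ Uh) eta0).
have near_d : \forall z \near (0 : 'rV[R]_n), `|z| < d / k.
  by apply: nbhs0_lt; rewrite divr_gt0.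
apply: filterS2 near_y near_d => z zr zd.
have [hze Fhz] := hP _ zr.
pose s := h (z + y) - h y.
have sk : `|s| <= k * `|z|.
  by apply: le_trans (injF _ _ hze he) _; rewrite Fhz Fh addrK.
have /dP : ball (0 : 'rV[R]_n) d s.
  rewrite -ball_normE /= sub0r normrN; apply: le_lt_trans sk _.
  by rewrite mulrC -ltr_pdivlMr.
rewrite /= /s subrK Fhz Fh addrK (mul_jacobian _ (dF _ Uh)) -/A -/s => Hs.
rewrite [X in `|X|](_ : _ = - ((z - s *m A) *m B)); last first.
  by rewrite mulmxBl mulmxK // opprB.
rewrite normrN; apply: le_trans (cB _) _.
apply: (@le_trans _ _ (c * (eta * (k * `|z|)))).
  apply: ler_wpM2l; first exact: ltW.
  by apply: le_trans Hs _; apply: ler_wpM2l; [exact: ltW|exact: sk].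
rewrite /eta le_eqVlt; apply/orP; left; apply/eqP; field.
by rewrite !gt_eqF.
Qed.
End InverseFunction.

(** * Antiderivatives, and the regularity of inverse maps *)

Section Antiderivatives.
Context {R : realType}.
Implicit Types V W : normedModType R.

Lemma antiderivative (g : R -> R) (a b : R) : a < b ->
  (forall x, a <= x <= b -> {for x, continuous g}) ->
  exists G : R -> R, forall x, a < x < b -> is_derive (x : R^o) 1 (G : R^o -> R^o) (g x).
Proof.
move=> ab cg.
have ig : (@lebesgue_measure R).-integrable `[a, b] (EFin \o g).
  apply: continuous_compact_integrable; first exact: segment_compact.
  apply: continuous_in_subspaceT => x; rewrite inE /= in_itv /=; exact: cg.
exists (fun x => (\int[@lebesgue_measure R]_(t in [set` `[a, x]]) (g t))%R) => x /andP[ax xb].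
have xab : a <= x <= b by rewrite !ltW.
have [d1 d2] := continuous_FTC1_closed xb ig ax (cg x xab).
by apply: DeriveDef; [exact: d1|rewrite -d2 derive1E].
Qed.

(** A bootstrap: the derivative of [h] is a combination of the [w i \o h], so any regularity of [h]
    yields one more order, as long as the [w i] allow it. *)
Lemma Ck_on_inverse n k (B U : set 'rV[R]_n) (w : 'I_n -> 'rV[R]_n -> 'rV[R]_n)
    (h : 'rV[R]_n -> 'rV[R]_n) : open B -> open U ->
  (forall y, B y -> U (h y)) -> (forall y, B y -> differentiable h y) ->
  (forall i, Ck_on k U (w i)) ->
  (forall y v, B y -> 'D_v h y = \sum_i v 0 i *: w i (h y)) -> Ck_on k.+1 B h.
Proof.
move=> oB oU hU dh Cw Dh.
have Dh' v y : B y -> 'D_v h y = \sum_i v 0 i *: w i (h y) by move=> By; exact: Dh.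
elim: k Cw => [|k IH] Cw.
  have C0 : Ck_on 0 B h by move=> y By; exact/differentiable_continuous/dh.
  refine (Ck_onSE (Df := fun v y : 'rV[R]_n => \sum_i v 0 i *: w i (h y)) oB dh Dh' _) => v.
  apply: Ck_on_sum => // i; apply: (Ck_onZ oB (Ck_on_cst 0 B (v 0 i : R^o))).
  exact: (Ck_on_comp oB oU hU C0 (Cw i)).
have Ck := IH (fun i => Ck_onW (Cw i)).
refine (Ck_onSE (Df := fun v y : 'rV[R]_n => \sum_i v 0 i *: w i (h y)) oB dh Dh' _) => v.
apply: Ck_on_sum => // i; apply: (Ck_onZ oB (Ck_on_cst k.+1 B (v 0 i : R^o))).
exact: (Ck_on_comp oB oU hU Ck (Cw i)).
Qed.
End Antiderivatives.

(** * Lorentzian linear algebra *)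

Section Lorentz.
Context {R : realType}.
Implicit Types x y z w : 'rV[R]_5.

Definition lor_sign (i : 'I_5) : R := if i == ord_max then -1 else 1.

Definition lor_mx : 'M[R]_5 := diag_mx (\row_i lor_sign i).

Lemma lorE x y : lor x y = \sum_i lor_sign i * (x 0 i * y 0 i).
Proof.
rewrite big_ord_recr /= /lor_sign eqxx mulN1r; congr (_ - _).
apply: eq_bigr => i _.
have -> : lift ord_max i = widen_ord (leqnSn 4) i by apply/val_inj; exact: lift_max.
rewrite ifF ?mul1r //; apply/eqP => /(congr1 val) /= E.
by have := ltn_ord i; rewrite E ltnn.
Qed.

Lemma lorC x y : lor x y = lor y x.
Proof. by rewrite !lorE; apply: eq_bigr => i _; rewrite (mulrC (x 0 i)). Qed.

Lemma lorDl x y z : lor (x + y) z = lor x z + lor y z.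
Proof. by rewrite !lorE -big_split; apply: eq_bigr => i _; rewrite /= mxE mulrDl mulrDr. Qed.

Lemma lorZl a x z : lor (a *: x) z = a * lor x z.
Proof. by rewrite !lorE mulr_sumr; apply: eq_bigr => i _; rewrite mxE; ring. Qed.

Lemma lorNl x z : lor (- x) z = - lor x z.
Proof. by rewrite -scaleN1r lorZl mulN1r. Qed.

Lemma lorBl x y z : lor (x - y) z = lor x z - lor y z.
Proof. by rewrite lorDl lorNl. Qed.

Lemma lorDr x y z : lor z (x + y) = lor z x + lor z y.
Proof. by rewrite !(lorC z) lorDl. Qed.

Lemma lorZr a x z : lor z (a *: x) = a * lor z x.
Proof. by rewrite !(lorC z) lorZl. Qed.

Lemma lorNr x z : lor z (- x) = - lor z x.
Proof. by rewrite !(lorC z) lorNl. Qed.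

Lemma lorBr x y z : lor z (x - y) = lor z x - lor z y.
Proof. by rewrite !(lorC z) lorBl. Qed.

Lemma lor0l z : lor 0 z = 0.
Proof. by rewrite -(scale0r 0) lorZl mul0r. Qed.

Lemma lor0r z : lor z 0 = 0.
Proof. by rewrite lorC lor0l. Qed.

Lemma lor_suml n (f : 'I_n -> 'rV[R]_5) z : lor (\sum_i f i) z = \sum_i lor (f i) z.
Proof.
elim: n f => [|n IH] f; first by rewrite !big_ord0 lor0l.
by rewrite !big_ord_recl lorDl IH.
Qed.

(* [x_5 w - w_5 x] has no time component, so it is spacelike or zero. *)
Lemma lor_gt0 x w : lor x x = -1 -> lor w x = 0 -> w != 0 -> 0 < lor w w.
Proof.
move=> xx wx; apply: contraNT; rewrite -leNgt => ww.
pose y := x 0 ord_max *: w - w 0 ord_max *: x.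
have y5 : y 0 ord_max = 0 by rewrite !mxE; ring.
have yy : lor y y = x 0 ord_max ^+ 2 * lor w w - w 0 ord_max ^+ 2.
  by rewrite !(lorBl, lorBr, lorZl, lorZr) (lorC x) xx wx; ring.
have yyE : lor y y = \sum_(i < 4) y 0 (lift ord_max i) ^+ 2.
  by rewrite {1}/lor y5 mul0r subr0; apply: eq_bigr => i _; rewrite expr2.
have yy0 : 0 <= lor y y by rewrite yyE sumr_ge0 // => i _; exact: sqr_ge0.
have x5 : 0 <= x 0 ord_max ^+ 2 - 1.
  have := xx; rewrite /lor => E.
  have : 0 <= \sum_(i < 4) x 0 (lift ord_max i) * x 0 (lift ord_max i).
    by apply: sumr_ge0 => i _; rewrite -expr2 sqr_ge0.
  by rewrite expr2; lra.
have w5 : w 0 ord_max ^+ 2 <= 0.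
  have : x 0 ord_max ^+ 2 * lor w w <= 0 by rewrite mulr_ge0_le0 // sqr_ge0.
  lra.
have w50 : w 0 ord_max = 0.
  by apply/eqP; rewrite -sqrf_eq0 eq_le w5 sqr_ge0.
have y0 : \sum_(i < 4) y 0 (lift ord_max i) ^+ 2 = 0.
  apply/eqP; rewrite eq_le -yyE yy0 andbT yy w50 expr0n /= subr0.
  by rewrite mulr_ge0_le0 // sqr_ge0.
apply/eqP/rowP => j; rewrite mxE.
case: (unliftP ord_max j) => [i|] -> //.
have /(_ i isT) := (psumr_eq0P (fun i _ => sqr_ge0 (y 0 (lift ord_max i)))) y0.
rewrite !mxE w50 mul0r subr0 => /eqP; rewrite sqrf_eq0 mulf_eq0 => /orP[/eqP x50|/eqP //].
by move: x5; rewrite x50 expr0n /=; lra.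
Qed.

Definition rows5 (e1 e2 e3 e4 x : 'rV[R]_5) : 'M[R]_5 :=
  \matrix_(i < 5) [:: e1; e2; e3; e4; x]`_i.

Definition lor_frame (e1 e2 e3 e4 x : 'rV[R]_5) : Prop :=
  [/\ lor e1 e1 = 1, lor e2 e2 = 1, lor e3 e3 = 1, lor e4 e4 = 1 & lor x x = -1] /\
  [/\ lor e1 e2 = 0, lor e1 e3 = 0, lor e1 e4 = 0, lor e1 x = 0 & lor e2 e3 = 0] /\
  [/\ lor e2 e4 = 0, lor e2 x = 0, lor e3 e4 = 0, lor e3 x = 0 & lor e4 x = 0].

(** Taking determinants, this makes the matrix of the frame invertible; the expansion of a vector in
    the frame rests on it. *)
Lemma lor_frame_gram e1 e2 e3 e4 x : lor_frame e1 e2 e3 e4 x ->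
  let P := rows5 e1 e2 e3 e4 x in P *m lor_mx *m P^T = lor_mx.
Proof.
move=> [[h11 h22 h33 h44 hxx] [[h12 h13 h14 h1x h23] [h24 h2x h34 h3x h4x]]] P.
have E i j : (P *m lor_mx *m P^T) i j = lor (row i P) (row j P).
  rewrite mxE lorE; apply: eq_bigr => k _; rewrite mul_mx_diag !mxE; ring.
have PE i : row i P = [:: e1; e2; e3; e4; x]`_i by apply/rowP => k; rewrite !mxE.
apply/matrixP => i j; rewrite E !PE !mxE.
case: i => -[|[|[|[|[|//]]]]] ?; case: j => -[|[|[|[|[|//]]]]] ? //=;
  by rewrite ?h11 ?h22 ?h33 ?h44 ?hxx // lorC.
Qed.

Lemma lor_mx_unit : lor_mx \in unitmx.
Proof.
rewrite unitmxE det_diag unitfE; apply/prodf_neq0 => i _.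
by rewrite mxE /lor_sign; case: ifP => _; rewrite ?oppr_eq0 oner_eq0.
Qed.

Lemma det_rows5N e1 e2 e3 e4 x : \det (rows5 e1 e2 e3 (- e4) x) = - \det (rows5 e1 e2 e3 e4 x).
Proof.
pose i3 : 'I_5 := Ordinal (isT : 3 < 5)%N.
rewrite (@determinant_multilinear _ _ _ (rows5 e1 e2 e3 e4 x) (rows5 e1 e2 e3 e4 x) i3 (-1) 0).
- by rewrite mulN1r mul0r addr0.
- by rewrite scale0r addr0 scaleN1r; apply/rowP => k; rewrite !mxE.
- by apply/matrixP => -[[|[|[|[|//]]]] ?] k; rewrite !mxE.
- by apply/matrixP => -[[|[|[|[|//]]]] ?] k; rewrite !mxE.
Qed.

Lemma lor_frame_det e1 e2 e3 e4 x : lor_frame e1 e2 e3 e4 x ->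
  \det (rows5 e1 e2 e3 e4 x) != 0.
Proof.
move=> /lor_frame_gram /(congr1 determinant) /=; rewrite !det_mulmx => E.
have := lor_mx_unit; rewrite unitmxE unitfE -E; apply: contraNneq => ->.
by rewrite !mul0r.
Qed.

Lemma lor_frame_nondegenerate e1 e2 e3 e4 x w : lor_frame e1 e2 e3 e4 x ->
  lor w e1 = 0 -> lor w e2 = 0 -> lor w e3 = 0 -> lor w e4 = 0 -> lor w x = 0 -> w = 0.
Proof.
move=> fr h1 h2 h3 h4 hx; set P := rows5 e1 e2 e3 e4 x.
have uP : P \in unitmx by rewrite unitmxE unitfE lor_frame_det.
have E : w *m (lor_mx *m P^T) = 0.
  apply/rowP => i; rewrite mulmxA -[RHS](_ : lor w (row i P) = _); last first.
    have -> : row i P = [:: e1; e2; e3; e4; x]`_i by apply/rowP => k; rewrite !mxE.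
    by rewrite mxE; case: i => -[|[|[|[|[|//]]]]] ?.
  by rewrite mxE lorE; apply: eq_bigr => k _; rewrite mul_mx_diag !mxE; ring.
have uQ : lor_mx *m P^T \in unitmx by rewrite unitmx_mul lor_mx_unit unitmx_tr.
by rewrite -(mulmxK uQ w) E mul0mx.
Qed.

Lemma lor_frame_expand e1 e2 e3 e4 x w : lor_frame e1 e2 e3 e4 x ->
  w = lor w e1 *: e1 + lor w e2 *: e2 + lor w e3 *: e3 + lor w e4 *: e4 - lor w x *: x.
Proof.
move=> fr; have [[h11 h22 h33 h44 hxx] [[h12 h13 h14 h1x h23] [h24 h2x h34 h3x h4x]]] := fr.
apply/eqP; rewrite -subr_eq0; apply/eqP; apply: (lor_frame_nondegenerate fr);
  rewrite !(lorBl, lorDl, lorZl) ?h11 ?h22 ?h33 ?h44 ?hxx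
   ?h12 ?h13 ?h14 ?h1x ?h23 ?h24 ?h2x ?h34 ?h3x ?h4x;
  rewrite ?(lorC e2 e1, lorC e3 e1, lorC e3 e2, lorC e4 e1, lorC e4 e2, lorC e4 e3)
   ?(lorC x e1, lorC x e2, lorC x e3, lorC x e4)
   ?h12 ?h13 ?h14 ?h1x ?h23 ?h24 ?h2x ?h34 ?h3x ?h4x; ring.
Qed.

(** A non-zero vector orthogonal to the four given ones exists by dimension. Since it is orthogonal
    to the timelike [x], it is spacelike by [lor_gt0] and can be normalized; its sign is then
    settled by the determinant. *)
Lemma lor_frame_exists e1 e2 e3 x :
  lor e1 e1 = 1 -> lor e2 e2 = 1 -> lor e3 e3 = 1 -> lor x x = -1 ->
  lor e1 e2 = 0 -> lor e1 e3 = 0 -> lor e2 e3 = 0 ->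
  lor e1 x = 0 -> lor e2 x = 0 -> lor e3 x = 0 ->
  exists2 e4, lor_frame e1 e2 e3 e4 x & 0 < \det (rows5 e1 e2 e3 e4 x).
Proof.
move=> h11 h22 h33 hxx h12 h13 h23 h1x h2x h3x.
pose Q : 'M[R]_(4, 5) := \matrix_(i < 4) [:: e1; e2; e3; x]`_i.
have [w wQ w0] : exists2 w : 'rV[R]_5, w *m (lor_mx *m Q^T) = 0 & w != 0.
  have : kermx (lor_mx *m Q^T) != 0.
    by rewrite kermx_eq0 /row_free neq_ltn (leq_ltn_trans (rank_leq_col _)).
  by move=> /rowV0Pn[w /sub_kermxP wQ w0]; exists w.
have wi (i : 'I_4) : lor w ([:: e1; e2; e3; x]`_i) = 0.
  have -> : [:: e1; e2; e3; x]`_i = row i Q by apply/rowP => k; rewrite !mxE.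
  move/rowP: wQ => /(_ i); rewrite mulmxA !mxE => <-.
  by rewrite lorE; apply: eq_bigr => k _; rewrite mul_mx_diag !mxE; ring.
have w1 : lor w e1 = 0 := wi (Ordinal (isT : 0 < 4)%N).
have w2 : lor w e2 = 0 := wi (Ordinal (isT : 1 < 4)%N).
have w3 : lor w e3 = 0 := wi (Ordinal (isT : 2 < 4)%N).
have wx : lor w x = 0 := wi (Ordinal (isT : 3 < 4)%N).
have ww := lor_gt0 hxx wx w0.
pose n := (Num.sqrt (lor w w))^-1 *: w.
have nn : lor n n = 1.
  rewrite lorZl lorZr mulrA -expr2 exprVn sqr_sqrtr ?ltW // mulVf //.
  by rewrite gt_eqF.
have ne z : lor w z = 0 -> lor n z = 0 by move=> wz; rewrite lorZl wz mulr0.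
have en z : lor w z = 0 -> lor z n = 0 by move=> wz; rewrite lorC ne.
have fr : lor_frame e1 e2 e3 n x by do !split => //; [exact: en|exact: en|exact: en|exact: ne].
have := lor_frame_det fr.
rewrite neq_lt => /orP[neg|pos]; last by exists n.
exists (- n); last by rewrite det_rows5N oppr_gt0.
by do !split => //; rewrite ?(lorNl, lorNr) ?nn ?opprK // ?en ?ne ?oppr0.
Qed.

Lemma differentiable_lor (V : normedModType R) (f g : V -> 'rV[R]_5) (p : V) :
  differentiable f p -> differentiable g p ->
  differentiable (fun u => lor (f u) (g u) : R^o) p /\
  forall v, 'D_v (fun u => lor (f u) (g u) : R^o) p = lor ('D_v f p) (g p) + lor (f p) ('D_v g p).
Proof.
move=> df dg.
have -> : (fun u => lor (f u) (g u) : R^o) = \sum_i (fun u => lor_sign i * (f u 0 i * g u 0 i) : R^o).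
  by apply/funext => y; rewrite fct_sumE lorE.
have D i : differentiable (fun u => lor_sign i * (f u 0 i * g u 0 i) : R^o) p /\
   forall v, 'D_v (fun u => lor_sign i * (f u 0 i * g u 0 i) : R^o) p =
      lor_sign i * ('D_v f p 0 i * g p 0 i) + lor_sign i * (f p 0 i * 'D_v g p 0 i).
  have dfi := differentiable_mx_coord 0 i df.
  have dgi := differentiable_mx_coord 0 i dg.
  have [d1 D1] := differentiable_scale dfi dgi.
  have [d2 D2] := differentiable_scale (differentiable_cst (lor_sign i : R^o) p) d1.
  split=> // v; rewrite D2 D1 derive_cst scale0r add0r !derivable_mx_coord //.
  exact: mulrDr.
split=> [|v]; first by apply: differentiable_sum => i; exact: (D i).1.
rewrite derive_sum => [|i]; last by apply: diff_derivable; exact: (D i).1.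
by rewrite !lorE -big_split; apply: eq_bigr => i _; exact: (D i).2.
Qed.

Lemma Ck_on_lor (V : normedModType R) k (U : set V) (f g : V -> 'rV[R]_5) : open U ->
  Ck_on k U f -> Ck_on k U g -> Ck_on k U (fun u => lor (f u) (g u) : R^o).
Proof.
move=> oU Cf Cg.
have -> : (fun u => lor (f u) (g u) : R^o) = (fun u => \sum_i (lor_sign i * (f u 0 i * g u 0 i) : R^o)).
  by apply/funext => y; rewrite lorE.
apply: Ck_on_sum => // i; apply: Ck_onM => //; first exact: Ck_on_cst.
by apply: Ck_onM => //; exact: Ck_on_coord.
Qed.
End Lorentz.

(** * Derivatives along vector fields and their commutators *)

Section VectorFields.
Context {R : realType}.
Implicit Types V W : normedModType R.

Lemma deriveBv V W (f : V -> W) (x v w : V) : differentiable f x ->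
  'D_(v - w) f x = 'D_v f x - 'D_w f x.
Proof. by move=> df; rewrite -(scaleN1r w) deriveDv // deriveZv // scaleN1r. Qed.

Lemma Ck_on_deriveF n W k (U : set 'rV[R]_n) (v : 'rV[R]_n -> 'rV[R]_n) (F : 'rV[R]_n -> W) :
  open U -> Ck_on k U v -> Ck_on k.+1 U F -> Ck_on k U (fun y => 'D_(v y) F y).
Proof.
move=> oU Cv CF.
apply: (@Ck_on_eq _ _ _ _ _ (fun y => \sum_i v y 0 i *: 'D_(delta_mx 0 i) F y)) => // [x Ux|].
  by rewrite -derive_rv //; exact: Ck_on_differentiable CF Ux.
apply: Ck_on_sum => // i; apply: Ck_onZ => //; first exact: Ck_on_coord.
exact: Ck_on_derive CF.
Qed.

Lemma derive_deriveF n m p (U : set 'rV[R]_n) (v : 'rV[R]_n -> 'rV[R]_n)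
    (F : 'rV[R]_n -> 'M[R]_(m, p)) (x w : 'rV[R]_n) :
  open U -> U x -> differentiable v x -> Ck_on 2 U F ->
  'D_w (fun y => 'D_(v y) F y) x = 'D_('D_w v x) F x + 'D_w ('D_(v x) F) x.
Proof.
move=> oU Ux dv CF.
have dF y : U y -> differentiable F y by exact: Ck_on_differentiable CF.
have dDF u : differentiable ('D_u F) x by exact: Ck_on_differentiable (Ck_on_derive u CF) Ux.
have E : \near x, 'D_(v x) F x = (\sum_i (fun y => v y 0 i *: 'D_(delta_mx 0 i) F y)) x.
  apply: filterS (open_nbhs_nbhs (conj oU Ux)) => y Uy.
  by rewrite fct_sumE; apply: derive_rv; exact: dF.
apply: etrans (near_eq_derive _ E) _.
have D i : differentiable (fun y => v y 0 i *: 'D_(delta_mx 0 i) F y) x /\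
  forall w, 'D_w (fun y => v y 0 i *: 'D_(delta_mx 0 i) F y) x =
    'D_w v x 0 i *: 'D_(delta_mx 0 i) F x + v x 0 i *: 'D_w ('D_(delta_mx 0 i) F) x.
  have [d1 D1] := differentiable_scale (differentiable_mx_coord 0 i dv) (dDF (delta_mx 0 i)).
  by split=> // u; rewrite D1 derivable_mx_coord.
rewrite derive_sum => [|i]; last by apply: diff_derivable; exact: (D i).1.
rewrite (derive_rv ('D_w v x) (dF _ Ux)).
rewrite (derive_sym w (v x) oU Ux CF) (derive_rv (v x) (dDF w)) -big_split.
apply: eq_bigr => i _; rewrite (D i).2.
by rewrite (derive_sym w (delta_mx 0 i) oU Ux CF).
Qed.

(** The second-order terms cancel by symmetry, and what survives is the derivative along the Lie
    bracket. *)
Lemma lie_commutator n m p (U : set 'rV[R]_n) (v w : 'rV[R]_n -> 'rV[R]_n)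
    (F : 'rV[R]_n -> 'M[R]_(m, p)) (x : 'rV[R]_n) :
  open U -> U x -> differentiable v x -> differentiable w x -> Ck_on 2 U F ->
  'D_(v x) (fun y => 'D_(w y) F y) x - 'D_(w x) (fun y => 'D_(v y) F y) x =
  'D_('D_(v x) w x - 'D_(w x) v x) F x.
Proof.
move=> oU Ux dv dw CF.
have dF : differentiable F x by exact: Ck_on_differentiable CF Ux.
have alg (a b q r s t : 'M[R]_(m, p)) : a = q + r -> b = s + t -> r = t -> a - b = q - s.
  by move=> -> -> ->; rewrite opprD addrACA subrr addr0.
apply: etrans (alg _ _ _ _ _ _ (derive_deriveF (v x) oU Ux dw CF)
  (derive_deriveF (w x) oU Ux dv CF) (derive_sym (v x) (w x) oU Ux CF)) _.
exact: esym (deriveBv _ _ dF).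
Qed.

Lemma near_open V (U : set V) (P : V -> Prop) (x : V) : open U -> U x ->
  (forall y, U y -> P y) -> \forall y \near x, P y.
Proof. by move=> oU Ux UP; apply: filterS (open_nbhs_nbhs (conj oU Ux)). Qed.

Lemma derive_lor_cst V (U : set V) (F G : V -> 'rV[R]_5) (k : R) (x v : V) :
  open U -> U x -> differentiable F x -> differentiable G x ->
  (forall y, U y -> lor (F y) (G y) = k) ->
  lor ('D_v F x) (G x) = - lor (F x) ('D_v G x).
Proof.
move=> oU Ux dF dG E; apply/eqP; rewrite -addr_eq0; apply/eqP.
rewrite -(differentiable_lor dF dG).2.
rewrite (near_eq_derive _ (near_open oU Ux E : \near x, lor (F x) (G x) = cst k x)).
exact: derive_cst.
Qed.

End VectorFields.

(** * Functions of the mean curvature *)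

Section Scalars.
Context {R : realType}.
Implicit Types V W : normedModType R.

(** Real powers are atoms for [ring] and [lra]; in terms of a square root the identities between
    powers of f become polynomial. *)
Lemma powR32 (t : R) : 0 <= t -> t `^ (3 / 2) = t * Num.sqrt t.
Proof.
move=> t0; rewrite -powR12_sqrt // -{2}(powRr1 t0).
have [->|tn0] := eqVneq t 0; first by rewrite !powR0 ?mul0r // mulf_neq0.
by rewrite -powRD ?tn0 ?implybT //; congr (_ `^ _); field.
Qed.

Lemma powR34_sqr (t : R) : 0 <= t -> (t `^ (3 / 4)) ^+ 2 = t * Num.sqrt t.
Proof.
move=> t0; rewrite -powR32 // expr2.
have [->|tn0] := eqVneq t 0; first by rewrite !powR0 ?mul0r // mulf_neq0.
by rewrite -powRD ?tn0 ?implybT //; congr (_ `^ _); field.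
Qed.

Lemma Ck_on_powR V k (U : set V) (f : V -> R^o) (a : R) : open U ->
  (forall x, U x -> 0 < f x) -> Ck_on k U f -> Ck_on k U (fun x => f x `^ a : R^o).
Proof.
move=> oU f0; elim: k a => [|k IH] a.
  move=> cf x Ux; apply: (@continuous_comp _ _ _ f (fun t : R => t `^ a)); first exact: cf.
  have [d _] := is_derive1_powR a (f0 _ Ux).
  exact/differentiable_continuous/derivable1_diffP.
move=> Cf; have [df Df] := Cf.
have DE x : U x -> _ := fun Ux => differentiable_comp1 (df x Ux) (is_derive1_powR a (f0 x Ux)).
apply: (@Ck_onSE R V R^o _ _ _ (fun v x => (a * f x `^ (a - 1)) * 'D_v f x)) => // [x Ux|v x Ux|v].
- by have [] := DE x Ux.
- by have [_ ->] := DE x Ux.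
- apply: Ck_onM (Df v) => //; apply: Ck_onM => //; first exact: Ck_on_cst.
  by apply: IH; exact: Ck_onW.
Qed.

Lemma derive_shape (c t : R) : 0 < t ->
  is_derive (t : R^o) 1 (fun t : R^o => c * t `^ (3 / 2) : R^o) (3 / 2 * c * Num.sqrt t).
Proof.
move=> t0; have H := is_derive1_powR (3 / 2) t0.
apply: is_derive_eq.
rewrite -powR12_sqrt ?ltW // (_ : 3 / 2 - 1 = 2^-1); last by field.
by rewrite /GRing.scale /=; ring.
Qed.

Definition radicand' (c C t : R) : R := 27 / 2 * C * Num.sqrt t - 18 * t - 3 * c ^+ 2 * t ^+ 2.

Lemma derive_radicand (c C t : R) : 0 < t ->
  is_derive (t : R^o) 1 (radicand c C : R^o -> R^o) (radicand' c C t).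
Proof.
move=> t0; have H := is_derive1_powR (3 / 2) t0.
rewrite /radicand; apply: is_derive_eq.
rewrite (_ : 3 / 2 - 1 = 2^-1); last by field.
rewrite powR12_sqrt ?ltW // /radicand' /GRing.scale /=.
by field.
Qed.

Lemma derive_sqrt_radicand (c C t : R) : 0 < t -> 0 < radicand c C t ->
  is_derive (t : R^o) 1 (fun t : R^o => Num.sqrt (radicand c C t) : R^o)
    (radicand' c C t / (2 * Num.sqrt (radicand c C t))).
Proof.
move=> t0 r0; have H := derive_radicand c C t0; have H2 := is_derive1_sqrt r0.
have D : differentiable (radicand c C : R^o -> R^o) t by apply/derivable1_diffP; case: H.
have [d Dd] := differentiable_comp1 D H2.
apply: DeriveDef; first exact: diff_derivable.
by rewrite Dd mulrC; congr (_ * _); case: H.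
Qed.

Definition kappahat (C t : R) : R := 3 * Num.sqrt C * t `^ (3 / 4).

(** The logarithmic derivative is 3/4 of that of [t]; combined with f' = 4/3 f p it makes k grow at
    the rate p along E1. *)
Lemma derive_kappahat (C t : R) : 0 < t ->
  is_derive (t : R^o) 1 (kappahat C : R^o -> R^o) (3 / 4 * kappahat C t / t).
Proof.
move=> t0; have H := is_derive1_powR (3 / 4) t0.
rewrite /kappahat; apply: is_derive_eq.
have -> : t `^ (3 / 4 - 1) = t `^ (3 / 4) / t.
  by rewrite powRB ?(gt_eqF t0) ?implybT // powRr1 // ltW.
rewrite /GRing.scale /=.
by field; rewrite gt_eqF.
Qed.

Lemma kappahat_gt0 (C t : R) : 0 < C -> 0 < t -> 0 < kappahat C t.
Proof. by move=> C0 t0; rewrite /kappahat !mulr_gt0 ?sqrtr_gt0 ?powR_gt0. Qed.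

Lemma derive_kappahatV (C t : R) : 0 < C -> 0 < t ->
  is_derive (t : R^o) 1 (fun t : R^o => (kappahat C t)^-1 : R^o)
    (- (3 / 4 * (kappahat C t)^-1 / t)).
Proof.
move=> C0 t0; have [d D] := derive_kappahat C t0; have k0 := kappahat_gt0 C0 t0.
apply: DeriveDef; first by apply: derivableV => //; rewrite gt_eqF.
rewrite deriveV // ?gt_eqF // D /GRing.scale /=.
by field; rewrite !gt_eqF.
Qed.
End Scalars.

(** * Structure equations of an adapted frame *)

(* Locked, because unification is otherwise tempted to unfold limits. *)
HB.lock Definition along (R : realType) (v : 'rV[R]_2 -> 'rV[R]_2) (F : 'rV[R]_2 -> 'rV[R]_5)
  (y : 'rV[R]_2) : 'rV[R]_5 := 'D_(v y) F y.

Section AdaptedFrame.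
Context {R : realType}.
Implicit Types (U : set 'rV[R]_2) (v : 'rV[R]_2 -> 'rV[R]_2) (X F G : 'rV[R]_2 -> 'rV[R]_5).

Lemma alongE v F y : along v F y = 'D_(v y) F y.
Proof. by rewrite along.unlock. Qed.

Lemma along_funE v F : along v F = fun y => 'D_(v y) F y.
Proof. by apply/funext => y; rewrite alongE. Qed.

(** The geometric data in flat terms: metric, Christoffel symbols and shape operators are replaced
    by products [lor] of derivatives taken in R^5. [v1] and [v2] are E1 and E2 read in the chart,
    and [af_span] is the expansion of a tangent vector in this orthonormal frame. *)
Record adapted_frame U X v1 v2 (e3 e4 : 'rV[R]_2 -> 'rV[R]_5) (f : 'rV[R]_2 -> R^o)
    (c C : R) : Prop := AdaptedFrame {
  af_open : open U;
  af_X : smooth_on U X;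
  af_v1 : smooth_on U v1;
  af_v2 : smooth_on U v2;
  af_e3 : smooth_on U e3;
  af_e4 : smooth_on U e4;
  af_f : smooth_on U f;
  af_span : forall x u, U x ->
    u = lor ('D_u X x) (along v1 X x) *: v1 x + lor ('D_u X x) (along v2 X x) *: v2 x;
  af_frame : forall x, U x -> lor_frame (along v1 X x) (along v2 X x) (e3 x) (e4 x) (X x);
  af_c : c != 0;
  af_f_gt0 : forall x, U x -> 0 < f x;
  af_f1 : forall x, U x -> 'D_(v1 x) f x = 4 / 3 * f x * Num.sqrt (radicand c C (f x));
  af_f1_gt0 : forall x, U x -> 0 < 'D_(v1 x) f x;
  af_f2 : forall x, U x -> 'D_(v2 x) f x = 0;
  af_parallel : forall x u, U x -> lor ('D_u e3 x) (e4 x) = 0;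
  af_B114 : forall x, U x -> lor (along v1 (along v1 X) x) (e4 x) = c * f x `^ (3 / 2);
  af_B124 : forall x, U x -> lor (along v1 (along v2 X) x) (e4 x) = 0;
  af_B224 : forall x, U x -> lor (along v2 (along v2 X) x) (e4 x) = - (c * f x `^ (3 / 2));
  af_H : forall x, U x -> lor (along v1 (along v1 X) x) (e3 x)
    + lor (along v2 (along v2 X) x) (e3 x) = 2 * f x }.

Lemma derive_lor_eq U F G (g : 'rV[R]_2 -> R^o) (x v : 'rV[R]_2) :
  open U -> U x -> differentiable F x -> differentiable G x ->
  (forall y, U y -> lor (F y) (G y) = g y) ->
  lor ('D_v F x) (G x) = 'D_v g x - lor (F x) ('D_v G x).
Proof.
move=> oU Ux dF dG E; apply/eqP; rewrite -subr_eq opprK; apply/eqP.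
apply: etrans (esym ((differentiable_lor dF dG).2 v)) _.
exact: near_eq_derive (near_open oU Ux E).
Qed.

Variables (U : set 'rV[R]_2) (X : 'rV[R]_2 -> 'rV[R]_5) (v1 v2 : 'rV[R]_2 -> 'rV[R]_2).
Variables (e3 e4 : 'rV[R]_2 -> 'rV[R]_5) (f : 'rV[R]_2 -> R^o) (c C : R).
Hypothesis af : adapted_frame U X v1 v2 e3 e4 f c C.

Let oU : open U := af_open af.
Let e1 := along v1 X.
Let e2 := along v2 X.
(* [mu] is an eigenvalue of A_4, and [p = (3 / 4) * E_1 f / f]. *)
Let mu (y : 'rV[R]_2) : R^o := c * f y `^ (3 / 2).
Let p (y : 'rV[R]_2) : R^o := Num.sqrt (radicand c C (f y)).

Lemma along_smooth v F : smooth_on U v -> smooth_on U F -> smooth_on U (along v F).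
Proof. by move=> sv sF k; rewrite along_funE; apply: Ck_on_deriveF => //. Qed.

Let se1 : smooth_on U e1 := along_smooth (af_v1 af) (af_X af).
Let se2 : smooth_on U e2 := along_smooth (af_v2 af) (af_X af).

Lemma smooth_differentiable (W : normedModType R) (F : 'rV[R]_2 -> W) x :
  smooth_on U F -> U x -> differentiable F x.
Proof. by move=> sF; exact: Ck_on_differentiable (sF 1%N). Qed.

Lemma mu_neq0 x : U x -> mu x != 0.
Proof.
by move=> Ux; rewrite mulf_neq0 ?(af_c af) // gt_eqF // powR_gt0 // (af_f_gt0 af).
Qed.

Lemma radicand_gt0 x : U x -> 0 < radicand c C (f x).
Proof.
move=> Ux; rewrite -sqrtr_gt0; have f0 := af_f_gt0 af Ux.
have := af_f1_gt0 af Ux; rewrite (af_f1 af Ux).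
by rewrite pmulr_rgt0 // mulr_gt0 // divr_gt0.
Qed.

Lemma p_gt0 x : U x -> 0 < p x.
Proof. by move=> Ux; rewrite /p sqrtr_gt0 radicand_gt0. Qed.

Lemma derive_of_f x u (g : R^o -> R^o) (g' : R) : U x -> is_derive (f x) 1 g g' ->
  'D_u (fun y => g (f y) : R^o) x = g' * 'D_u f x.
Proof.
by move=> Ux Hg; exact: (differentiable_comp1 (smooth_differentiable (af_f af) Ux) Hg).2.
Qed.

Lemma derive_mu x u : U x -> 'D_u mu x = 3 / 2 * c * Num.sqrt (f x) * 'D_u f x.
Proof. by move=> Ux; exact: (derive_of_f u Ux (derive_shape c (af_f_gt0 af Ux))). Qed.

Lemma derive_p x u : U x -> 'D_u p x = radicand' c C (f x) / (2 * p x) * 'D_u f x.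
Proof.
move=> Ux.
exact: (derive_of_f u Ux (derive_sqrt_radicand (af_f_gt0 af Ux) (radicand_gt0 Ux))).
Qed.

Lemma derive1_mu x : U x -> 'D_(v1 x) mu x = 2 * mu x * p x.
Proof.
move=> Ux; rewrite derive_mu // (af_f1 af Ux) /mu powR32; first by rewrite /p; field.
by rewrite ltW // (af_f_gt0 af).
Qed.

Let smu : smooth_on U mu.
Proof.
move=> k; apply: Ck_onM => //; first exact: Ck_on_cst.
by apply: Ck_on_powR => //; [exact: (af_f_gt0 af)|exact: (af_f af)].
Qed.

(* [w1], [w2] are the values of the connection form on [e1], [e2], and [a], [b] those of
   <B(e1, e1), e3>, <B(e1, e2), e3>. *)
Let w1 x := lor (along v1 e1 x) (e2 x).
Let w2 x := lor (along v2 e1 x) (e2 x).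
Let a x := lor (along v1 e1 x) (e3 x).
Let b x := lor (along v1 e2 x) (e3 x).

Let sX := af_X af.
Let se3 := af_e3 af.
Let se4 := af_e4 af.

Lemma lor_derive_unit F (k : R) x u : smooth_on U F -> U x ->
  (forall y, U y -> lor (F y) (F y) = k) -> lor ('D_u F x) (F x) = 0.
Proof.
move=> sF Ux E; have dF := smooth_differentiable sF Ux.
by have := derive_lor_cst u oU Ux dF dF E; rewrite (lorC (F x)); lra.
Qed.

Lemma lor_derive_swap F G (k : R) x u : smooth_on U F -> smooth_on U G -> U x ->
  (forall y, U y -> lor (F y) (G y) = k) ->
  lor ('D_u F x) (G x) = - lor ('D_u G x) (F x).
Proof.
move=> sF sG Ux E; rewrite (lorC ('D_u G x)).
by apply: (derive_lor_cst u oU Ux _ _ E); exact: smooth_differentiable.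
Qed.

Let fr x (Ux : U x) : lor_frame (e1 x) (e2 x) (e3 x) (e4 x) (X x) := af_frame af Ux.

Ltac frame := move=> y Uy; have [[? ? ? ? ?] [[? ? ? ? ?] [? ? ? ? ?]]] := fr Uy; assumption.

Lemma D11 x u : U x -> lor ('D_u e1 x) (e1 x) = 0.
Proof. by move=> Ux; apply: (lor_derive_unit (k := 1)) => //; frame. Qed.
Lemma D22 x u : U x -> lor ('D_u e2 x) (e2 x) = 0.
Proof. by move=> Ux; apply: (lor_derive_unit (k := 1)) => //; frame. Qed.
Lemma D33 x u : U x -> lor ('D_u e3 x) (e3 x) = 0.
Proof. by move=> Ux; apply: (lor_derive_unit (k := 1)) => //; frame. Qed.
Lemma D44 x u : U x -> lor ('D_u e4 x) (e4 x) = 0.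
Proof. by move=> Ux; apply: (lor_derive_unit (k := 1)) => //; frame. Qed.
Lemma D21 x u : U x -> lor ('D_u e2 x) (e1 x) = - lor ('D_u e1 x) (e2 x).
Proof. by move=> Ux; apply/esym/eqP; rewrite eqr_oppLR; apply/eqP; apply: (lor_derive_swap (k := 0)) => //; frame. Qed.
Lemma D31 x u : U x -> lor ('D_u e3 x) (e1 x) = - lor ('D_u e1 x) (e3 x).
Proof. by move=> Ux; apply/esym/eqP; rewrite eqr_oppLR; apply/eqP; apply: (lor_derive_swap (k := 0)) => //; frame. Qed.
Lemma D32 x u : U x -> lor ('D_u e3 x) (e2 x) = - lor ('D_u e2 x) (e3 x).
Proof. by move=> Ux; apply/esym/eqP; rewrite eqr_oppLR; apply/eqP; apply: (lor_derive_swap (k := 0)) => //; frame. Qed.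
Lemma D41 x u : U x -> lor ('D_u e4 x) (e1 x) = - lor ('D_u e1 x) (e4 x).
Proof. by move=> Ux; apply/esym/eqP; rewrite eqr_oppLR; apply/eqP; apply: (lor_derive_swap (k := 0)) => //; frame. Qed.
Lemma D42 x u : U x -> lor ('D_u e4 x) (e2 x) = - lor ('D_u e2 x) (e4 x).
Proof. by move=> Ux; apply/esym/eqP; rewrite eqr_oppLR; apply/eqP; apply: (lor_derive_swap (k := 0)) => //; frame. Qed.
Lemma D43 x u : U x -> lor ('D_u e4 x) (e3 x) = 0.
Proof.
move=> Ux; apply/eqP; rewrite -oppr_eq0 -(af_parallel af u Ux); apply/eqP/esym.
by apply: (lor_derive_swap (k := 0)) => //; frame.
Qed.
Lemma D1X x u : U x -> lor ('D_u e1 x) (X x) = - lor ('D_u X x) (e1 x).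
Proof. by move=> Ux; apply: (lor_derive_swap (k := 0)) => //; frame. Qed.
Lemma D2X x u : U x -> lor ('D_u e2 x) (X x) = - lor ('D_u X x) (e2 x).
Proof. by move=> Ux; apply: (lor_derive_swap (k := 0)) => //; frame. Qed.
Lemma D3X x u : U x -> lor ('D_u e3 x) (X x) = - lor ('D_u X x) (e3 x).
Proof. by move=> Ux; apply: (lor_derive_swap (k := 0)) => //; frame. Qed.
Lemma D4X x u : U x -> lor ('D_u e4 x) (X x) = - lor ('D_u X x) (e4 x).
Proof. by move=> Ux; apply: (lor_derive_swap (k := 0)) => //; frame. Qed.

Lemma derive_split F x u : smooth_on U F -> U x ->
  'D_u F x = lor ('D_u X x) (e1 x) *: along v1 F x + lor ('D_u X x) (e2 x) *: along v2 F x.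
Proof.
move=> sF Ux; have dF := smooth_differentiable sF Ux.
by rewrite {1}(af_span af u Ux) deriveDv // !deriveZv // !(alongE _ F).
Qed.

(** The bracket is a direction [k] that does not depend on [F]. Its components are read off by
    taking [F = X], for which the derivative along [k] is tangent, and then serve for every [F];
    this stands in for the absence of torsion. *)
Lemma frame_commutator F x : smooth_on U F -> U x ->
  along v1 (along v2 F) x - along v2 (along v1 F) x =
  - w1 x *: along v1 F x - w2 x *: along v2 F x.
Proof.
move=> sF Ux.
have dv1 := smooth_differentiable (af_v1 af) Ux.
have dv2 := smooth_differentiable (af_v2 af) Ux.
pose k := 'D_(v1 x) v2 x - 'D_(v2 x) v1 x.
have comm G : smooth_on U G -> along v1 (along v2 G) x - along v2 (along v1 G) x = 'D_k G x.
  by move=> sG; rewrite !alongE !along_funE; exact: lie_commutator oU Ux dv1 dv2 (sG 2%N).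
have A1 : lor (along v1 e2 x) (e1 x) = - w1 x by rewrite /w1 !alongE; exact: D21.
have A2 : lor (along v2 e1 x) (e1 x) = 0 by rewrite alongE; exact: D11.
have A3 : lor (along v1 e2 x) (e2 x) = 0 by rewrite alongE; exact: D22.
have k1 : lor ('D_k X x) (e1 x) = - w1 x.
  apply: etrans (congr1 (fun w => lor w (e1 x)) (esym (comm _ sX))) _.
  apply: etrans (lorBl _ _ _) _.
  by rewrite A1 A2 subr0.
have k2 : lor ('D_k X x) (e2 x) = - w2 x.
  apply: etrans (congr1 (fun w => lor w (e2 x)) (esym (comm _ sX))) _.
  apply: etrans (lorBl _ _ _) _.
  by rewrite A3 sub0r.
apply: etrans (comm _ sF) _.
apply: etrans (derive_split k sF Ux) _.
by rewrite k1 k2 (scaleNr (w2 x)).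
Qed.

(** Symmetry of the second fundamental form: the commutator applied to [X] is tangent, so it has no
    normal component. *)
Lemma sym13 x : U x -> lor (along v2 e1 x) (e3 x) = b x.
Proof.
move=> Ux; have [_ [[_ h13 _ _ h23] _]] := fr Ux.
have := congr1 (fun w => lor w (e3 x)) (frame_commutator sX Ux).
rewrite /= !lorBl !lorZl -/e1 -/e2 h13 h23 !mulr0 subr0 => /eqP.
by rewrite subr_eq0 /b => /eqP ->.
Qed.

Lemma sym14 x : U x -> lor (along v2 e1 x) (e4 x) = 0.
Proof.
move=> Ux; have [_ [[_ _ h14 _ _] [h24 _ _ _ _]]] := fr Ux.
have := congr1 (fun w => lor w (e4 x)) (frame_commutator sX Ux).
rewrite /= !lorBl !lorZl -/e1 -/e2 h14 h24 !mulr0 subr0 => /eqP.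
by rewrite subr_eq0 (af_B124 af Ux) => /eqP <-.
Qed.

Lemma expand_along v F x : smooth_on U F -> U x -> along v F x =
  lor ('D_(v x) F x) (e1 x) *: e1 x + lor ('D_(v x) F x) (e2 x) *: e2 x
  + lor ('D_(v x) F x) (e3 x) *: e3 x + lor ('D_(v x) F x) (e4 x) *: e4 x
  - lor ('D_(v x) F x) (X x) *: X x.
Proof. by move=> sF Ux; rewrite -alongE; exact: lor_frame_expand (fr Ux). Qed.

Lemma e4_along1 x : U x -> along v1 e4 x = - mu x *: e1 x.
Proof.
move=> Ux; rewrite expand_along // D41 // D42 // D43 // D44 // D4X // -!alongE.
have [_ [[_ _ h14 _ _] _]] := fr Ux.
by rewrite (af_B114 af Ux) (af_B124 af Ux) h14 !oppr0 !scale0r !addr0 subr0.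
Qed.

Lemma e4_along2 x : U x -> along v2 e4 x = mu x *: e2 x.
Proof.
move=> Ux; rewrite expand_along // D41 // D42 // D43 // D44 // D4X // -!alongE.
have [_ [_ [h24 _ _ _ _]]] := fr Ux.
by rewrite (af_B224 af Ux) sym14 // h24 !oppr0 opprK !scale0r !addr0 add0r subr0.
Qed.

Lemma along_lor v F G (g : 'rV[R]_2 -> R^o) x : smooth_on U F -> smooth_on U G -> U x ->
  (forall y, U y -> lor (F y) (G y) = g y) ->
  lor (along v F x) (G x) = 'D_(v x) g x - lor (F x) (along v G x).
Proof.
move=> sF sG Ux E; rewrite !alongE.
by apply: (derive_lor_eq _ oU Ux _ _ E); exact: smooth_differentiable.
Qed.

Lemma along_lor0 v F G x : smooth_on U F -> smooth_on U G -> U x ->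
  (forall y, U y -> lor (F y) (G y) = 0) ->
  lor (along v F x) (G x) = - lor (F x) (along v G x).
Proof.
by move=> sF sG Ux E; rewrite (along_lor v sF sG Ux E) (derive_cst 0) sub0r.
Qed.

Let s1 F : smooth_on U F -> smooth_on U (along v1 F) := fun sF => along_smooth (af_v1 af) sF.
Let s2 F : smooth_on U F -> smooth_on U (along v2 F) := fun sF => along_smooth (af_v2 af) sF.

Lemma derive2_mu x : U x -> 'D_(v2 x) mu x = 0.
Proof. by move=> Ux; rewrite derive_mu // (af_f2 af Ux) mulr0. Qed.

Lemma lor_along2_e4 x y : U x -> lor (along v2 e4 x) y = mu x * lor (e2 x) y.
Proof. by move=> Ux; rewrite e4_along2 // lorZl. Qed.

Lemma lor_along1_e4 x y : U x -> lor (along v1 e4 x) y = - mu x * lor (e1 x) y.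
Proof. by move=> Ux; rewrite e4_along1 // lorZl. Qed.

(* The first two Codazzi equations of [e4] give [w1] and [w2]; the component along [e3] is
   the Ricci equation, which says that the two shape operators commute. *)
Lemma comm4 x y : U x -> lor (along v1 (along v2 e4) x) y - lor (along v2 (along v1 e4) x) y =
  w1 x * mu x * lor (e1 x) y - w2 x * mu x * lor (e2 x) y.
Proof.
move=> Ux; have := congr1 (fun w => lor w y) (frame_commutator se4 Ux).
by rewrite /= !lorBl !lorZl lor_along1_e4 // lor_along2_e4 // => ->; ring.
Qed.

(** Since f is constant along [v2], so is [mu], and the component of [comm4] along [e1] reduces to 2
    mu w1 = 0. *)
Lemma w1_eq0 x : U x -> w1 x = 0.
Proof.
move=> Ux; have [[h11 _ _ _ _] [[h12 _ _ _ _] _]] := fr Ux.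
have := comm4 (e1 x) Ux.
rewrite (along_lor0 v1 (s2 se4) se1 Ux); last first.
  by move=> y Uy; rewrite lor_along2_e4 // lorC; have [_ [[-> _ _ _ _] _]] := fr Uy; rewrite mulr0.
rewrite (along_lor v2 (g := fun y => - mu y) (s1 se4) se1 Ux); last first.
  by move=> y Uy; rewrite lor_along1_e4 //; have [[-> _ _ _ _] _] := fr Uy; rewrite mulr1.
rewrite lor_along1_e4 // lor_along2_e4 // (lorC (e2 x)) (lorC (e1 x)) (alongE v2 e1) D11 //.
rewrite h11 (etrans (lorC (e2 x) (e1 x)) h12) deriveN ?derive2_mu //; last first.
  by apply: diff_derivable; exact: smooth_differentiable smu Ux.
rewrite -/(w1 x) => E; apply: (mulfI (mu_neq0 Ux)); lra.
Qed.

(** Here [mu] varies along [v1] at the rate 2 mu p, and the component along [e2] balances this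
    against the connection: 2 mu p = - 2 mu w2. *)
Lemma w2_eq x : U x -> w2 x = - p x.
Proof.
move=> Ux; have [[_ h22 _ _ _] [[h12 _ _ _ _] _]] := fr Ux.
have := comm4 (e2 x) Ux.
rewrite (along_lor v1 (g := mu) (s2 se4) se2 Ux); last first.
  by move=> y Uy; rewrite lor_along2_e4 //; have [[_ -> _ _ _] _] := fr Uy; rewrite mulr1.
rewrite (along_lor0 v2 (s1 se4) se2 Ux); last first.
  by move=> y Uy; rewrite lor_along1_e4 //; have [_ [[-> _ _ _ _] _]] := fr Uy; rewrite mulr0.
rewrite derive1_mu // lor_along1_e4 // lor_along2_e4 // (lorC (e2 x)) (lorC (e1 x)).
rewrite (alongE v1 e2) (alongE v2 e2) D22 // D21 // -alongE h12 h22 -/(w2 x).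
move=> E; apply: (mulfI (mu_neq0 Ux)); lra.
Qed.

(** The shape operator of [e4] has the distinct eigenvalues [mu] and [- mu], so one commuting with
    it is diagonal: 2 mu b = 0. *)
Lemma b_eq0 x : U x -> b x = 0.
Proof.
move=> Ux; have [_ [[_ h13 _ _ h23] _]] := fr Ux.
have := comm4 (e3 x) Ux.
rewrite (along_lor0 v1 (s2 se4) se3 Ux); last first.
  by move=> y Uy; rewrite lor_along2_e4 //; have [_ [[_ _ _ _ ->] _]] := fr Uy; rewrite mulr0.
rewrite (along_lor0 v2 (s1 se4) se3 Ux); last first.
  by move=> y Uy; rewrite lor_along1_e4 //; have [_ [[_ -> _ _ _] _]] := fr Uy; rewrite mulr0.
rewrite lor_along1_e4 // lor_along2_e4 // (lorC (e2 x)) (lorC (e1 x)) h13 h23.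
rewrite (alongE v1 e3) (alongE v2 e3) D31 // D32 // -!alongE sym13 // -/(b x).
move=> E; apply: (mulfI (mu_neq0 Ux)); lra.
Qed.

Lemma e1_along1 x : U x -> along v1 e1 x = a x *: e3 x + mu x *: e4 x + X x.
Proof.
move=> Ux; rewrite expand_along // D11 // D1X // -!alongE -/(w1 x) w1_eq0 // -/(a x) (af_B114 af Ux).
by have [[-> _ _ _ _] _] := fr Ux; rewrite !scale0r !add0r scaleN1r opprK.
Qed.

Lemma e1_along2 x : U x -> along v2 e1 x = - p x *: e2 x.
Proof.
move=> Ux; rewrite expand_along // D11 // D1X // -!alongE -/(w2 x) w2_eq // sym13 // sym14 // b_eq0 //.
by have [_ [[h12 _ _ _ _] _]] := fr Ux; rewrite (etrans (lorC (e2 x) (e1 x)) h12) oppr0 !scale0r !addr0 add0r subr0.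
Qed.

Lemma e2_along1 x : U x -> along v1 e2 x = 0.
Proof.
move=> Ux; rewrite expand_along // D21 // D22 // D2X // -!alongE -/(w1 x) w1_eq0 // -/(b x) b_eq0 // (af_B124 af Ux).
by have [_ [[-> _ _ _ _] _]] := fr Ux; rewrite oppr0 !scale0r !addr0 subr0.
Qed.

Lemma e2_along2 x : U x ->
  along v2 e2 x = p x *: e1 x + (2 * f x - a x) *: e3 x - mu x *: e4 x + X x.
Proof.
move=> Ux; rewrite expand_along // D21 // D22 // D2X // -!alongE -/(w2 x) w2_eq // (af_B224 af Ux).
have [[_ -> _ _ _] _] := fr Ux.
rewrite (_ : lor (along v2 e2 x) (e3 x) = 2 * f x - a x); last first.
  by have := af_H af Ux; rewrite -/e1 -/e2 -/(a x); lra.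
by rewrite opprK scale0r addr0 scaleNr scaleN1r opprK.
Qed.

Lemma e3_along1 x : U x -> along v1 e3 x = - a x *: e1 x.
Proof.
move=> Ux; rewrite expand_along // D31 // D32 // D33 // (af_parallel af _ Ux) D3X // -!alongE -/(a x) -/(b x) b_eq0 //.
by have [_ [[_ -> _ _ _] _]] := fr Ux; rewrite oppr0 !scale0r !addr0 subr0.
Qed.

Lemma e3_along2 x : U x -> along v2 e3 x = - (2 * f x - a x) *: e2 x.
Proof.
move=> Ux; rewrite expand_along // D31 // D32 // D33 // (af_parallel af _ Ux) D3X // -!alongE.
rewrite sym13 // b_eq0 // (_ : lor (along v2 e2 x) (e3 x) = 2 * f x - a x); last first.
  by have := af_H af Ux; rewrite -/e1 -/e2 -/(a x); lra.
by have [_ [[_ _ _ _ ->] _]] := fr Ux; rewrite !oppr0 !scale0r !addr0 add0r subr0.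
Qed.

Lemma along_near0 v F x : U x -> (forall y, U y -> F y = 0) -> along v F x = 0.
Proof.
move=> Ux F0; rewrite alongE.
apply: etrans (near_eq_derive _ (near_open oU Ux F0 : \near x, F x = cst 0 x)) _.
exact: derive_cst.
Qed.

(** With W = D_2 e2 this reads D_1 W = p W: the direction of W does not change along [v1]. It holds
    because [e2] is constant along [v1]. *)
Lemma e2_along12 x : U x -> along v1 (along v2 e2) x = p x *: along v2 e2 x.
Proof.
move=> Ux; have := frame_commutator se2 Ux.
rewrite (along_near0 v2 Ux e2_along1) e2_along1 // w2_eq // subr0 scaler0 sub0r => ->.
by rewrite scaleNr opprK.
Qed.

Let sa : smooth_on U (a : 'rV[R]_2 -> R^o).
Proof. by move=> k; exact: (Ck_on_lor oU (s1 se1 k) (se3 k)). Qed.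

Lemma lor_e2_along2 x y : U x -> lor (along v2 e2 x) y =
  p x * lor (e1 x) y + (2 * f x - a x) * lor (e3 x) y - mu x * lor (e4 x) y + lor (X x) y.
Proof. by move=> Ux; rewrite e2_along2 // !(lorDl, lorNl, lorZl). Qed.

(** Differentiate <D_2 e2, e1> = p along [v1], using D_1 D_2 e2 = p D_2 e2. The term -1 is the
    curvature of the ambient space, contributed by the position vector. *)
Lemma gauss x : U x -> 'D_(v1 x) p x = p x ^+ 2 + a x * (2 * f x - a x) - mu x ^+ 2 - 1.
Proof.
move=> Ux; have [[h11 h22 h33 h44 hxx] [[h12 h13 h14 h1x h23] [h24 h2x h34 h3x h4x]]] := fr Ux.
have Hp y : U y -> lor (along v2 e2 y) (e1 y) = p y.
  move=> Uy; rewrite lor_e2_along2 //.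
  have [[k11 _ _ _ _] [[_ k13 k14 k1x _] _]] := fr Uy.
  by rewrite (lorC (e3 y)) (lorC (e4 y)) (lorC (X y)) k11 k13 k14 k1x; ring.
have := along_lor v1 (g := p) (s2 se2) se1 Ux Hp; rewrite e2_along12 // lorZl Hp //.
rewrite lor_e2_along2 // e1_along1 // !(lorDr, lorZr) h33 h44 hxx h13 h14 h1x.
rewrite (lorC (e4 x) (e3 x)) (lorC (X x) (e3 x)) (lorC (X x) (e4 x)) h34 h3x h4x => H.
rewrite !expr2; lra.
Qed.

(** The component along [e2] of the commutator applied to [e3], where <D_2 e3, e2> = a - 2 f because
    the trace of the shape operator of [e3] is 2 f. *)
Lemma codazzi x : U x -> 'D_(v1 x) f x * 2 - 'D_(v1 x) (a : 'rV[R]_2 -> R^o) x = p x * (2 * f x - 2 * a x).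
Proof.
move=> Ux; have [[h11 h22 h33 h44 hxx] [[h12 h13 h14 h1x h23] [h24 h2x h34 h3x h4x]]] := fr Ux.
have := congr1 (fun w => lor w (e2 x)) (frame_commutator se3 Ux).
rewrite /= w1_eq0 // w2_eq // !lorBl !lorZl.
rewrite (along_lor v1 (g := fun y => a y - 2 * f y) (s2 se3) se2 Ux); last first.
  move=> y Uy; rewrite e3_along2 // lorZl; have [[_ -> _ _ _] _] := fr Uy; ring.
rewrite (along_lor0 v2 (s1 se3) se2 Ux); last first.
  by move=> y Uy; rewrite e3_along1 // lorZl; have [_ [[-> _ _ _ _] _]] := fr Uy; rewrite mulr0.
rewrite e2_along1 // lor0r e3_along1 // e3_along2 // !lorZl (lorC (e1 x)) lor_e2_along2 //.
rewrite (lorC (e3 x) (e1 x)) (lorC (e4 x) (e1 x)) (lorC (X x) (e1 x)) h11 h13 h14 h1x h12 h22.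
have df := smooth_differentiable (af_f af) Ux.
have da := smooth_differentiable sa Ux.
have [d2 D2] := differentiable_scale (differentiable_cst (2 : R^o) x) df.
rewrite deriveB; [|exact: diff_derivable..].
rewrite (_ : 'D_(v1 x) (fun y => 2 * f y) x = 2 * 'D_(v1 x) f x); last first.
  by apply: etrans (D2 (v1 x)) _; rewrite derive_cst scale0r add0r.
lra.
Qed.

Lemma mu_sqr x : U x -> mu x ^+ 2 = c ^+ 2 * f x ^+ 3.
Proof.
move=> Ux; have f0 := ltW (af_f_gt0 af Ux).
by rewrite /mu powR32 // !exprMn sqr_sqrtr //; ring.
Qed.

Lemma p_sqr x : U x -> p x ^+ 2 = radicand c C (f x).
Proof. by move=> Ux; rewrite sqr_sqrtr // ltW // radicand_gt0. Qed.

(* [derive_p] and the equation for [f] turn the Gauss equation into a quadratic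
   equation for [a]. *)
Lemma a_quadratic x : U x -> (a x - 3 * f x) * (a x + f x) = 0.
Proof.
move=> Ux; have f0 := af_f_gt0 af Ux; have p0 := p_gt0 Ux.
have := gauss Ux; rewrite derive_p // (af_f1 af Ux) mu_sqr // -/(p x).
have -> : radicand' c C (f x) / (2 * p x) * (4 / 3 * f x * p x) = 2 / 3 * f x * radicand' c C (f x).
  by field; rewrite gt_eqF.
rewrite p_sqr // /radicand /radicand' powR32 ?(ltW f0) // => E.
lra.
Qed.

(* By continuity [a = 3 f] would hold near [x], and contradict the Codazzi equation. *)
Lemma a_neq_3f x : U x -> a x = 3 * f x -> False.
Proof.
move=> Ux ax; have f0 := af_f_gt0 af Ux.
have ca : {for x, continuous (fun y => a y + f y : R^o)}.
  exact: Ck_on_continuous (Ck_onD oU (sa 0%N) (af_f af 0%N)) Ux.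
have near_pos : \forall y \near x, 0 < a y + f y.
  apply: (cvgr_gt _ ca) => //; rewrite ax; lra.
have E : \forall y \near x, a y = 3 * f y.
  apply: filterS2 near_pos (open_nbhs_nbhs (conj oU Ux)) => y pos Uy.
  move/eqP: (a_quadratic Uy); rewrite mulf_eq0 (gt_eqF pos) orbF subr_eq0 => /eqP; exact.
have := codazzi Ux; rewrite (near_eq_derive _ (E : \near x, a x = (fun y => 3 * f y) x)).
have df := smooth_differentiable (af_f af) Ux.
have [_ D3] := differentiable_scale (differentiable_cst (3 : R^o) x) df.
have -> : 'D_(v1 x) (fun y => 3 * f y) x = 3 * 'D_(v1 x) f x.
  by apply: etrans (D3 (v1 x)) _; rewrite derive_cst scale0r add0r.
(* With a = 3 f the Codazzi equation reads - f' = - 4 f p, whereas f' = 4/3 f p > 0. *)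
have := af_f1_gt0 af Ux; rewrite (af_f1 af Ux) -/(p x) ax.
have := mulr_gt0 f0 (p_gt0 Ux).
lra.
Qed.

Lemma a_eq x : U x -> a x = - f x.
Proof.
move=> Ux; move/eqP: (a_quadratic Ux); rewrite mulf_eq0 subr_eq0 addr_eq0.
by move=> /orP[/eqP /(a_neq_3f Ux)[]|/eqP].
Qed.

Let W := along v2 e2.

Lemma WE x : U x -> W x = p x *: e1 x + (3 * f x) *: e3 x - mu x *: e4 x + X x.
Proof.
by move=> Ux; rewrite /W e2_along2 // a_eq // (_ : 2 * f x - - f x = 3 * f x) //; ring.
Qed.

Lemma lorW x y : U x -> lor (W x) y =
  p x * lor (e1 x) y + 3 * f x * lor (e3 x) y - mu x * lor (e4 x) y + lor (X x) y.
Proof. by move=> Ux; rewrite WE // !(lorDl, lorNl, lorZl). Qed.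

Lemma lorW_frame x : U x -> [/\ lor (W x) (e1 x) = p x, lor (W x) (e2 x) = 0,
  lor (W x) (e3 x) = 3 * f x, lor (W x) (e4 x) = - mu x & lor (W x) (X x) = -1].
Proof.
move=> Ux; have [[h11 h22 h33 h44 hxx] [[h12 h13 h14 h1x h23] [h24 h2x h34 h3x h4x]]] := fr Ux.
rewrite !lorW // (lorC (e3 x) (e1 x)) (lorC (e4 x) (e1 x)) (lorC (X x) (e1 x)).
rewrite (lorC (e3 x) (e2 x)) (lorC (e4 x) (e2 x)) (lorC (X x) (e2 x)).
rewrite (lorC (e4 x) (e3 x)) (lorC (X x) (e3 x)) (lorC (X x) (e4 x)).
by rewrite h11 h12 h13 h14 h1x h23 h24 h2x h34 h3x h4x h33 h44 hxx; split; ring.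
Qed.

(** The square is p^2 + 9 f^2 + mu^2 - 1, and inserting the radicand for p^2 leaves only 9 C
    f^(3/2). *)
Lemma lorWW x : U x -> 0 <= C -> lor (W x) (W x) = kappahat C (f x) ^+ 2.
Proof.
move=> Ux C0; have f0 := ltW (af_f_gt0 af Ux).
have [k1 k2 k3 k4 kX] := lorW_frame Ux.
rewrite lorW // !(lorC _ (W x)) k1 k3 k4 kX /kappahat !exprMn sqr_sqrtr // powR34_sqr //.
have := p_sqr Ux; have := mu_sqr Ux; rewrite /radicand powR32 //; lra.
Qed.

(** The coefficients of [W] in the frame depend on f only, hence are constant along [v2]. Moreover
    D_2 of [e1], [e3], [e4] and [X] is a multiple of [e2], which is orthogonal to [W]; so only the
    component along [e2] survives, and it equals - <W, W>. *)
Lemma W_along2 x : U x -> 0 <= C -> along v2 W x = - kappahat C (f x) ^+ 2 *: e2 x.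
Proof.
move=> Ux C0; have sW : smooth_on U W := s2 se2.
have [k1 k2 k3 k4 kX] := lorW_frame Ux.
have d2 (g : R^o -> R^o) (g' : R) : is_derive (f x) 1 g g' -> 'D_(v2 x) (fun y => g (f y) : R^o) x = 0.
  by move=> Hg; rewrite (derive_of_f (v2 x) Ux Hg) (af_f2 af Ux) mulr0.
have E1 : lor (along v2 W x) (e1 x) = 0.
  rewrite (along_lor v2 (g := p) sW se1 Ux); last by move=> y /lorW_frame[].
  rewrite e1_along2 // lorZr k2 mulr0 subr0 derive_p // (af_f2 af Ux) mulr0 //.
have E3 : lor (along v2 W x) (e3 x) = 0.
  rewrite (along_lor v2 (g := fun y => 3 * f y) sW se3 Ux); last by move=> y /lorW_frame[].
  rewrite e3_along2 // lorZr k2 mulr0 subr0.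
  by apply: (d2 (fun t => 3 * t) (3 * 1)).
have E4 : lor (along v2 W x) (e4 x) = 0.
  rewrite (along_lor v2 (g := fun y => - mu y) sW se4 Ux); last by move=> y /lorW_frame[].
  rewrite e4_along2 // lorZr k2 mulr0 subr0 deriveN ?derive2_mu ?oppr0 //.
  by apply: diff_derivable; exact: smooth_differentiable smu Ux.
have EX : lor (along v2 W x) (X x) = 0.
  rewrite (along_lor v2 (g := cst (-1)) sW sX Ux); last by move=> y /lorW_frame[].
  by rewrite -/e2 k2 subr0 derive_cst.
have E2 : lor (along v2 W x) (e2 x) = - kappahat C (f x) ^+ 2.
  rewrite (along_lor0 v2 sW se2 Ux); last by move=> y /lorW_frame[].
  by rewrite -/W lorWW.
rewrite {1}(lor_frame_expand (along v2 W x) (fr Ux)) E1 E2 E3 E4 EX.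
by rewrite !scale0r !addr0 add0r subr0.
Qed.

Hypothesis C_gt0 : 0 < C.

Let kh x := kappahat C (f x).
Let n x := (kh x)^-1 *: W x.

Let kh0 x : U x -> 0 < kh x.
Proof. by move=> Ux; apply: kappahat_gt0 => //; exact: (af_f_gt0 af). Qed.

Lemma derive_e2 x u : U x -> 'D_u e2 x = (kh x * lor ('D_u X x) (e2 x)) *: n x.
Proof.
move=> Ux; rewrite (derive_split u se2 Ux) e2_along1 // scaler0 add0r scalerA -/W.
by rewrite mulrAC divff ?mul1r // gt_eqF // kh0.
Qed.

Lemma smooth_kh : smooth_on U (kh : 'rV[R]_2 -> R^o).
Proof.
move=> k; apply: Ck_onM => //; first exact: Ck_on_cst.
by apply: Ck_on_powR => //; [exact: (af_f_gt0 af)|exact: (af_f af)].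
Qed.

Lemma smooth_n : smooth_on U n.
Proof.
move=> k; apply: Ck_onZ => //; last exact: (s2 se2 k).
by apply: Ck_onV => //; [move=> x Ux; rewrite gt_eqF // kh0|exact: smooth_kh].
Qed.

Lemma derive_f x u : U x -> 'D_u f x = 4 / 3 * f x * p x * lor ('D_u X x) (e1 x).
Proof.
move=> Ux; have df := smooth_differentiable (af_f af) Ux.
rewrite {1}(af_span af u Ux) deriveDv // !deriveZv // (af_f1 af Ux) (af_f2 af Ux).
by rewrite scaler0 addr0 /GRing.scale /= mulrC.
Qed.

Lemma derive_n x u : U x -> 'D_u n x = - (kh x * lor ('D_u X x) (e2 x)) *: e2 x.
Proof.
move=> Ux; have f0 := af_f_gt0 af Ux; have k0 := kh0 Ux.
have sW : smooth_on U W := s2 se2.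
have skv : smooth_on U (fun y => (kh y)^-1 : R^o).
  by move=> k; apply: Ck_onV => //; [move=> y Uy; rewrite gt_eqF // kh0|exact: smooth_kh].
have [_ D] := differentiable_scale (smooth_differentiable skv Ux) (smooth_differentiable sW Ux).
rewrite /n D (derive_of_f u Ux (derive_kappahatV C_gt0 f0)) derive_f // -/(kh x).
rewrite (derive_split u sW Ux) (W_along2 Ux (ltW C_gt0)) /W e2_along12 // -/W -/(kh x).
(* Along [v1] both [W] and [kh] grow at the rate p, so the coefficient of [W x] in the derivative of
   the quotient vanishes. *)
rewrite scalerDr !scalerA addrA -scalerDl [X in X *: W x + _](_ : _ = 0) ?scale0r ?add0r; last first.
  by field; rewrite !gt_eqF.
by congr (_ *: _); field; rewrite gt_eqF.
Qed.

Lemma derive_e1 x u : U x -> 'D_u e1 x =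
  lor ('D_u X x) (e1 x) *: (- f x *: e3 x + mu x *: e4 x + X x)
  - (p x * lor ('D_u X x) (e2 x)) *: e2 x.
Proof.
move=> Ux; rewrite (derive_split u se1 Ux) e1_along1 // e1_along2 // a_eq //.
by congr (_ + _); rewrite scalerA mulrN (mulrC (p x)) scaleNr.
Qed.

Lemma derive_e3 x u : U x -> 'D_u e3 x =
  (f x * lor ('D_u X x) (e1 x)) *: e1 x - (3 * f x * lor ('D_u X x) (e2 x)) *: e2 x.
Proof.
move=> Ux; rewrite (derive_split u se3 Ux) e3_along1 // e3_along2 // a_eq // !scalerA -scaleNr.
by congr (_ *: _ + _ *: _); ring.
Qed.

Lemma derive_e4 x u : U x -> 'D_u e4 x =
  - (mu x * lor ('D_u X x) (e1 x)) *: e1 x + (mu x * lor ('D_u X x) (e2 x)) *: e2 x.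
Proof.
move=> Ux; rewrite (derive_split u se4 Ux) e4_along1 // e4_along2 // !scalerA.
by congr (_ *: _ + _ *: _); ring.
Qed.

Lemma n_frame x : U x -> [/\ lor (n x) (n x) = 1, lor (n x) (e2 x) = 0 & lor (X x) (n x) = - (kh x)^-1].
Proof.
move=> Ux; have [_ k2 _ _ kX] := lorW_frame Ux; have k0 := kh0 Ux.
rewrite (lorC (X x)) /n !(lorZl, lorZr) lorWW ?(ltW C_gt0) // k2 kX mulr0 mulrN1.
by split=> //; rewrite -/(kh x); field; rewrite gt_eqF.
Qed.

End AdaptedFrame.

Section CanonicalFrame.
Context {R : realType}.

(* [lor ('D_u X x) (e1 x)] and [lor ('D_u X x) (e2 x)] are the components of [u]
   in the adapted tangent frame; [n] is the principal normal of the integral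
   curves of [e2], and [w1], [w2] turn out to be the coordinate fields. *)
Record canonical_frame (U : set 'rV[R]_2) (X e1 e2 e3 e4 n : 'rV[R]_2 -> 'rV[R]_5)
    (w1 w2 : 'rV[R]_2 -> 'rV[R]_2) (f : 'rV[R]_2 -> R^o) (c C : R) : Prop := CanonicalFrame {
  cf_open : open U;
  cf_X : smooth_on U X;
  cf_e1 : smooth_on U e1;
  cf_e2 : smooth_on U e2;
  cf_e3 : smooth_on U e3;
  cf_e4 : smooth_on U e4;
  cf_n : smooth_on U n;
  cf_f : smooth_on U f;
  cf_w1 : smooth_on U w1;
  cf_w2 : smooth_on U w2;
  cf_frame : forall x, U x -> lor_frame (e1 x) (e2 x) (e3 x) (e4 x) (X x);
  cf_f_gt0 : forall x, U x -> 0 < f x;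
  cf_rad_gt0 : forall x, U x -> 0 < radicand c C (f x);
  cf_span : forall x u, U x -> u = lor ('D_u X x) (e1 x) *: w1 x
    + (kappahat C (f x) * lor ('D_u X x) (e2 x)) *: w2 x;
  cf_DX : forall x u, U x ->
    'D_u X x = lor ('D_u X x) (e1 x) *: e1 x + lor ('D_u X x) (e2 x) *: e2 x;
  cf_Df : forall x u, U x ->
    'D_u f x = 4 / 3 * f x * Num.sqrt (radicand c C (f x)) * lor ('D_u X x) (e1 x);
  cf_De1 : forall x u, U x -> 'D_u e1 x =
    lor ('D_u X x) (e1 x) *: (- f x *: e3 x + (c * f x `^ (3 / 2)) *: e4 x + X x)
    - (Num.sqrt (radicand c C (f x)) * lor ('D_u X x) (e2 x)) *: e2 x;
  cf_De2 : forall x u, U x ->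
    'D_u e2 x = (kappahat C (f x) * lor ('D_u X x) (e2 x)) *: n x;
  cf_De3 : forall x u, U x -> 'D_u e3 x =
    (f x * lor ('D_u X x) (e1 x)) *: e1 x - (3 * f x * lor ('D_u X x) (e2 x)) *: e2 x;
  cf_De4 : forall x u, U x -> 'D_u e4 x =
    - (c * f x `^ (3 / 2) * lor ('D_u X x) (e1 x)) *: e1 x
    + (c * f x `^ (3 / 2) * lor ('D_u X x) (e2 x)) *: e2 x;
  cf_Dn : forall x u, U x ->
    'D_u n x = - (kappahat C (f x) * lor ('D_u X x) (e2 x)) *: e2 x;
  cf_n_frame : forall x, U x -> [/\ lor (n x) (n x) = 1, lor (n x) (e2 x) = 0
    & lor (X x) (n x) = - (kappahat C (f x))^-1] }.

Lemma canonical_frame_exists U X v1 v2 e3 e4 f c C : 0 < C ->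
  adapted_frame U X v1 v2 e3 e4 f c C -> exists e1 e2 n w1 w2,
  canonical_frame U X e1 e2 e3 e4 n w1 w2 f c C.
Proof.
move=> C0 af; have oU := af_open af.
pose e1 := along v1 X; pose e2 := along v2 X.
pose n := fun x => (kappahat C (f x))^-1 *: along v2 e2 x.
exists e1, e2, n, v1, (fun x => (kappahat C (f x))^-1 *: v2 x).
have k0 x : U x -> 0 < kappahat C (f x).
  by move=> Ux; apply: kappahat_gt0 => //; exact: (af_f_gt0 af).
have kV x : U x -> kappahat C (f x) / kappahat C (f x) = 1.
  by move=> Ux; rewrite divff // gt_eqF // k0.
split => //.
- exact: (af_X af).
- exact (along_smooth af (af_v1 af) (af_X af)).
- exact (along_smooth af (af_v2 af) (af_X af)).
- exact: (af_e3 af).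
- exact: (af_e4 af).
- exact (smooth_n af C0).
- exact: (af_f af).
- exact: (af_v1 af).
- move=> k; apply: Ck_onZ => //; last exact: (af_v2 af k).
  by apply: Ck_onV => //; [move=> x Ux; rewrite gt_eqF // k0|exact: (smooth_kh af)].
- exact: (af_frame af).
- exact: (af_f_gt0 af).
- exact: (radicand_gt0 af).
- move=> x u Ux; rewrite {1}(af_span af u Ux) scalerA.
  by rewrite mulrAC kV // mul1r.
- move=> x u Ux; apply: etrans (derive_split af u (af_X af) Ux) _; exact: erefl.
- exact (derive_f af).
- exact (derive_e1 af).
- exact (derive_e2 af C0).
- exact (derive_e3 af).
- exact (derive_e4 af).
- exact (derive_n af C0).
- exact (n_frame af C0).
Qed.
End CanonicalFrame.

(** * Coordinates adapted to the principal curves *)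

Section Flattening.
Context {R : realType}.
Implicit Types V W : normedModType R.

Lemma smooth_onS V W (U U' : set V) (F : V -> W) : U' `<=` U -> smooth_on U F -> smooth_on U' F.
Proof. by move=> UU sF k; exact: Ck_onS (sF k). Qed.

Lemma smooth_on_derive V W (U : set V) (F : V -> W) u : smooth_on U F -> smooth_on U ('D_u F).
Proof. by move=> sF k; exact: Ck_on_derive (sF k.+1). Qed.

Lemma smooth_of_derive V W (U : set V) (F : V -> W) (DF : V -> V -> W) : open U ->
  (forall x, U x -> differentiable F x) -> (forall v x, U x -> 'D_v F x = DF v x) ->
  (forall v, smooth_on U (DF v)) -> smooth_on U F.
Proof. by move=> oU dF DFE sDF k; apply: Ck_onW; exact: (Ck_onSE oU dF DFE (fun v => sDF v k)). Qed.

(** Along E1 the function f solves an autonomous equation with positive right-hand side, so arc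
    length is a function of f, namely a primitive of the reciprocal. The radius is halved because
    the primitive is taken over a closed interval of continuity. *)
Lemma arclength_parameter (c C f0 : R) : 0 < f0 -> 0 < radicand c C f0 ->
  exists (d : R) (G : R -> R), [/\ 0 < d, forall t, `|f0 - t| < d -> 0 < t /\ 0 < radicand c C t &
    forall t, `|f0 - t| < d ->
      is_derive (t : R^o) 1 (G : R^o -> R^o) (4 / 3 * t * Num.sqrt (radicand c C t))^-1].
Proof.
move=> f00 r0.
have n1 : \forall t \near f0, 0 < t by exact: lt_nbhsr.
have c2 : {for f0, continuous (radicand c C : R^o -> R^o)}.
  have [H _] := derive_radicand c C f00; exact/differentiable_continuous/derivable1_diffP.
have n2 : \forall t \near f0, 0 < radicand c C t by exact: (cvgr_gt _ c2).
have n12 : nbhs f0 ([set t | 0 < t] `&` [set t | 0 < radicand c C t]) by exact: (filterI n1 n2).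
have [d /= d0 dP] := (nbhs_ballP _ _).1 n12.
have dP' t : `|f0 - t| < d -> 0 < t /\ 0 < radicand c C t by move=> td; exact: (dP t).
pose g (t : R) : R := (4 / 3 * t * Num.sqrt (radicand c C t))^-1.
have cg t : `|f0 - t| < d -> {for t, continuous g}.
  move=> /dP' [t0 rt0].
  have cr : {for t, continuous (radicand c C : R^o -> R^o)}.
    have [H _] := derive_radicand c C t0; exact/differentiable_continuous/derivable1_diffP.
  apply: cvgV; first by rewrite gt_eqF // !mulr_gt0 ?divr_gt0 ?sqrtr_gt0.
  apply: cvgM; first by apply: cvgM; [exact: cvg_cst|exact: cvg_id].
  by apply: (@continuous_comp _ _ _ (radicand c C) (@Num.sqrt R)); [exact: cr|exact: sqrt_continuous].
have d20 : 0 < d / 2 by rewrite divr_gt0.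
have [||G GP] := @antiderivative R g (f0 - d / 2) (f0 + d / 2); first lra.
  by move=> t /andP[t1 t2]; apply: cg; rewrite ltr_norml; apply/andP; split; lra.
exists (d / 2), G; split=> // t td.
  by apply: dP'; lra.
apply: GP; move: td; rewrite ltr_norml => /andP[? ?]; apply/andP; split; lra.
Qed.

Variables (U : set 'rV[R]_2) (X e1 e2 e3 e4 n : 'rV[R]_2 -> 'rV[R]_5).
Variables (w1 w2 : 'rV[R]_2 -> 'rV[R]_2) (f : 'rV[R]_2 -> R^o) (c C : R).
Hypothesis cf : canonical_frame U X e1 e2 e3 e4 n w1 w2 f c C.
Hypothesis C_gt0 : 0 < C.

Let oU := cf_open cf.
Let th1 (u x : 'rV[R]_2) : R^o := lor ('D_u X x) (e1 x).
Let th2 (u x : 'rV[R]_2) : R^o := kappahat C (f x) * lor ('D_u X x) (e2 x).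

Let diffU W (F : 'rV[R]_2 -> W) x : smooth_on U F -> U x -> differentiable F x.
Proof. by move=> sF; exact: Ck_on_differentiable (sF 1%N). Qed.

Lemma kappahat_f_gt0 x : U x -> 0 < kappahat C (f x).
Proof. by move=> Ux; apply: kappahat_gt0 => //; exact: (cf_f_gt0 cf). Qed.

Lemma smooth_th1 u : smooth_on U (th1 u).
Proof. by move=> k; apply: Ck_on_lor => //; [exact: smooth_on_derive (cf_X cf) k|exact: (cf_e1 cf)]. Qed.

Lemma smooth_th2 u : smooth_on U (th2 u).
Proof.
move=> k; apply: Ck_onM => //.
  apply: Ck_onM => //; first exact: Ck_on_cst.
  by apply: Ck_on_powR => //; [exact: (cf_f_gt0 cf)|exact: (cf_f cf)].
by apply: Ck_on_lor => //; [exact: smooth_on_derive (cf_X cf) k|exact: (cf_e2 cf)].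
Qed.

Lemma arclength_coordinate x0 : U x0 -> exists e (S : 'rV[R]_2 -> R^o),
  [/\ 0 < e, forall x, ball x0 e x -> U x, forall x, ball x0 e x -> differentiable S x &
   forall x u, ball x0 e x -> 'D_u S x = th1 u x].
Proof.
move=> Ux0.
have [d [G [d0 dP GP]]] := arclength_parameter (cf_f_gt0 cf Ux0) (cf_rad_gt0 cf Ux0).
have nf : \forall x \near x0, `|f x0 - f x| < d.
  have cfx : {for x0, continuous f} by exact: Ck_on_continuous (cf_f cf 0%N) Ux0.
  exact: (cvgrPdist_lt _ _).1 cfx d d0.
have nn : nbhs x0 (U `&` [set x | `|f x0 - f x| < d]).
  exact: (filterI (open_nbhs_nbhs (conj oU Ux0)) nf).
have [e /= e0 eP] := (nbhs_ballP _ _).1 nn.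
exists e, (fun x => G (f x)); split => [//|x /eP[]//|x /eP[Ux fx]|x u /eP[Ux fx]].
  exact: (differentiable_comp1 (diffU (cf_f cf) Ux) (GP _ fx)).1.
rewrite (differentiable_comp1 (diffU (cf_f cf) Ux) (GP _ fx)).2 (cf_Df cf u Ux) -/(th1 u x).
have [t0 r0] := dP _ fx.
by rewrite /th1; field; rewrite !gt_eqF // sqrtr_gt0.
Qed.

(** [A] and [B] are the sine and the cosine of the angle by which the pair ([e2], [n]) has turned
    since [x0]. Turning it back gives [P] and [Q], which have zero derivative; this also yields A^2
    + B^2 = 1. The ball is shrunk to [B > 0], so that [asin] inverts the sine smoothly. *)
Lemma angle_coordinate x0 : U x0 -> exists e (T : 'rV[R]_2 -> R^o),
  [/\ 0 < e, forall x, ball x0 e x -> U x, forall x, ball x0 e x -> differentiable T x,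
   forall x u, ball x0 e x -> 'D_u T x = th2 u x &
   T x0 = 0 /\ forall x, ball x0 e x ->
     e2 x = cos (T x) *: e2 x0 + sin (T x) *: n x0 /\ n x = cos (T x) *: n x0 - sin (T x) *: e2 x0].
Proof.
move=> Ux0; have [nn0 ne0 _] := cf_n_frame cf Ux0.
have [[_ ee0 _ _ _] _] := cf_frame cf Ux0.
pose A x : R^o := lor (e2 x) (n x0).
pose B x : R^o := lor (n x) (n x0).
have A0 : A x0 = 0 by rewrite /A lorC.
have B0 : B x0 = 1 by [].
have dcst (w : 'rV[R]_5) x : differentiable (cst w : 'rV[R]_2 -> 'rV[R]_5) x by exact: differentiable_cst.
have dA x : U x -> differentiable A x /\ forall u, 'D_u A x = th2 u x * B x.
  move=> Ux; have [d1 D1] := differentiable_lor (diffU (cf_e2 cf) Ux) (dcst (n x0) x).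
  by split=> // u; apply: etrans (D1 u) _; rewrite derive_cst lor0r addr0 (cf_De2 cf u Ux) lorZl.
have dB x : U x -> differentiable B x /\ forall u, 'D_u B x = - (th2 u x * A x).
  move=> Ux; have [d1 D1] := differentiable_lor (diffU (cf_n cf) Ux) (dcst (n x0) x).
  by split=> // u; apply: etrans (D1 u) _; rewrite derive_cst lor0r addr0 (cf_Dn cf u Ux) lorZl mulNr.
have nB : \forall x \near x0, 0 < B x.
  have cB : {for x0, continuous B} by exact: differentiable_continuous (dB _ Ux0).1.
  by apply: (cvgr_gt _ cB); rewrite B0.
have nb : nbhs x0 (U `&` [set x | 0 < B x]).
  exact: (filterI (open_nbhs_nbhs (conj oU Ux0)) nB).
have [e /= e0 eP] := (nbhs_ballP _ _).1 nb.
have eU x : ball x0 e x -> U x by move=> /eP[].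
have x0e : ball x0 e x0 by exact: ballxx.
pose P x := B x *: e2 x - A x *: n x.
pose Q x := A x *: e2 x + B x *: n x.
have dPQ x : ball x0 e x -> [/\ differentiable P x, differentiable Q x,
    forall u, 'D_u P x = 0 & forall u, 'D_u Q x = 0].
  move=> /eU Ux; have [dAx DA] := dA _ Ux; have [dBx DB] := dB _ Ux.
  have d2 := diffU (cf_e2 cf) Ux; have dn := diffU (cf_n cf) Ux.
  have [a1 a2] := differentiable_scale dBx d2.
  have [b1 b2] := differentiable_scale dAx dn.
  have [c1 c2] := differentiable_scale dAx d2.
  have [d1 d3] := differentiable_scale dBx dn.
  have De2 u : 'D_u e2 x = th2 u x *: n x := cf_De2 cf u Ux.
  have Dn u : 'D_u n x = - th2 u x *: e2 x := cf_Dn cf u Ux.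
  split.
  - by apply: differentiableB.
  - by apply: differentiableD.
  - move=> u; rewrite deriveB; [|exact: diff_derivable..].
    rewrite a2 b2 DA DB De2 Dn !scalerA opprD !addrA [_ - _ + _]addrAC.
    by apply/rowP => i; rewrite !mxE; ring.
  - move=> u; rewrite deriveD; [|exact: diff_derivable..].
    rewrite c2 d3 DA DB De2 Dn.
    by apply/rowP => i; rewrite !mxE; ring.
have Pc x : ball x0 e x -> P x = e2 x0.
  move=> xe; rewrite (@constant_on_ball _ _ _ _ P x0 e _ _ x x0 xe x0e).
  - by rewrite /P A0 B0 scale0r subr0 scale1r.
  - by move=> y /dPQ[].
  - by move=> y v /dPQ[].
have Qc x : ball x0 e x -> Q x = n x0.
  move=> xe; rewrite (@constant_on_ball _ _ _ _ Q x0 e _ _ x x0 xe x0e).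
  - by rewrite /Q A0 B0 scale0r add0r scale1r.
  - by move=> y /dPQ[].
  - by move=> y v /dPQ[].
have AB x : ball x0 e x -> A x ^+ 2 + B x ^+ 2 = 1.
  move=> xe; have := congr1 (fun w => lor w (n x0)) (Qc x xe).
  by rewrite /Q /= lorDl !lorZl nn0 -/(A x) -/(B x) !expr2.
have B_gt0 x : ball x0 e x -> 0 < B x by move=> /eP[].
have A1 x : ball x0 e x -> -1 < A x < 1.
  move=> xe; rewrite -ltr_norml -(@ltr_pXn2r _ 2) ?nnegrE // expr1n real_normK ?num_real //.
  by rewrite -(AB x xe) ltrDl exprn_gt0 // B_gt0.
have Bsq x : ball x0 e x -> Num.sqrt (1 - A x ^+ 2) = B x.
  by move=> xe; rewrite -(AB x xe) addrAC subrr add0r sqrtr_sqr gtr0_norm // B_gt0.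
exists e, (fun x => asin (A x)); split => //.
- move=> x xe; exact: (differentiable_comp1 (dA _ (eU _ xe)).1 (is_derive1_asin (A1 _ xe))).1.
- move=> x u xe; rewrite (differentiable_comp1 (dA _ (eU _ xe)).1 (is_derive1_asin (A1 _ xe))).2.
  rewrite (dA _ (eU _ xe)).2 Bsq //; field.
  by rewrite gt_eqF // B_gt0.
have pi0 := pi_ge0 R.
split.
  by rewrite A0 -[in asin 0](@sin0 R) sinK // in_itv /=; apply/andP; split; lra.
move=> x xe; have /andP[/ltW a1 /ltW a2] := A1 _ xe.
rewrite asinK ?in_itv /= ?a1 ?a2 // cos_asin ?a1 ?a2 // Bsq //.
have := AB _ xe; rewrite -(Pc _ xe) -(Qc _ xe) /P /Q => E.
by split; apply/rowP => i; rewrite !mxE -[LHS]mul1r -E; ring.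
Qed.

Lemma flat_coordinates x0 : U x0 -> exists e r (F h : 'rV[R]_2 -> 'rV[R]_2),
  [/\ 0 < e, 0 < r, ball x0 e `<=` U, smooth_on (ball x0 e) F
    & smooth_on (ball (F x0) r) h] /\
  [/\ forall x y, ball x0 e x -> ball x0 e y -> F x = F y -> x = y,
    forall y, ball (F x0) r y -> ball x0 e (h y) /\ F (h y) = y,
    forall y v, ball (F x0) r y -> lor ('D_('D_v h y) X (h y)) (e1 (h y)) = v 0 0 /\
      kappahat C (f (h y)) * lor ('D_('D_v h y) X (h y)) (e2 (h y)) = v 0 1,
    F x0 0 1 = 0
    & forall x, ball x0 e x ->
      e2 x = cos (F x 0 1) *: e2 x0 + sin (F x 0 1) *: n x0 /\
      n x = cos (F x 0 1) *: n x0 - sin (F x 0 1) *: e2 x0].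
Proof.
move=> Ux0.
have [eS [S [eS0 eSU dS DS]]] := arclength_coordinate Ux0.
have [eT [T [eT0 eTU dT DT [T0 rot]]]] := angle_coordinate Ux0.
pose e := Num.min eS eT.
have e0 : 0 < e by rewrite lt_min eS0 eT0.
have eS' x : ball x0 e x -> ball x0 eS x by apply: le_ball; rewrite ge_min lexx.
have eT' x : ball x0 e x -> ball x0 eT x by apply: le_ball; rewrite ge_min lexx orbT.
have oB : open (ball x0 e) by exact: ball_open.
have BU : ball x0 e `<=` U by move=> x /eS' /eSU.
pose F (x : 'rV[R]_2) : 'rV[R]_2 := \row_i [:: S x; T x]`_i.
have FS x : F x 0 0 = S x by rewrite mxE.
have FT x : F x 0 1 = T x by rewrite mxE.
have sS : smooth_on (ball x0 e) S.
  apply: (smooth_of_derive (DF := th1)) => //.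
  - by move=> x /eS' /dS.
  - by move=> v x /eS' /DS.
  - by move=> v; exact: smooth_onS BU (smooth_th1 v).
have sT : smooth_on (ball x0 e) T.
  apply: (smooth_of_derive (DF := th2)) => //.
  - by move=> x /eT' /dT.
  - by move=> v x /eT' /DT.
  - by move=> v; exact: smooth_onS BU (smooth_th2 v).
have sF : smooth_on (ball x0 e) F.
  move=> k; apply: Ck_on_mx => // i j.
  have -> : (fun x => F x i j) = [:: S; T]`_j :> (_ -> R^o).
    by apply/funext => x; rewrite mxE; case: j => -[|[|//]] ?.
  by case: j => -[|[|//]] ? /=; [exact: sS|exact: sT].
have dF x : ball x0 e x -> differentiable F x by exact: Ck_on_differentiable (sF 1%N).
have DF0 x u : ball x0 e x -> 'D_u F x 0 0 = th1 u x.
  move=> xe; rewrite -(DS _ u (eS' _ xe)); apply: etrans (esym (derivable_mx_coord _ _ _ (dF _ xe))) _.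
  by congr ('D_u _ x); apply/funext => y; rewrite FS.
have DF1 x u : ball x0 e x -> 'D_u F x 0 1 = th2 u x.
  move=> xe; rewrite -(DT _ u (eT' _ xe)); apply: etrans (esym (derivable_mx_coord _ _ _ (dF _ xe))) _.
  by congr ('D_u _ x); apply/funext => y; rewrite FT.
(* [w1] and [w2] form the basis dual to the differentials of [S] and [T]. So the differential of [F]
   is injective, and the derivative of its inverse is expressed by [w1] and [w2], as the bootstrap
   requires. *)
have spanF x u : ball x0 e x -> u = 'D_u F x 0 0 *: w1 x + 'D_u F x 0 1 *: w2 x.
  by move=> xe; rewrite DF0 // DF1 //; exact (cf_span cf u (BU _ xe)).
have x0e : ball x0 e x0 by exact: ballxx.
have injDF x v : ball x0 e x -> 'D_v F x = 0 -> v = 0.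
  by move=> xe D0; rewrite (spanF x v xe) D0 !mxE !scale0r addr0.
have [e' [r [h [e'0 r0 e'e injF hP]]]] := inverse_function oB x0e (sF 1%N) injDF.
exists e', r, F, h.
have oB' : open (ball (F x0) r) by exact: ball_open.
have DFh y v : ball (F x0) r y -> 'D_('D_v h y) F (h y) = v.
  move=> yr; have [he Fh dh] := hP y yr; have he' := e'e _ he.
  apply: etrans (esym (derive_comp v dh (dF _ he'))) _.
  apply: etrans _ (derive_id y v).
  by apply: near_eq_derive; apply: (near_open oB' yr) => z zr /=; have [] := hP z zr.
have Dh y v : ball (F x0) r y -> 'D_v h y = v 0 0 *: w1 (h y) + v 0 1 *: w2 (h y).
  move=> yr; have [he Fh dh] := hP y yr; have he' := e'e _ he.
  have Ev := DFh y v yr.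
  apply: etrans (spanF _ _ he') _.
  congr (_ *: _ + _ *: _).
    exact: (congr1 (fun w : 'rV[R]_2 => w 0 0) Ev).
  exact: (congr1 (fun w : 'rV[R]_2 => w 0 1) Ev).
have sh : smooth_on (ball (F x0) r) h.
  move=> k; apply: Ck_onW.
  apply: (@Ck_on_inverse R 2 k _ U (fun i => [:: w1; w2]`_i)) => //.
  - by move=> y /hP[/e'e /BU].
  - by move=> y /hP[].
  - by case=> -[|[|//]] ? /=; [exact: (cf_w1 cf)|exact: (cf_w2 cf)].
  - move=> y v yr; rewrite Dh // big_ord_recl big_ord1 /=.
    by congr (_ *: _ + _ *: _); congr (v 0 _); apply/val_inj.
split; first by split => //; [move=> x /e'e /BU|exact: smooth_onS e'e sF].
split => //.
- by move=> y /hP[].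
- move=> y v yr; have he' : ball x0 e (h y) by apply: e'e; have [] := hP y yr.
  split.
    apply: etrans (esym (DF0 _ ('D_v h y) he')) _.
    exact: (congr1 (fun w : 'rV[R]_2 => w 0 0) (DFh y v yr)).
  apply: etrans (esym (DF1 _ ('D_v h y) he')) _.
  exact: (congr1 (fun w : 'rV[R]_2 => w 0 1) (DFh y v yr)).
- by rewrite FT.
- by move=> x /e'e xe; rewrite FT; exact: rot (eT' _ xe).
Qed.

End Flattening.

(** * Curves in a totally geodesic hypersurface *)

Section OneVariable.
Context {R : realType}.

Lemma is_derive_scale1 m n (g : R^o -> R^o) (V : R^o -> 'M[R]_(m, n)) (u : R^o) (g' : R) V' :
  is_derive u 1 g g' -> is_derive u 1 V V' ->
  is_derive u 1 (fun u => g u *: V u) (g' *: V u + g u *: V').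
Proof.
move=> [g1 g2] [V1 V2].
have dg : differentiable g u by exact/derivable1_diffP.
have dV : differentiable V u by exact/derivable1_diffP.
have [d D] := differentiable_scale dg dV.
by apply: DeriveDef; [exact: diff_derivable|rewrite D g2 V2].
Qed.

Lemma is_derive_comp1 (g phi : R^o -> R^o) (u : R^o) (g' phi' : R) :
  is_derive u 1 phi phi' -> is_derive (phi u) 1 g g' ->
  is_derive u 1 (fun u => g (phi u) : R^o) (g' * phi').
Proof.
move=> [p1 p2] Hg; have dp : differentiable phi u by exact/derivable1_diffP.
have [d D] := differentiable_comp1 dp Hg.
by apply: DeriveDef; [exact: diff_derivable|rewrite D p2].
Qed.

(** These functions of f are the coefficients of the Frenet normal on [N3] and [N4], see
    [normal_eq]. *)
Lemma derive_normal_coef (c t : R) : 0 < t ->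
  let Q := Num.sqrt (1 + c ^+ 2 * t) in
  is_derive (t : R^o) 1 (fun t : R^o => - (Num.sqrt (1 + c ^+ 2 * t))^-1 : R^o) (c ^+ 2 / (2 * Q ^+ 3)) /\
  is_derive (t : R^o) 1 (fun t : R^o => c * Num.sqrt t / Num.sqrt (1 + c ^+ 2 * t) : R^o)
    (c / (2 * Num.sqrt t * Q ^+ 3)).
Proof.
move=> t0 Q.
have q0 : 0 < 1 + c ^+ 2 * t by rewrite ltr_wpDr // mulr_ge0 ?sqr_ge0 // ltW.
have Q0 : 0 < Q by rewrite sqrtr_gt0.
have st0 : 0 < Num.sqrt t by rewrite sqrtr_gt0.
have H0 : is_derive (t : R^o) 1 (fun t : R^o => 1 + c ^+ 2 * t : R^o) (c ^+ 2).
  by apply: is_derive_eq; rewrite /GRing.scale /=; ring.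
have HQ := is_derive_comp1 H0 (is_derive1_sqrt q0).
have HQV : is_derive (t : R^o) 1 (fun t : R^o => (Num.sqrt (1 + c ^+ 2 * t))^-1 : R^o)
    (- (Q ^- 2 * ((2 * Q)^-1 * c ^+ 2))).
  have [d1 D1] := HQ.
  apply: DeriveDef; first by apply: derivableV => //; rewrite gt_eqF.
  by rewrite deriveV // ?gt_eqF // D1 /GRing.scale /= mulNr.
have Hs := is_derive1_sqrt t0.
split.
  by apply: is_derive_eq; field; rewrite gt_eqF.
apply: is_derive_eq; rewrite /GRing.scale /=.
have Q2 : Q ^+ 2 = 1 + c ^+ 2 * Num.sqrt t ^+ 2 by rewrite !sqr_sqrtr // ltW.
have -> : (c / (2 * Num.sqrt t * Q ^+ 3)) = c * (Q ^+ 2 - c ^+ 2 * Num.sqrt t ^+ 2) / (2 * Num.sqrt t * Q ^+ 3).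
  by rewrite Q2 addrK mulr1.
by rewrite -/Q; field; rewrite !gt_eqF.
Qed.

End OneVariable.

(** * Frenet data of an integral curve of E1 *)

Section Frenet.
Context {R : realType}.

Variables (I : set R^o) (b : 'rV[R]_5) (s T N3 N4 : R -> 'rV[R]_5) (phi : R -> R) (c C : R).
Hypothesis oI : open I.
Hypothesis fr : forall u, I u -> lor_frame (T u) b (N3 u) (N4 u) (s u).
Hypothesis phi0 : forall u, I u -> 0 < phi u.
Hypothesis rad0 : forall u, I u -> 0 < radicand c C (phi u).
Let mu u := c * phi u `^ (3 / 2).
Hypothesis Ds : forall u : R^o, I u -> is_derive u 1 (s : R^o -> 'rV[R]_5) (T u).
Hypothesis DT : forall u : R^o, I u -> is_derive u 1 (T : R^o -> 'rV[R]_5)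
  (- phi u *: N3 u + mu u *: N4 u + s u).
Hypothesis DN3 : forall u : R^o, I u -> is_derive u 1 (N3 : R^o -> 'rV[R]_5) (phi u *: T u).
Hypothesis DN4 : forall u : R^o, I u -> is_derive u 1 (N4 : R^o -> 'rV[R]_5) (- mu u *: T u).
Hypothesis Dphi : forall u : R^o, I u -> is_derive u 1 (phi : R^o -> R^o)
  (4 / 3 * phi u * Num.sqrt (radicand c C (phi u))).

(** Only the values of [V] near [u] matter, so a closed form [V1] valid on [I] suffices. A
    derivative orthogonal to [b] needs no projection onto the hypersurface, only the removal of its
    part along the position vector. *)
Lemma covD_near (V V1 : R -> 'rV[R]_5) (u : R^o) (V' : 'rV[R]_5) : I u ->
  (forall y, I y -> V y = V1 y) -> is_derive u 1 (V1 : R^o -> 'rV[R]_5) V' ->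
  lor V' b = 0 -> covD b s V u = V' + lor V' (s u) *: s u.
Proof.
move=> Iu VV1 [d1 d2] V'b.
have E : derive1 V u = V'.
  rewrite derive1E -d2; apply: near_eq_derive.
  exact: (near_open oI Iu VV1).
rewrite /covD E /tanH lorDl lorZl V'b.
have [_ [_ [_ h2x _ _ _]]] := fr Iu.
by rewrite (lorC (s u)) h2x mulr0 addr0 scale0r subr0.
Qed.

Lemma derive1_curve u : I u -> derive1 s u = T u.
Proof. by move=> Iu; rewrite derive1E; have [_ ->] := Ds Iu. Qed.

Let q u := Num.sqrt (1 + c ^+ 2 * phi u).

Let q_gt0 u : I u -> 0 < 1 + c ^+ 2 * phi u.
Proof. by move=> Iu; rewrite ltr_wpDr // mulr_ge0 ?sqr_ge0 // ltW // phi0. Qed.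

Let mu_sq u : I u -> mu u ^+ 2 = c ^+ 2 * phi u ^+ 3.
Proof.
move=> Iu; have f0 := ltW (phi0 Iu).
by rewrite /mu powR32 // !exprMn sqr_sqrtr //; ring.
Qed.

Lemma covD_tangent u : I u -> covD b s (derive1 s) u = - phi u *: N3 u + mu u *: N4 u.
Proof.
move=> Iu; have [[h11 h22 h33 h44 hxx] [[h12 h13 h14 h1x h23] [h24 h2x h34 h3x h4x]]] := fr Iu.
rewrite (covD_near Iu derive1_curve (DT Iu)) !lorDl !lorZl.
  by rewrite h3x h4x hxx !mulr0 !add0r scaleN1r addrK.
by rewrite (lorC (N3 u)) (lorC (N4 u)) (lorC (s u)) h23 h24 h2x; ring.
Qed.

Lemma curvature_eq u : I u -> frenet_curvature b s u = phi u * q u.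
Proof.
move=> Iu; have [[h11 h22 h33 h44 hxx] [[h12 h13 h14 h1x h23] [h24 h2x h34 h3x h4x]]] := fr Iu.
rewrite /frenet_curvature covD_tangent // !(lorDl, lorDr, lorZl, lorZr) h33 h44 (lorC (N4 u)) h34.
rewrite [X in Num.sqrt X](_ : _ = phi u ^+ 2 * (1 + c ^+ 2 * phi u)); last first.
  by have := mu_sq Iu; rewrite !expr2; lra.
by rewrite sqrtrM ?sqr_ge0 // sqrtr_sqr gtr0_norm // phi0.
Qed.

Lemma normal_eq u : I u -> frenet_normal b s u =
  - (Num.sqrt (1 + c ^+ 2 * phi u))^-1 *: N3 u
  + (c * Num.sqrt (phi u) / Num.sqrt (1 + c ^+ 2 * phi u)) *: N4 u.
Proof.
move=> Iu; have f0 := phi0 Iu; have Q0 : 0 < q u by rewrite sqrtr_gt0 q_gt0.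
rewrite /frenet_normal curvature_eq // covD_tangent // scalerDr !scalerA /mu powR32 ?(ltW f0) // -/(q u).
by congr (_ *: _ + _ *: _); field; rewrite !gt_eqF.
Qed.

Lemma torsion_eq u : I u -> frenet_torsion b s u =
  2 * `|c| * Num.sqrt (phi u) / (3 * (1 + c ^+ 2 * phi u)) * Num.sqrt (radicand c C (phi u)).
Proof.
move=> Iu; have f0 := phi0 Iu; have Q0 : 0 < q u by rewrite sqrtr_gt0 q_gt0.
have st0 : 0 < Num.sqrt (phi u) by rewrite sqrtr_gt0.
have p0 : 0 < Num.sqrt (radicand c C (phi u)) by rewrite sqrtr_gt0 rad0.
have [[h11 h22 h33 h44 hxx] [[h12 h13 h14 h1x h23] [h24 h2x h34 h3x h4x]]] := fr Iu.
have [Ha Hb] := derive_normal_coef c f0.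
have HN := is_deriveD (is_derive_scale1 (is_derive_comp1 (Dphi Iu) Ha) (DN3 Iu))
  (is_derive_scale1 (is_derive_comp1 (Dphi Iu) Hb) (DN4 Iu)).
rewrite /frenet_torsion curvature_eq // derive1_curve //.
set p := Num.sqrt (radicand c C (phi u)) in p0 HN *.
set st := Num.sqrt (phi u) in st0 HN *.
have Q2 : q u ^+ 2 = 1 + c ^+ 2 * phi u by rewrite sqr_sqrtr // ltW // q_gt0.
have S2 : st ^+ 2 = phi u by rewrite sqr_sqrtr // ltW.
rewrite (covD_near Iu normal_eq HN); last first.
  rewrite !(lorDl, lorZl) (lorC (N3 u)) (lorC (N4 u)) h23 h24 h12; ring.
rewrite !(lorDl _ _ (s u)) !(lorZl _ _ (s u)) h3x h4x h1x !mulr0 !addr0 scale0r addr0.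
rewrite -/(q u) /mu powR32 ?(ltW f0) // -/st.
set al := c ^+ 2 / (2 * q u ^+ 3) * (4 / 3 * phi u * p).
set be := c / (2 * st * q u ^+ 3) * (4 / 3 * phi u * p).
(* The tangential part of N' is - kappa T and cancels; the rest is the torsion times the binormal,
   up to sign. *)
rewrite [X in lor X X](_ : _ = al *: N3 u + be *: N4 u); last first.
  have -> : phi u * q u *: T u = - (- (q u)^-1 * phi u + c * st / q u * - (c * (phi u * st))) *: T u.
    congr (_ *: _); rewrite [in LHS](_ : q u = q u ^+ 2 / q u); last by field; rewrite gt_eqF.
    by rewrite Q2 -S2; field; rewrite gt_eqF.
  by apply/rowP => i; rewrite !mxE; ring.
rewrite !(lorDl, lorDr, lorZl, lorZr) h33 h44 (lorC (N4 u)) h34.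
rewrite [X in Num.sqrt X](_ : _ = (2 * c * st / (3 * (1 + c ^+ 2 * phi u)) * p) ^+ 2); last first.
  apply: (@etrans _ _ (4 / 9 * p ^+ 2 * st ^+ 2 * c ^+ 2 * (1 + c ^+ 2 * st ^+ 2) / q u ^+ 6)).
    by rewrite /al /be -S2; field; rewrite !gt_eqF.
  have -> : 1 + c ^+ 2 * st ^+ 2 = q u ^+ 2 by rewrite S2 Q2.
  by rewrite -Q2; field; rewrite gt_eqF.
rewrite sqrtr_sqr !normrM normfV !normrM (gtr0_norm st0) (gtr0_norm p0) (gtr0_norm (q_gt0 Iu)) !normr_nat //.
Qed.

End Frenet.

(** * The local parametrization *)

Section LocalForm.
Context {R : realType}.
Implicit Types V W : normedModType R.

Definition row2 (u t : R) : 'rV[R]_2 := \row_i [:: u; t]`_i.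

Lemma row2_0 u t : row2 u t 0 0 = u. Proof. by rewrite mxE. Qed.
Lemma row2_1 u t : row2 u t 0 1 = t. Proof. by rewrite mxE. Qed.

Lemma row2E (y : 'rV[R]_2) : y = row2 (y 0 0) (y 0 1).
Proof.
apply/rowP => -[[|[|//]] ?]; rewrite mxE /=; congr (y _ _); exact/val_inj.
Qed.

(** The norm is the maximum norm, so balls are squares; this makes the domain of the final chart a
    product of intervals. *)
Lemma ball_row2 (x y : 'rV[R]_2) (r : R) :
  ball x r y <-> `|x 0 0 - y 0 0| < r /\ `|x 0 1 - y 0 1| < r.
Proof.
rewrite -ball_normE /=; split=> [xy|[h0 h1]].
  by split; apply: le_lt_trans xy; [have := normr_coord (x - y) 0 0|have := normr_coord (x - y) 0 1]; rewrite !mxE.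
have [M [Mr M0 M1]] : exists M, [/\ M < r, `|x 0 0 - y 0 0| <= M & `|x 0 1 - y 0 1| <= M].
  by exists (Num.max `|x 0 0 - y 0 0| `|x 0 1 - y 0 1|); rewrite gt_max h0 h1 !le_max !lexx orbT.
apply: le_lt_trans Mr; apply: normr_mx_le; first exact: le_trans M0.
by move=> i j; rewrite ord1 !mxE; case: (unliftP ord0 j) => [k|] ->;
  rewrite ?ord1 // (_ : lift ord0 ord0 = 1) //; exact/val_inj.
Qed.

(** Only the derivative along the segment is supposed to vanish, as for a function of [u] alone on a
    segment of constant [u]. *)
Lemma constant_on_segment V m n (F : V -> 'M[R]_(m, n)) (x0 x y : V) (e : R) :
  (forall z, ball x0 e z -> differentiable F z) ->
  (forall z, ball x0 e z -> 'D_(x - y) F z = 0) ->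
  ball x0 e x -> ball x0 e y -> F x = F y.
Proof.
move=> dF DF xe ye; apply/matrixP => i j.
have [|r rs|r [r1]] := @MVT_line R V (fun z => F z i j : R^o) y (x - y) 1 => //.
  by apply: differentiable_mx_coord; apply: dF; exact: ball_segment.
have zr := ball_segment xe ye r1.
rewrite derivable_mx_coord; last exact: dF.
by rewrite DF // mxE mulr0 scale1r (addrC y) subrK => /eqP; rewrite subr_eq0 => /eqP.
Qed.

Lemma Ck_on_id V k (U : set V) : open U -> Ck_on k U (id : V -> V).
Proof.
move=> oU; case: k => [|k]; first by move=> x _; exact: cvg_id.
apply: (Ck_onSE (Df := fun v _ => v) oU) => [x _|v x _|v]; first exact: ex_diff.
  exact: derive_id.
exact: Ck_on_cst.
Qed.

Lemma smooth_row2 (I : set R^o) (t : R) : open I -> smooth_on I (fun u : R^o => row2 u t).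
Proof.
move=> oI k; apply: Ck_on_mx => // i j.
have -> : (fun u : R^o => row2 u t i j) = [:: id; cst (t : R^o)]`_j :> (R^o -> R^o).
  by apply/funext => u; rewrite mxE; case: j => -[|[|//]] ?.
by case: j => -[|[|//]] ? /=; [exact: Ck_on_id|exact: Ck_on_cst].
Qed.

Lemma is_derive_row2 (u t : R^o) : is_derive u 1 (fun u : R^o => row2 u t) (row2 1 0).
Proof.
have du : differentiable (fun u : R^o => row2 u t) u.
  exact: Ck_on_differentiable (smooth_row2 t openT 1%N) I.
apply: DeriveDef; first exact: diff_derivable.
apply/rowP => j; rewrite -derivable_mx_coord //.
have -> : (fun u : R^o => row2 u t 0 j) = [:: id; cst (t : R^o)]`_j :> (R^o -> R^o).
  by apply/funext => v; rewrite mxE; case: j => -[|[|//]] ?.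
by rewrite mxE; case: j => -[|[|//]] ? /=; [exact: derive_id|exact: derive_cst].
Qed.

Variables (U : set 'rV[R]_2) (X e1 e2 e3 e4 n : 'rV[R]_2 -> 'rV[R]_5).
Variables (w1 w2 : 'rV[R]_2 -> 'rV[R]_2) (f : 'rV[R]_2 -> R^o) (c C : R).
Hypothesis cf : canonical_frame U X e1 e2 e3 e4 n w1 w2 f c C.
Hypothesis C_gt0 : 0 < C.
Variables (x0 y0 : 'rV[R]_2) (r : R) (h : 'rV[R]_2 -> 'rV[R]_2).
Hypothesis y01 : y0 0 1 = 0.
Hypothesis r_gt0 : 0 < r.
Hypothesis Ux0 : U x0.
Hypothesis hU : forall y, ball y0 r y -> U (h y).
Hypothesis sh : smooth_on (ball y0 r) h.
Hypothesis Dh : forall y v, ball y0 r y -> lor ('D_('D_v h y) X (h y)) (e1 (h y)) = v 0 0 /\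
  kappahat C (f (h y)) * lor ('D_('D_v h y) X (h y)) (e2 (h y)) = v 0 1.
Hypothesis rot : forall y, ball y0 r y ->
  e2 (h y) = cos (y 0 1) *: e2 x0 + sin (y 0 1) *: n x0 /\
  n (h y) = cos (y 0 1) *: n x0 - sin (y 0 1) *: e2 x0.

Let I : set R^o := [set u | `|y0 0 0 - u| < r].
Let base u := h (row2 u 0).
Let oB : open (ball y0 r).
Proof. exact: ball_open. Qed.
Let kh x := kappahat C (f x).

Let diffU W (G : 'rV[R]_2 -> W) x : smooth_on U G -> U x -> differentiable G x.
Proof. by move=> sG; exact: Ck_on_differentiable (sG 1%N). Qed.

Let dh y : ball y0 r y -> differentiable h y.
Proof. exact: Ck_on_differentiable (sh 1%N). Qed.

Let kh0 x : U x -> 0 < kh x.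
Proof. by move=> Ux; exact: (kappahat_f_gt0 cf C_gt0). Qed.

Let oI : open I.
Proof.
have -> : I = ball (y0 0 0 : R^o) r by apply/funext => u; rewrite -ball_normE.
exact: ball_open.
Qed.

Lemma base_ball u : I u -> ball y0 r (row2 u 0).
Proof. by move=> Iu; apply/ball_row2; rewrite row2_0 row2_1 y01 subrr normr0. Qed.

Lemma derive_comp_chart W (G : 'rV[R]_2 -> W) y (v : 'rV[R]_2) : smooth_on U G -> ball y0 r y ->
  differentiable (G \o h) y /\ 'D_v (G \o h) y = 'D_('D_v h y) G (h y).
Proof.
move=> sG yr; have dG := diffU sG (hU yr).
by split; [exact: differentiable_comp (dh yr) dG|exact: derive_comp v (dh yr) dG].
Qed.

(** [X + n / kh] is the centre of the circle described by an integral curve of E2. When [v] has no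
    first component, f is stationary, and the derivatives of [X] and of [n / kh] are opposite
    multiples of [e2]. *)
Lemma vertical y (v : 'rV[R]_2) : ball y0 r y -> v 0 0 = 0 -> 'D_v (f \o h) y = 0 /\
  'D_v (fun y => X (h y) + (kh (h y))^-1 *: n (h y)) y = 0 /\
  differentiable (fun y => X (h y) + (kh (h y))^-1 *: n (h y)) y.
Proof.
move=> yr v0; have [d1 d2] := Dh v yr; rewrite v0 in d1.
have Uh := hU yr; have f0 := cf_f_gt0 cf Uh; have k0 := kh0 Uh.
have [df Df] := derive_comp_chart v (cf_f cf) yr.
have [dX DX] := derive_comp_chart v (cf_X cf) yr.
have [dn Dn] := derive_comp_chart v (cf_n cf) yr.
have Df0 : 'D_v (f \o h) y = 0 by apply: etrans Df _; rewrite (cf_Df cf _ Uh) d1 mulr0.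
have [dk Dk] := differentiable_comp1 df (derive_kappahatV C_gt0 f0).
have [dkn Dkn] := differentiable_scale dk dn.
split; first exact: Df0.
split; last exact: differentiableD.
rewrite deriveD; [|exact: diff_derivable..].
rewrite Dkn Dk Df0 mulr0 scale0r add0r DX Dn (cf_DX cf _ Uh) (cf_Dn cf _ Uh) d1 scale0r add0r scalerA.
rewrite -/(kh (h y)) -scalerDl (_ : _ + _ = 0) ?scale0r //.
by field; rewrite gt_eqF.
Qed.

Lemma f_vertical y : ball y0 r y -> f (h y) = f (base (y 0 0)).
Proof.
move=> yr; have [I0 _] := (ball_row2 _ _ _).1 yr; have br := base_ball I0.
have [|s s1] := @MVT_line R _ (f \o h) (row2 (y 0 0) 0) (y - row2 (y 0 0) 0) 1 ler01.
  by move=> s s1; have [] := derive_comp_chart 0 (cf_f cf) (ball_segment yr br s1).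
have zr := ball_segment yr br s1.1.
have v0 : (y - row2 (y 0 0) 0) 0 0 = 0 by rewrite !mxE subrr.
case: s1 => _ E; have [D0 _] := vertical zr v0.
move: E; rewrite D0 mulr0 scale1r (addrC (row2 _ _)) subrK => /eqP; rewrite subr_eq0 => /eqP; exact.
Qed.

(** The points with second coordinates t and 0 share centre and radius, so they differ by the
    difference of their normals [n], which [rot] expresses through [e2 x0] and [n x0]; [- n x0]
    plays the part of b2. *)
Lemma parametrization y : ball y0 r y -> X (h y) = X (base (y 0 0)) +
  (kh (base (y 0 0)))^-1 *: (sin (y 0 1) *: e2 x0 + (cos (y 0 1) - 1) *: (- n x0)).
Proof.
move=> yr; have [I0 _] := (ball_row2 _ _ _).1 yr; have br := base_ball I0.
have v0 : (y - row2 (y 0 0) 0) 0 0 = 0 by rewrite !mxE subrr.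
pose Y y := X (h y) + (kh (h y))^-1 *: n (h y).
have E : Y y = Y (row2 (y 0 0) 0).
  apply: (constant_on_segment _ _ yr br) => z zr; by have [_ []] := vertical zr v0.
move: E; rewrite /Y -/(base _) {1}/kh (f_vertical yr) -/(kh _).
rewrite (rot yr).2 (rot br).2 row2_1 cos0 sin0 => /(canRL (addrK _)) ->.
by apply/rowP => i; rewrite !mxE; ring.
Qed.

Lemma is_derive_base W (G : 'rV[R]_2 -> W) (u : R^o) : smooth_on U G -> I u ->
  is_derive u 1 (fun u : R^o => G (base u)) ('D_('D_(row2 1 0) h (row2 u 0)) G (base u)).
Proof.
move=> sG Iu; have br := base_ball Iu.
have [d1 D1] := derive_comp_chart (row2 1 0) sG br.
have [r1 r2] := is_derive_row2 u 0.
have dr : differentiable (fun u : R^o => row2 u 0) u by exact/derivable1_diffP.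
apply: DeriveDef; first by apply: diff_derivable; exact: (differentiable_comp dr d1).
apply: etrans (derive_comp _ dr d1) _; rewrite r2; exact: D1.
Qed.

Lemma base_components u : I u ->
  lor ('D_('D_(row2 1 0) h (row2 u 0)) X (base u)) (e1 (base u)) = 1 /\
  lor ('D_('D_(row2 1 0) h (row2 u 0)) X (base u)) (e2 (base u)) = 0.
Proof.
move=> Iu; have br := base_ball Iu; have [-> D2] := Dh (row2 1 0) br.
rewrite row2_0; split=> //; move/eqP: D2; rewrite row2_1 mulf_eq0 gt_eqF ?kh0 //=.
  by move/eqP.
exact: hU.
Qed.

Lemma e2_base u : I u -> e2 (base u) = e2 x0.
Proof. by move=> /base_ball /rot[-> _]; rewrite row2_1 cos0 sin0 scale1r scale0r addr0. Qed.

Lemma n_base u : I u -> n (base u) = n x0.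
Proof. by move=> /base_ball /rot[_ ->]; rewrite row2_1 cos0 sin0 scale1r scale0r subr0. Qed.

Lemma base_curve u : I u -> (forall x, U x -> H4 R (X x)) ->
  let sigma u := X (base u) in let phi u := f (base u) in
  [/\ H3 (e2 x0) (sigma u), lor (derive1 sigma u) (derive1 sigma u) = 1,
    frenet_curvature (e2 x0) sigma u = phi u * Num.sqrt (1 + c ^+ 2 * phi u),
    frenet_torsion (e2 x0) sigma u = 2 * `|c| * Num.sqrt (phi u) / (3 * (1 + c ^+ 2 * phi u))
      * Num.sqrt (radicand c C (phi u)) & lor (sigma u) (- n x0) = (kappahat C (phi u))^-1] /\
  is_derive (u : R^o) 1 (phi : R^o -> R^o) (4 / 3 * phi u * Num.sqrt (radicand c C (phi u))).
Proof.
move=> Iu XH sigma phi.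
have UI v : I v -> U (base v) by move=> /base_ball /hU.
have frI v : I v -> lor_frame (e1 (base v)) (e2 x0) (e3 (base v)) (e4 (base v)) (X (base v)).
  by move=> Iv; rewrite -(e2_base Iv); exact (cf_frame cf (UI _ Iv)).
have phi0 v : I v -> 0 < phi v by move=> /UI; exact: (cf_f_gt0 cf).
have rad0 v : I v -> 0 < radicand c C (phi v) by move=> /UI; exact: (cf_rad_gt0 cf).
have Ds (v : R^o) : I v -> is_derive v 1 (sigma : R^o -> 'rV[R]_5) (e1 (base v)).
  move=> Iv; have [c1 c2] := base_components Iv.
  apply: is_derive_eq (is_derive_base (cf_X cf) Iv) _.
  by rewrite (cf_DX cf _ (UI _ Iv)) c1 c2 scale1r scale0r addr0.
have DT (v : R^o) : I v -> is_derive v 1 (fun v : R^o => e1 (base v))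
    (- phi v *: e3 (base v) + (c * phi v `^ (3 / 2)) *: e4 (base v) + sigma v).
  move=> Iv; have [c1 c2] := base_components Iv.
  apply: is_derive_eq (is_derive_base (cf_e1 cf) Iv) _.
  by rewrite (cf_De1 cf _ (UI _ Iv)) c1 c2 scale1r mulr0 scale0r subr0.
have D3 (v : R^o) : I v -> is_derive v 1 (fun v : R^o => e3 (base v)) (phi v *: e1 (base v)).
  move=> Iv; have [c1 c2] := base_components Iv.
  apply: is_derive_eq (is_derive_base (cf_e3 cf) Iv) _.
  by rewrite (cf_De3 cf _ (UI _ Iv)) c1 c2 mulr1 mulr0 scale0r subr0.
have D4 (v : R^o) : I v -> is_derive v 1 (fun v : R^o => e4 (base v))
    (- (c * phi v `^ (3 / 2)) *: e1 (base v)).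
  move=> Iv; have [c1 c2] := base_components Iv.
  apply: is_derive_eq (is_derive_base (cf_e4 cf) Iv) _.
  by rewrite (cf_De4 cf _ (UI _ Iv)) c1 c2 mulr1 mulr0 scale0r addr0.
have Dphi (v : R^o) : I v -> is_derive v 1 (phi : R^o -> R^o)
    (4 / 3 * phi v * Num.sqrt (radicand c C (phi v))).
  move=> Iv; have [c1 c2] := base_components Iv.
  apply: is_derive_eq (is_derive_base (cf_f cf) Iv) _.
  by rewrite (cf_Df cf _ (UI _ Iv)) c1 mulr1.
split; last exact: Dphi.
have [[h11 _ _ _ _] [_ [_ h2x _ _ _]]] := frI u Iu.
split.
- by split; [exact: XH (UI _ Iu)|rewrite /= lorC].
- by rewrite (derive1_curve Ds Iu).
- exact: (curvature_eq oI frI phi0 Ds DT Iu).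
- exact: (torsion_eq oI frI phi0 rad0 Ds DT D3 D4 Dphi Iu).
- by rewrite -(n_base Iu) lorNr; have [_ _ ->] := cf_n_frame cf (UI _ Iu); rewrite opprK.
Qed.

End LocalForm.

(** * Immersed charts and their mean curvature *)

Section Metric2.
Context {R : realType}.
Implicit Types (G : 'M[R]_2).

Lemma ord2E (j : 'I_2) : j = 0 \/ j = 1.
Proof. by case: j => -[|[|//]] ?; [left|right]; exact/val_inj. Qed.

Lemma sum2 (V : nmodType) (F : 'I_2 -> V) : \sum_i F i = F 0 + F 1.
Proof. by rewrite big_ord_recl big_ord1; congr (_ + F _); exact/val_inj. Qed.

Lemma inner2 (G : 'rV[R]_2 -> 'M[R]_2) x v w : inner G x v w =
  v 0 0 * G x 0 0 * w 0 0 + v 0 1 * G x 1 0 * w 0 0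
  + v 0 0 * G x 0 1 * w 0 1 + v 0 1 * G x 1 1 * w 0 1.
Proof. by rewrite /inner mxE sum2 !mxE !sum2; ring. Qed.

Lemma det2 G : \det G = G 0 0 * G 1 1 - G 0 1 * G 1 0.
Proof.
rewrite (expand_det_row _ 0) sum2 /cofactor !det_mx11 !mxE /=.
have -> : lift 0 0 = 1 :> 'I_2 by exact/val_inj.
have -> : lift 1 0 = 0 :> 'I_2 by exact/val_inj.
by rewrite expr0 expr1; ring.
Qed.

Lemma invmx_unique n (A B : 'M[R]_n) : A *m B = 1%:M -> invmx A = B.
Proof. by move=> AB; have [uA _] := mulmx1_unit AB; rewrite -(mulKmx uA B) AB mulmx1. Qed.

Lemma invmx2 G : \det G != 0 ->
  invmx G = (\det G)^-1 *: \matrix_(i, j) (if i == 0 then (if j == 0 then G 1 1 else - G 0 1)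
     else (if j == 0 then - G 1 0 else G 0 0)).
Proof.
move=> d0; apply: invmx_unique; apply/matrixP => i j; rewrite mxE sum2 !mxE /=.
have E : G 0 0 * G 1 1 - G 0 1 * G 1 0 != 0 by rewrite -det2.
by case: (ord2E i) => ->; case: (ord2E j) => -> /=; rewrite !det2 ?mulr1n ?mulr0n; field.
Qed.

Lemma smooth_invmx (U : set 'rV[R]_2) (G : 'rV[R]_2 -> 'M[R]_2) i j : open U ->
  (forall x, U x -> \det (G x) != 0) -> smooth_on U G ->
  smooth_on U (fun x => invmx (G x) i j : R^o).
Proof.
move=> oU d0 sG k.
have sc a b : Ck_on k U (fun x => G x a b : R^o) by exact: Ck_on_coord (sG k).
have sd : Ck_on k U (fun x => (\det (G x))^-1 : R^o).
  apply: Ck_onV => //; apply: (@Ck_on_eq _ _ _ _ _ (fun x => G x 0 0 * G x 1 1 + - (G x 0 1 * G x 1 0) : R^o)) => //.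
    by move=> x _; rewrite det2.
  by apply: Ck_onD => //; [exact: Ck_onM|apply: Ck_onN => //; exact: Ck_onM].
apply: (@Ck_on_eq _ _ _ _ _ (fun x => (\det (G x))^-1 * (if i == 0 then (if j == 0 then G x 1 1 else - G x 0 1)
     else (if j == 0 then - G x 1 0 else G x 0 0)) : R^o)) => //.
  by move=> x Ux; rewrite invmx2 ?d0 // !mxE.
apply: (Ck_onM oU sd); case: (i == 0); case: (j == 0);
  [exact: sc|exact: Ck_onN|exact: Ck_onN|exact: sc].
Qed.

(** Raising an index with the inverse metric: gradient, Christoffel symbols and shape operator all
    have this form. *)
Lemma inner_raise (G : 'rV[R]_2 -> 'M[R]_2) x (a : 'I_2 -> R) w : G x \in unitmx -> (G x)^T = G x ->
  inner G x (\row_i \sum_j invmx (G x) i j * a j) w = \sum_k a k * w 0 k.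
Proof.
move=> uG Gsym.
have E : \row_i \sum_j invmx (G x) i j * a j = (\row_j a j) *m invmx (G x).
  apply/rowP => i; rewrite !mxE; apply: eq_bigr => j _; rewrite mxE mulrC; congr (_ * _).
  by rewrite -{1}Gsym -trmx_inv mxE.
by rewrite /inner E mulmxKV // mxE; apply: eq_bigr => k _; rewrite !mxE.
Qed.

End Metric2.

Section ImmersedChart.
Context {R : realType}.

Record immersed_chart (U : set 'rV[R]_2) (X : 'rV[R]_2 -> 'rV[R]_5) (G : 'rV[R]_2 -> 'M[R]_2)
    : Prop := ImmersedChart {
  ic_open : open U;
  ic_X : smooth_on U X;
  ic_G : smooth_on U G;
  ic_H4 : forall x, U x -> H4 R (X x);
  ic_inj : forall x v, U x -> 'D_v X x = 0 -> v = 0;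
  ic_iso : forall x v w, U x -> lor ('D_v X x) ('D_w X x) = inner G x v w }.

Lemma inner_sum (G : 'rV[R]_2 -> 'M[R]_2) x v w : inner G x v w = \sum_k (v *m G x) 0 k * w 0 k.
Proof. by rewrite /inner mxE; apply: eq_bigr => k _; rewrite [X in _ * X]mxE. Qed.

Lemma sum_ebase (a : 'I_2 -> R) m : \sum_k a k * ebase R m 0 k = a m.
Proof.
rewrite (bigD1 m) //= big1 => [|k km]; last by rewrite mxE (negbTE km) mulr0.
by rewrite mxE !eqxx mulr1 addr0.
Qed.

Variables (U : set 'rV[R]_2) (X : 'rV[R]_2 -> 'rV[R]_5) (G : 'rV[R]_2 -> 'M[R]_2).
Hypothesis ic : immersed_chart U X G.
Let oU := ic_open ic.

Let sXk k : Ck_on k U X := ic_X ic k.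
Let spd i k : Ck_on k U (pd i X) := Ck_on_derive (ebase R i) (sXk k.+1).
Let dX x : U x -> differentiable X x := fun Ux => Ck_on_differentiable (sXk 1) Ux.
Let dpd i x : U x -> differentiable (pd i X) x := fun Ux => Ck_on_differentiable (spd i 1) Ux.

Lemma lorXX x : U x -> lor (X x) (X x) = -1.
Proof. by move=> /(ic_H4 ic)[]. Qed.

Lemma tangent_orth x v : U x -> lor ('D_v X x) (X x) = 0.
Proof.
move=> Ux; have := derive_lor_cst v oU Ux (dX Ux) (dX Ux) lorXX.
by rewrite (lorC (X x)); lra.
Qed.

Lemma inner_ebase x i j : inner G x (ebase R i) (ebase R j) = G x i j.
Proof. by rewrite /inner /ebase -rowE trmx_delta -colE !mxE. Qed.

Lemma GE x i j : U x -> G x i j = lor (pd i X x) (pd j X x).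
Proof. by move=> Ux; rewrite (ic_iso ic) // inner_ebase. Qed.

Lemma G_sym x : U x -> (G x)^T = G x.
Proof. by move=> Ux; apply/matrixP => i j; rewrite mxE; exact: etrans (GE _ _ Ux) (etrans (lorC _ _) (esym (GE _ _ Ux))). Qed.

(** A tangent vector is orthogonal to the timelike position vector, hence spacelike. *)
Lemma inner_gt0 x v : U x -> v != 0 -> 0 < inner G x v v.
Proof.
move=> Ux v0; rewrite -(ic_iso ic) //; apply: lor_gt0 (lorXX Ux) (tangent_orth v Ux) _.
by apply: contraNneq v0 => /(ic_inj ic Ux) ->.
Qed.

Lemma G_unit x : U x -> G x \in unitmx.
Proof.
move=> Ux; apply: unitmx_inj => v vG; apply/eqP; apply: contraT => v0.
by have := inner_gt0 Ux v0; rewrite /inner vG mul0mx mxE ltxx.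
Qed.

Lemma G00_gt0 x : U x -> 0 < G x 0 0.
Proof.
move=> Ux; rewrite -inner_ebase; apply: inner_gt0 => //.
by apply/eqP => /rowP /(_ 0) /eqP; rewrite !mxE /= oner_eq0.
Qed.

Lemma G01 x : U x -> G x 1 0 = G x 0 1.
Proof. by move=> Ux; rewrite -{1}(G_sym Ux) mxE. Qed.

Lemma detG_gt0 x : U x -> 0 < \det (G x).
Proof.
move=> Ux; have g0 := G00_gt0 Ux.
(* This vector is orthogonal to the first coordinate field, and its squared length is the first
   diagonal entry times the determinant. *)
have v0 : row2 (- G x 0 1) (G x 0 0) != 0.
  by apply: contraTneq g0 => /rowP /(_ 1); rewrite row2_1 mxE => ->; rewrite ltxx.
have := inner_gt0 Ux v0; rewrite inner2 row2_0 row2_1 (G01 Ux) det2 (G01 Ux).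
rewrite [X in 0 < X -> _](_ : _ = G x 0 0 * (G x 0 0 * G x 1 1 - G x 0 1 * G x 0 1)); last by ring.
by rewrite pmulr_rgt0.
Qed.

Lemma pd_sym x i j : U x -> pd i (pd j X) x = pd j (pd i X) x.
Proof. by move=> Ux; exact: derive_sym _ _ oU Ux (sXk 2). Qed.

Lemma pdG x i j k : U x -> pd i (fun y => G y j k : R^o) x =
  lor (pd i (pd j X) x) (pd k X x) + lor (pd j X x) (pd i (pd k X) x).
Proof.
move=> Ux; rewrite -(differentiable_lor (dpd j Ux) (dpd k Ux)).2.
by apply: near_eq_derive; apply: (near_open oU Ux) => y Uy; exact: GE.
Qed.

Lemma lor_derive_tangent x u w : U x -> lor ('D_u X x) w = \sum_i u 0 i * lor (pd i X x) w.
Proof.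
by move=> Ux; rewrite derive_rv ?lor_suml //; [apply: eq_bigr => i _; rewrite lorZl|exact: dX].
Qed.

(** The Koszul formula: the three first derivatives of [G] are the pairwise sums of [p], [q], [r],
    and half of (p + q) + (p + r) - (q + r) is [p], the tangential part of the second derivative of
    [X]. *)
Lemma sff_coord_tangent x i j m : U x -> lor (sff_coord X G x i j) (pd m X x) = 0.
Proof.
move=> Ux; rewrite /sff_coord /nablaX /tanH lorBl lorDl lorZl.
have -> : lor (X x) (pd m X x) = 0 by rewrite lorC; exact: tangent_orth.
rewrite mulr0 addr0 lor_derive_tangent // -/(pd i (pd j X) x).
pose a l := 2^-1 * (pd i (fun y => G y j l : R^o) x + pd j (fun y => G y i l : R^o) x
     - pd l (fun y => G y i j : R^o) x).
have -> : \sum_k christoffel G x i j 0 k * lor (pd k X x) (pd m X x) =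
    inner G x (\row_k \sum_l invmx (G x) k l * a l) (ebase R m).
  rewrite inner_sum sum_ebase [RHS]mxE; apply: eq_bigr => k _.
  rewrite -(GE k m Ux) !mxE; congr (_ * _); rewrite mulr_sumr; apply: eq_bigr => l _.
  by rewrite /a mulrCA.
rewrite inner_raise ?(G_unit Ux) ?(G_sym Ux) // sum_ebase /a.
pose p : R := lor (pd i (pd j X) x) (pd m X x).
pose q : R := lor (pd i (pd m X) x) (pd j X x).
pose r : R := lor (pd j (pd m X) x) (pd i X x).
have E1 : pd i (fun y => G y j m : R^o) x = (p + q : R).
  exact: (etrans (pdG i j m Ux) (congr2 (fun a b : R => a + b) (erefl p) (lorC (pd j X x) (pd i (pd m X) x)))).
have E2 : pd j (fun y => G y i m : R^o) x = (p + r : R).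
  exact: (etrans (pdG j i m Ux) (congr2 (fun a b : R => a + b)
    (congr1 (fun w => lor w (pd m X x)) (pd_sym j i Ux)) (lorC (pd i X x) (pd j (pd m X) x)))).
have E3 : pd m (fun y => G y i j : R^o) x = (q + r : R).
  exact: (etrans (pdG m i j Ux) (congr2 (fun a b : R => a + b)
    (congr1 (fun w => lor w (pd j X x)) (pd_sym m i Ux))
    (etrans (lorC (pd i X x) (pd m (pd j X) x)) (congr1 (fun w => lor w (pd i X x)) (pd_sym m j Ux))))).
rewrite -/p.
rewrite E1.
rewrite E2.
rewrite E3.
lra.
Qed.

Lemma sff_coord_position x i j : U x -> lor (sff_coord X G x i j) (X x) = 0.
Proof.
move=> Ux; rewrite /sff_coord /nablaX /tanH lorBl lorDl lorZl lorXX // tangent_orth //.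
by ring.
Qed.

(** Against a normal vector both corrections, the one along the position vector and the Christoffel
    term, vanish. *)
Lemma sff_coord_normal x i j xi : U x -> lor (X x) xi = 0 -> (forall k, lor (pd k X x) xi = 0) ->
  lor (sff_coord X G x i j) xi = lor (pd i (pd j X) x) xi.
Proof.
move=> Ux Xxi kxi; rewrite /sff_coord /nablaX /tanH lorBl lorDl lorZl Xxi mulr0 addr0.
rewrite lor_derive_tangent // big1 ?subr0 // => k _; by rewrite kxi mulr0.
Qed.

End ImmersedChart.

(** * Regularity of the mean curvature and of the tangent frame *)

Section MeanCurvature.
Context {R : realType}.
Variables (U : set 'rV[R]_2) (X : 'rV[R]_2 -> 'rV[R]_5) (G : 'rV[R]_2 -> 'M[R]_2).
Hypothesis ic : immersed_chart U X G.
Let oU := ic_open ic.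

Lemma lor_gtrace x (B : 'I_2 -> 'I_2 -> 'rV[R]_5) w :
  lor (gtrace G x B) w = \sum_i \sum_j invmx (G x) i j * lor (B i j) w.
Proof.
rewrite /gtrace lor_suml; apply: eq_bigr => i _; rewrite lor_suml; apply: eq_bigr => j _.
exact: lorZl.
Qed.

Lemma mean_curvature_orth x w : (forall i j, lor (sff_coord X G x i j) w = 0) ->
  lor (mean_curvature_field X G x) w = 0.
Proof.
move=> B0; rewrite /mean_curvature_field lorZl lor_gtrace big1 ?mulr0 // => i _.
by rewrite big1 // => j _; rewrite B0 mulr0.
Qed.

Lemma mean_curvature_tangent x m : U x -> lor (mean_curvature_field X G x) (pd m X x) = 0.
Proof. by move=> Ux; apply: mean_curvature_orth => i j; exact: (sff_coord_tangent ic). Qed.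

Lemma mean_curvature_position x : U x -> lor (mean_curvature_field X G x) (X x) = 0.
Proof. by move=> Ux; apply: mean_curvature_orth => i j; exact: (sff_coord_position ic). Qed.

Lemma mean_curvature_normal x xi : U x -> lor (X x) xi = 0 -> (forall k, lor (pd k X x) xi = 0) ->
  lor (mean_curvature_field X G x) xi =
  2^-1 * \sum_i \sum_j invmx (G x) i j * lor (pd i (pd j X) x) xi.
Proof.
move=> Ux Xxi kxi; rewrite /mean_curvature_field lorZl lor_gtrace; congr (_ * _).
apply: eq_bigr => i _; apply: eq_bigr => j _; congr (_ * _).
exact: (sff_coord_normal ic).
Qed.

Lemma smooth_invG i j : smooth_on U (fun x => invmx (G x) i j : R^o).
Proof.
apply: smooth_invmx (ic_G ic) => // x Ux.
by rewrite gt_eqF // (detG_gt0 ic).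
Qed.

Lemma smooth_christoffel i j : smooth_on U (fun x => christoffel G x i j).
Proof.
move=> k; apply: Ck_on_mx => // r m.
have sG a l n : Ck_on k U (pd a (fun y => G y l n : R^o)).
  by apply: Ck_on_derive; apply: Ck_on_coord => //; exact: (ic_G ic).
apply: (@Ck_on_eq _ _ _ _ _ (fun x => 2^-1 * \sum_l (invmx (G x) m l *
    (pd i (fun y => G y j l : R^o) x + pd j (fun y => G y i l : R^o) x
     + - pd l (fun y => G y i j : R^o) x) : R^o) : R^o)) => // [x _|]; first by rewrite mxE.
apply: Ck_onM => //; first exact: Ck_on_cst.
apply: Ck_on_sum => // l; apply: Ck_onM => //; first exact: smooth_invG.
by apply: Ck_onD => //; [exact: Ck_onD|exact: Ck_onN].
Qed.

Lemma smooth_sff_coord i j : smooth_on U (fun x => sff_coord X G x i j).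
Proof.
move=> k; have sX l : Ck_on l U X := ic_X ic l.
have spp : Ck_on k U ('D_(ebase R i) (pd j X)) := Ck_on_derive _ (Ck_on_derive _ (sX k.+2)).
apply: Ck_onD => //; last first.
  by apply: Ck_onN => //; apply: Ck_on_deriveF => //; exact: smooth_christoffel.
by apply: Ck_onD => //; apply: Ck_onZ => //; exact: Ck_on_lor.
Qed.

Lemma smooth_mean_curvature_field : smooth_on U (mean_curvature_field X G).
Proof.
move=> k; apply: Ck_onZ => //; first exact: Ck_on_cst.
apply: Ck_on_sum => // i; apply: Ck_on_sum => // j; apply: Ck_onZ => //.
  exact: smooth_invG.
exact: smooth_sff_coord.
Qed.

Hypothesis f_gt0 : forall x, U x -> 0 < mean_curvature X G x.

Lemma mean_curvature_sqr x : U x ->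
  lor (mean_curvature_field X G x) (mean_curvature_field X G x) = mean_curvature X G x ^+ 2.
Proof.
(* [Num.sqrt] is 0 on negative numbers, so a positive root forces a positive argument. *)
by move=> /f_gt0 f0; rewrite /mean_curvature sqr_sqrtr // ltW // -sqrtr_gt0.
Qed.

Lemma smooth_mean_curvature : smooth_on U (mean_curvature X G : 'rV[R]_2 -> R^o).
Proof.
move=> k; apply: Ck_on_sqrt => // [x Ux|].
  by rewrite -sqrtr_gt0; exact: f_gt0.
by apply: Ck_on_lor => //; exact: smooth_mean_curvature_field.
Qed.

Lemma smooth_E3 : smooth_on U (E3 X G).
Proof.
move=> k; apply: Ck_onZ => //; last exact: smooth_mean_curvature_field.
apply: Ck_onV => //; last exact: smooth_mean_curvature.
by move=> x Ux; rewrite gt_eqF // f_gt0.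
Qed.

Lemma smooth_gradient : smooth_on U (gradient G (mean_curvature X G)).
Proof.
move=> k; apply: Ck_on_mx => // r i.
apply: (@Ck_on_eq _ _ _ _ _ (fun x => \sum_j (invmx (G x) i j *
   pd j (mean_curvature X G : 'rV[R]_2 -> R^o) x : R^o))) => // [x _|]; first by rewrite mxE.
apply: Ck_on_sum => // j; apply: Ck_onM => //; first exact: smooth_invG.
by apply: Ck_on_derive; exact: smooth_mean_curvature.
Qed.

Lemma smooth_inner (v w : 'rV[R]_2 -> 'rV[R]_2) : smooth_on U v -> smooth_on U w ->
  smooth_on U (fun x => inner G x (v x) (w x) : R^o).
Proof.
move=> sv sw k.
have sG i j : Ck_on k U (fun x => G x i j : R^o) by apply: Ck_on_coord => //; exact: (ic_G ic).
have sv' i : Ck_on k U (fun x => v x 0 i : R^o) by exact: Ck_on_coord.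
have sw' i : Ck_on k U (fun x => w x 0 i : R^o) by exact: Ck_on_coord.
apply: (@Ck_on_eq _ _ _ _ _ (fun x => v x 0 0 * G x 0 0 * w x 0 0 + v x 0 1 * G x 1 0 * w x 0 0
  + v x 0 0 * G x 0 1 * w x 0 1 + v x 0 1 * G x 1 1 * w x 0 1 : R^o)) => // [x _|].
  by rewrite inner2.
have sm i j l : Ck_on k U (fun x => v x 0 i * G x i j * w x 0 l : R^o).
  by apply: Ck_onM => //; exact: Ck_onM.
by apply: Ck_onD => //; apply: Ck_onD => //; exact: Ck_onD.
Qed.

Hypothesis grad_neq0 : forall x, U x -> gradient G (mean_curvature X G) x != 0.

Lemma smooth_E1 : smooth_on U (E1 X G).
Proof.
have i0 x : U x -> 0 < inner G x (gradient G (mean_curvature X G) x) (gradient G (mean_curvature X G) x).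
  by move=> Ux; apply: (inner_gt0 ic Ux); exact: grad_neq0.
move=> k; apply: Ck_onZ => //; last exact: smooth_gradient.
apply: Ck_onV => // [x Ux|]; first by rewrite gt_eqF // sqrtr_gt0 i0.
by apply: Ck_on_sqrt => //; exact: smooth_inner smooth_gradient smooth_gradient k.
Qed.

Lemma E1_unit x : U x -> inner G x (E1 X G x) (E1 X G x) = 1.
Proof.
move=> Ux; set g := gradient G (mean_curvature X G) x.
have i0 : 0 < inner G x g g by apply: (inner_gt0 ic Ux); exact: grad_neq0.
rewrite /E1 -/g -(ic_iso ic) // !deriveZv ?lorZl ?lorZr ?(ic_iso ic) //;
  try exact: Ck_on_differentiable (ic_X ic 1%N) Ux.
by rewrite mulrA -expr2 exprVn sqr_sqrtr ?ltW // mulVf // gt_eqF.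
Qed.

(* The rotation of [v] by a right angle in the metric [G]. *)
Definition rotate (v : 'rV[R]_2 -> 'rV[R]_2) (x : 'rV[R]_2) : 'rV[R]_2 :=
  (Num.sqrt (\det (G x)))^-1 *: row2 (- (v x *m G x) 0 1) ((v x *m G x) 0 0).

Lemma inner_row (v w : 'rV[R]_2) x : inner G x v w = (v *m G x) 0 0 * w 0 0 + (v *m G x) 0 1 * w 0 1.
Proof. by rewrite inner_sum sum2. Qed.

Lemma rotate_orth v x : inner G x (v x) (rotate v x) = 0.
Proof. by rewrite inner_row !mxE /= -/(row2 _ _); ring. Qed.

Lemma rotate_unit v x : U x -> inner G x (v x) (v x) = 1 -> inner G x (rotate v x) (rotate v x) = 1.
Proof.
move=> Ux; have d0 := detG_gt0 ic Ux.
have s0 : 0 < Num.sqrt (\det (G x)) by rewrite sqrtr_gt0.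
have S2 : Num.sqrt (\det (G x)) ^+ 2 = \det (G x) by rewrite sqr_sqrtr // ltW.
rewrite /rotate; set s := Num.sqrt _ in s0 S2 *.
rewrite !inner2 !mxE /= !sum2 (G01 ic Ux) => E.
rewrite det2 (G01 ic Ux) in S2.
(* 1 is written as the determinant times the squared length of [v x], divided by s^2. *)
rewrite -[RHS](divff (expf_neq0 2 (lt0r_neq0 s0))) {1}S2 -[X in X / _]mulr1 -[X in _ * X / _]E.
by field; rewrite gt_eqF.
Qed.

Lemma rotate_det v x : U x -> inner G x (v x) (v x) = 1 ->
  0 < \det (\matrix_(i < 2) [:: v x; rotate v x]`_i).
Proof.
move=> Ux E; have s0 : 0 < (Num.sqrt (\det (G x)))^-1 by rewrite invr_gt0 sqrtr_gt0 (detG_gt0 ic).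
rewrite /rotate det2 !mxE /=.
rewrite [X in 0 < X](_ : _ = (Num.sqrt (\det (G x)))^-1 * inner G x (v x) (v x)); last first.
  by rewrite inner2 !sum2; ring.
by rewrite E mulr1.
Qed.

Lemma smooth_rotate v : smooth_on U v -> smooth_on U (rotate v).
Proof.
move=> sv k.
have sG i j : Ck_on k U (fun x => G x i j : R^o) by apply: Ck_on_coord => //; exact: (ic_G ic).
have sv' i : Ck_on k U (fun x => v x 0 i : R^o) by exact: Ck_on_coord.
have svG j : Ck_on k U (fun x => (v x *m G x) 0 j : R^o).
  apply: (@Ck_on_eq _ _ _ _ _ (fun x => v x 0 0 * G x 0 j + v x 0 1 * G x 1 j : R^o)) => // [x _|].
    by rewrite mxE sum2.
  by apply: Ck_onD => //; exact: Ck_onM.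
apply: Ck_onZ => //.
  apply: Ck_onV => // [x Ux|]; first by rewrite gt_eqF // sqrtr_gt0 (detG_gt0 ic).
  apply: Ck_on_sqrt => // [x Ux|]; first exact: (detG_gt0 ic).
  apply: (@Ck_on_eq _ _ _ _ _ (fun x => G x 0 0 * G x 1 1 + - (G x 0 1 * G x 1 0) : R^o)) => // [x _|].
    by rewrite det2.
  by apply: Ck_onD => //; [exact: Ck_onM|apply: Ck_onN => //; exact: Ck_onM].
apply: Ck_on_mx => // r i; case: (ord2E i) => ->.
  by apply: (@Ck_on_eq _ _ _ _ _ (fun x => - (v x *m G x) 0 1 : R^o)) => // [x _|]; [rewrite [RHS]mxE|exact: Ck_onN].
by apply: (@Ck_on_eq _ _ _ _ _ (fun x => (v x *m G x) 0 0 : R^o)) => // x _; rewrite [RHS]mxE.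
Qed.

End MeanCurvature.

(** * The adapted frame of a PNMC surface *)

Section SecondFundamentalForm.
Context {R : realType}.
Variables (U : set 'rV[R]_2) (X : 'rV[R]_2 -> 'rV[R]_5) (G : 'rV[R]_2 -> 'M[R]_2).
Hypothesis ic : immersed_chart U X G.
Let oU := ic_open ic.

Lemma second_derive x v w : U x ->
  'D_v ('D_w X) x = \sum_i \sum_j (v 0 i * w 0 j) *: pd i (pd j X) x.
Proof.
move=> Ux; have sX k : Ck_on k U X := ic_X ic k.
have dDX u : differentiable ('D_u X) x by exact: Ck_on_differentiable (Ck_on_derive u (sX 2%N)) Ux.
have E i : 'D_(delta_mx 0 i) ('D_w X) x = \sum_j w 0 j *: pd i (pd j X) x.
  apply: etrans (derive_sym (delta_mx 0 i) w oU Ux (sX 2%N)) _.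
  apply: etrans (derive_rv w (dDX (delta_mx 0 i))) _; apply: eq_bigr => j _.
  exact: (congr1 (fun z => w 0 j *: z) (derive_sym (delta_mx 0 j) (delta_mx 0 i) oU Ux (sX 2%N))).
apply: etrans (derive_rv v (dDX w)) _; apply: eq_bigr => i _.
apply: etrans (congr1 (fun z => v 0 i *: z) (E i)) _.
by rewrite scaler_sumr; apply: eq_bigr => j _; rewrite scalerA.
Qed.

Lemma lor_sff x v w xi :
  lor (sff X G x v w) xi = \sum_i \sum_j v 0 i * w 0 j * lor (sff_coord X G x i j) xi.
Proof.
rewrite /sff lor_suml; apply: eq_bigr => i _; rewrite lor_suml; apply: eq_bigr => j _.
exact: lorZl.
Qed.

(** Differentiating the direction [w] produces a tangent vector, which [xi] does not see; what
    remains is the second derivative of [X], that is, the second fundamental form. *)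
Lemma lor_along_along x v w xi : U x -> smooth_on U v -> smooth_on U w ->
  lor (X x) xi = 0 -> (forall k, lor (pd k X x) xi = 0) ->
  lor (along v (along w X) x) xi = lor (sff X G x (v x) (w x)) xi.
Proof.
move=> Ux sv sw Xxi kxi.
have dw : differentiable w x by exact: Ck_on_differentiable (sw 1%N) Ux.
rewrite alongE along_funE.
apply: etrans (congr1 (fun z => lor z xi) (derive_deriveF (v x) oU Ux dw (ic_X ic 2%N))) _.
rewrite lorDl (lor_derive_tangent ic) // big1 ?add0r => [|k _]; last by rewrite kxi mulr0.
apply: etrans (congr1 (fun z => lor z xi) (second_derive (v x) (w x) Ux)) _.
rewrite lor_sff lor_suml; apply: eq_bigr => i _; rewrite lor_suml; apply: eq_bigr => j _.
by rewrite lorZl (sff_coord_normal ic).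
Qed.

Lemma innerZl x a v w : inner G x (a *: v) w = a * inner G x v w.
Proof. by rewrite /inner -!scalemxAl mxE. Qed.

Lemma inner_shape x xi v w : U x -> inner G x (Defs.shape X G x xi v) w = lor (sff X G x v w) xi.
Proof.
move=> Ux; rewrite /Defs.shape (inner_raise (fun j => lor (sff X G x v (ebase R j)) xi)) ?(G_unit ic) ?(G_sym ic) //.
pose b i j := lor (sff_coord X G x i j) xi.
have E k : lor (sff X G x v (ebase R k)) xi = \sum_i v 0 i * b i k.
  rewrite lor_sff; apply: eq_bigr => i _; rewrite -(sum_ebase (fun j => v 0 i * b i j) k).
  by apply: eq_bigr => j _; rewrite mulrAC.
rewrite lor_sff exchange_big; apply: eq_bigr => k _ /=; rewrite E mulr_suml.
by apply: eq_bigr => i _; rewrite mulrAC.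
Qed.

(** The matrix P with rows [v] and [w] satisfies P G P^T = 1, so P^T P is the inverse of G. Metric
    traces thereby become sums over the orthonormal frame. *)
Lemma invG_frame x v w : inner G x v v = 1 -> inner G x v w = 0 -> inner G x w w = 1 -> U x ->
  (forall i j, invmx (G x) i j = v 0 i * v 0 j + w 0 i * w 0 j) /\
  forall u, u = inner G x u v *: v + inner G x u w *: w.
Proof.
move=> vv vw ww Ux; pose P : 'M[R]_2 := \matrix_(i < 2) [:: v; w]`_i.
have wv : inner G x w v = 0 by rewrite -(ic_iso ic) // lorC (ic_iso ic).
have E : P *m G x *m P^T = 1%:M.
  apply/matrixP => i j; have -> : (P *m G x *m P^T) i j = inner G x [:: v; w]`_i [:: v; w]`_j.
    by rewrite /inner !mxE; apply: eq_bigr => k _; rewrite !mxE; congr (_ * _); apply: eq_bigr => l _; rewrite !mxE.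
  by rewrite !mxE; case: (ord2E i) => ->; case: (ord2E j) => -> /=.
have EG : G x *m (P^T *m P) = 1%:M.
  by apply: mulmx1C; rewrite -mulmxA; apply: mulmx1C.
split=> [i j|u].
  by rewrite (invmx_unique EG) !mxE sum2 !mxE.
have Pu : u *m G x *m P^T = \row_i [:: inner G x u v; inner G x u w]`_i.
  apply/rowP => i; rewrite [RHS]mxE /inner.
  by case: (ord2E i) => -> /=; rewrite !mxE; apply: eq_bigr => k _; rewrite !mxE.
rewrite -[LHS]mulmx1 -EG !mulmxA Pu; apply/rowP => k.
by rewrite [LHS]mxE sum2 !mxE.
Qed.

Variables (c C : R).
Hypothesis c_neq0 : c != 0.
Let f := mean_curvature X G.
Hypothesis f_gt0 : forall x, U x -> 0 < f x.
Hypothesis grad_neq0 : forall x, U x -> gradient G f x != 0.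
Hypothesis parallel : forall x v, U x -> nabla_perp X G (E3 X G) v x = 0.
Hypothesis attached : forall x, U x ->
  [/\ forall v2 n4, positive_frames X G x v2 n4 ->
        Defs.shape X G x n4 (E1 X G x) = (c * f x `^ (3 / 2)) *: E1 X G x /\
        Defs.shape X G x n4 v2 = - (c * f x `^ (3 / 2)) *: v2,
      'D_(E1 X G x) (f : 'rV[R]_2 -> R^o) x = 4 / 3 * f x * Num.sqrt (radicand c C (f x))
    & 0 < 'D_(E1 X G x) (f : 'rV[R]_2 -> R^o) x].

Let v1 := E1 X G.
Let v2 := rotate G v1.
Let e1 := along v1 X.
Let e2 := along v2 X.
Let e3 := E3 X G.
Let sv1 : smooth_on U v1 := smooth_E1 ic f_gt0 grad_neq0.
Let sv2 : smooth_on U v2 := smooth_rotate ic sv1.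
Let sal v F : smooth_on U v -> smooth_on U F -> smooth_on U (along v F).
Proof. by move=> sv sF k; rewrite along_funE; apply: Ck_on_deriveF. Qed.
Let se1 : smooth_on U e1 := sal sv1 (ic_X ic).
Let se2 : smooth_on U e2 := sal sv2 (ic_X ic).
Let se3 : smooth_on U e3 := smooth_E3 ic f_gt0.

Let v11 x : U x -> inner G x (v1 x) (v1 x) = 1 := fun Ux => E1_unit ic grad_neq0 Ux.
Let v12 x : inner G x (v1 x) (v2 x) = 0 := rotate_orth G v1 x.
Let v22 x : U x -> inner G x (v2 x) (v2 x) = 1 := fun Ux => rotate_unit ic Ux (v11 Ux).

Lemma lor_along_tangent x u v : U x -> lor ('D_u X x) (along v X x) = inner G x u (v x).
Proof. by move=> Ux; rewrite alongE; exact: (ic_iso ic). Qed.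

Lemma E3_pd x k : U x -> lor (pd k X x) (e3 x) = 0.
Proof. by move=> Ux; rewrite lorC /e3 /E3 lorZl (mean_curvature_tangent ic) // mulr0. Qed.

Lemma E3_position x : U x -> lor (X x) (e3 x) = 0.
Proof. by move=> Ux; rewrite lorC /e3 /E3 lorZl (mean_curvature_position ic) // mulr0. Qed.

Lemma E3_unit x : U x -> lor (e3 x) (e3 x) = 1.
Proof.
move=> Ux; rewrite /e3 /E3 lorZl lorZr (mean_curvature_sqr f_gt0) // -/f.
by field; rewrite gt_eqF // f_gt0.
Qed.

Lemma tangent_normal x u xi : U x -> (forall k, lor (pd k X x) xi = 0) -> lor ('D_u X x) xi = 0.
Proof. by move=> Ux kxi; rewrite (lor_derive_tangent ic) // big1 // => k _; rewrite kxi mulr0. Qed.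

Lemma normal_of_frame x k xi : U x -> lor (e1 x) xi = 0 -> lor (e2 x) xi = 0 ->
  lor (pd k X x) xi = 0.
Proof.
move=> Ux h1 h2; have dX : differentiable X x by exact: Ck_on_differentiable (ic_X ic 1%N) Ux.
have [_ span] := invG_frame (v11 Ux) (v12 x) (v22 Ux) Ux.
apply: etrans (congr1 (fun u => lor ('D_u X x) xi) (span (ebase R k))) _.
have lin p q a b : lor ('D_p X x) xi = 0 -> lor ('D_q X x) xi = 0 ->
    lor ('D_(a *: p + b *: q) X x) xi = 0.
  move=> hp hq; rewrite (deriveDv _ _ dX) (deriveZv p a dX) (deriveZv q b dX).
  move: ('D_p X x) ('D_q X x) hp hq => P Q hp hq.
  by rewrite lorDl !lorZl hp hq !mulr0 addr0.
apply: lin.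
  exact: (etrans (congr1 (fun z => lor z xi) (esym (alongE v1 X x))) h1).
exact: (etrans (congr1 (fun z => lor z xi) (esym (alongE v2 X x))) h2).
Qed.

Lemma frame_exists x : U x -> exists n4, [/\ lor_frame (e1 x) (e2 x) (e3 x) n4 (X x),
  lor (along v1 e1 x) n4 = c * f x `^ (3 / 2), lor (along v1 e2 x) n4 = 0 &
  lor (along v2 e2 x) n4 = - (c * f x `^ (3 / 2))].
Proof.
move=> Ux.
have pe u v : lor ('D_u X x) (along v X x) = inner G x u (v x) := lor_along_tangent u v Ux.
have h11 : lor (e1 x) (e1 x) = 1 by rewrite {1}/e1 alongE pe v11.
have h12 : lor (e1 x) (e2 x) = 0 by rewrite {1}/e1 alongE pe v12.
have h22 : lor (e2 x) (e2 x) = 1 by rewrite {1}/e2 alongE pe v22.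
have h13 : lor (e1 x) (e3 x) = 0 by rewrite {1}/e1 alongE tangent_normal // => k; exact: E3_pd.
have h23 : lor (e2 x) (e3 x) = 0 by rewrite {1}/e2 alongE tangent_normal // => k; exact: E3_pd.
have h1x : lor (e1 x) (X x) = 0 by rewrite {1}/e1 alongE (tangent_orth ic).
have h2x : lor (e2 x) (X x) = 0 by rewrite {1}/e2 alongE (tangent_orth ic).
have h3x : lor (e3 x) (X x) = 0 by rewrite lorC E3_position.
have [n4 fr det0] := lor_frame_exists h11 h22 (E3_unit Ux) (lorXX ic Ux) h12 h13 h23 h1x h2x h3x.
exists n4; have [_ [[_ _ h14 _ _] [h24 _ h34 _ h4x]]] := fr.
have [[_ _ _ h44 _] _] := fr.
have k4 k : lor (pd k X x) n4 = 0 := normal_of_frame k Ux h14 h24.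
(* The hypothesis on the shape operator speaks of positive frames only; [rotate_det] and the
   determinant provided with [n4] supply the two orientations. *)
have pf : positive_frames X G x (v2 x) n4.
  split; first by split; [exact: v12|exact: v22|exact (rotate_det ic Ux (v11 Ux))].
  split => //; first by move=> i; rewrite lorC k4.
  by move: det0; rewrite /rows5 /e1 /e2 !alongE.
have [sh _ _] := attached Ux; have [sh1 sh2] := sh _ _ pf.
have Xn : lor (X x) n4 = 0 by rewrite lorC.
split=> //.
- rewrite /e1 (lor_along_along Ux sv1 sv1 Xn k4) -inner_shape // sh1.
  by rewrite innerZl (v11 Ux) mulr1.
- rewrite /e2 (lor_along_along Ux sv1 sv2 Xn k4) -inner_shape // sh1.
  by rewrite innerZl (v12 x) mulr0.
- rewrite /e2 (lor_along_along Ux sv2 sv2 Xn k4) -inner_shape // sh2.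
  by rewrite innerZl (v22 Ux) mulr1.
Qed.

Let A x := along v1 e1 x.
(** The vectors [n4] are chosen point by point, with no control on how they vary. The part of D_1 e1
    orthogonal to [e1], [e2], [e3] and [X] is mu times E4, so dividing by mu gives a smooth formula.
    The last sign is due to <X, X> = -1. *)
Let e4 x : 'rV[R]_5 := (c * f x `^ (3 / 2))^-1 *: (A x - lor (A x) (e1 x) *: e1 x
  - lor (A x) (e2 x) *: e2 x - lor (A x) (e3 x) *: e3 x + lor (A x) (X x) *: X x).

Let mu0 x : U x -> c * f x `^ (3 / 2) != 0.
Proof. by move=> Ux; rewrite mulf_neq0 // gt_eqF // powR_gt0 // f_gt0. Qed.

Lemma smooth_e4 : smooth_on U e4.
Proof.
move=> k; have sA : Ck_on k U A := sal sv1 se1 k.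
have sX : Ck_on k U X := ic_X ic k.
have sz (F : 'rV[R]_2 -> 'rV[R]_5) : Ck_on k U F -> Ck_on k U (fun x => lor (A x) (F x) *: F x).
  by move=> sF; apply: Ck_onZ => //; exact: Ck_on_lor.
apply: Ck_onZ => //.
  apply: Ck_onV => //.
  apply: Ck_onM => //; first exact: Ck_on_cst.
  by apply: Ck_on_powR => //; exact: smooth_mean_curvature ic f_gt0 k.
apply: Ck_onD => //; last exact: sz.
apply: Ck_onD => //; last by apply: Ck_onN => //; apply: sz; exact: se3.
apply: Ck_onD => //; last by apply: Ck_onN => //; apply: sz; exact: se2.
by apply: Ck_onD => //; apply: Ck_onN => //; apply: sz; exact: se1.
Qed.

Lemma e4_spec x : U x -> [/\ lor_frame (e1 x) (e2 x) (e3 x) (e4 x) (X x),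
  lor (along v1 e1 x) (e4 x) = c * f x `^ (3 / 2), lor (along v1 e2 x) (e4 x) = 0 &
  lor (along v2 e2 x) (e4 x) = - (c * f x `^ (3 / 2))].
Proof.
move=> Ux; have [n4 [fr b1 b2 b3]] := frame_exists Ux.
suff -> : e4 x = n4 by [].
rewrite /e4 {1}(lor_frame_expand (A x) fr) b1.
have alg (a b d m n z : 'rV[R]_5) (s : R) : s != 0 -> n = s *: z ->
   s^-1 *: (a + b + d + n - m - a - b - d + m) = z.
  move=> s0 ->; rewrite -[RHS](scalerK s0); congr (_ *: _).
  by apply/rowP => i; rewrite !mxE; ring.
exact: alg (mu0 Ux) erefl.
Qed.

Lemma adapted_frame_of_pnmc : exists w1 w2 n3 n4, adapted_frame U X w1 w2 n3 n4 f c C.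
Proof.
exists v1, v2, e3, e4.
have dX x : U x -> differentiable X x by exact: Ck_on_differentiable (ic_X ic 1%N).
have sf : smooth_on U (f : 'rV[R]_2 -> R^o) := smooth_mean_curvature ic f_gt0.
have XE3 x := @E3_position x.
split.
- exact: oU.
- exact: (ic_X ic).
- exact: sv1.
- exact: sv2.
- exact: se3.
- exact: smooth_e4.
- exact: sf.
- move=> x u Ux; rewrite !lor_along_tangent //.
  by have [_ span] := invG_frame (v11 Ux) (v12 x) (v22 Ux) Ux; exact: span.
- by move=> x /e4_spec[].
- exact: c_neq0.
- exact: f_gt0.
- by move=> x /attached[].
- by move=> x /attached[].
- move=> x Ux.
  have df : differentiable (f : 'rV[R]_2 -> R^o) x by exact: Ck_on_differentiable (sf 1%N) Ux.
  have E u : 'D_u (f : 'rV[R]_2 -> R^o) x = inner G x (gradient G f x) u.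
    rewrite /gradient inner_raise ?(G_unit ic) ?(G_sym ic) // derive_rv //.
    by apply: eq_bigr => k _; rewrite /GRing.scale /= mulrC.
  rewrite E; set g := gradient G f x.
  have i0 : 0 < inner G x g g by apply: (inner_gt0 ic Ux); exact: grad_neq0.
  (* [v1] is a positive multiple of the gradient, so orthogonality of [v2] to one is orthogonality
     to the other. *)
  have := v12 x; rewrite {1}/v1 /E1 -/f -/g innerZl => /eqP.
  by rewrite mulf_eq0 invr_eq0 gt_eqF ?sqrtr_gt0 //= => /eqP.
- move=> x u Ux; have [fr _ _ _] := e4_spec Ux.
  have [_ [[_ _ h14 _ _] [h24 _ h34 _ h4x]]] := fr.
  have k4 k : lor (pd k X x) (e4 x) = 0 := normal_of_frame k Ux h14 h24.
  have := congr1 (fun z => lor z (e4 x)) (parallel u Ux).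
  rewrite /= lor0l /nabla_perp /normal_part lorBl /tangent_part lor_gtrace.
  rewrite big1 ?subr0 => [|i _]; last by rewrite big1 // => j _; rewrite lorZl k4 !mulr0.
  by rewrite /nablaX /tanH lorDl lorZl (lorC (X x)) h4x mulr0 addr0.
- by move=> x /e4_spec[].
- by move=> x /e4_spec[].
- by move=> x /e4_spec[].
- move=> x Ux; have Xxi := XE3 _ Ux; have kxi k := @E3_pd x k Ux.
  rewrite (lor_along_along Ux sv1 sv1 Xxi kxi) (lor_along_along Ux sv2 sv2 Xxi kxi).
  have [ginv _] := invG_frame (v11 Ux) (v12 x) (v22 Ux) Ux.
  have H : lor (mean_curvature_field X G x) (e3 x) = f x.
    rewrite /e3 /E3 lorZr (mean_curvature_sqr f_gt0) // -/f; field.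
    by rewrite gt_eqF // f_gt0.
  rewrite -H /mean_curvature_field lorZl lor_gtrace mulVKf // !lor_sff -big_split.
  apply: eq_bigr => i _; rewrite -big_split; apply: eq_bigr => j _ /=.
  by rewrite ginv mulrDl.
Qed.

End SecondFundamentalForm.

(** * Change of chart *)

Lemma pullback_contraction {R : realType} (J W : 'M[R]_2) (S Y : 'I_2 -> 'I_2 -> R) :
  (forall i j, S i j = \sum_k \sum_l J j k * J i l * Y l k) ->
  \sum_i \sum_j W i j * S i j = \sum_i \sum_j (J^T *m W *m J) i j * Y i j.
Proof.
move=> E; rewrite !sum2 !E !sum2 !mxE !sum2 !mxE !sum2 !mxE.
ring.
Qed.

Section ChangeOfChart.
Context {R : realType}.
Variables (U U' V : set 'rV[R]_2) (X X' : 'rV[R]_2 -> 'rV[R]_5) (G G' : 'rV[R]_2 -> 'M[R]_2)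
  (T : 'rV[R]_2 -> 'rV[R]_2).
Hypotheses (ic : immersed_chart U X G) (ic' : immersed_chart U' X' G').
Hypotheses (oV : open V) (VU' : V `<=` U') (sT : smooth_on V T)
  (TU : forall x, V x -> U (T x)) (XT : forall x, V x -> X' x = X (T x)).
Let oU := ic_open ic.

Let dT x : V x -> differentiable T x.
Proof. by move=> Vx; exact: Ck_on_differentiable (sT 1%N) Vx. Qed.
Let dXT x : V x -> differentiable X (T x).
Proof. by move=> Vx; exact: Ck_on_differentiable (ic_X ic 1%N) (TU Vx). Qed.

Lemma derive_change x v : V x -> 'D_v X' x = 'D_('D_v T x) X (T x).
Proof.
move=> Vx; apply: etrans (derive_comp v (dT Vx) (dXT Vx)).
exact: (near_eq_derive _ (near_open oV Vx XT)).
Qed.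

Lemma jacobian_change_unit x : V x -> jacobian T x \in unitmx.
Proof.
move=> Vx; apply: unitmx_inj => v vJ; apply: (ic_inj ic' (VU' Vx)).
apply: etrans (derive_change v Vx) _.
by rewrite (mul_jacobian _ (dT Vx)) vJ (deriveE _ (dXT Vx)) linear0.
Qed.

Lemma pd_coord x i k : V x -> pd i T x 0 k = jacobian T x i k.
Proof. by move=> Vx; rewrite /pd (mul_jacobian _ (dT Vx)) -rowE mxE. Qed.

Lemma metric_change x : V x ->
  G' x = jacobian T x *m G (T x) *m (jacobian T x)^T.
Proof.
move=> Vx; apply/matrixP => i j; rewrite -(inner_ebase G') -(ic_iso ic' _ _ (VU' Vx)).
apply: etrans (congr2 (fun a b => lor a b) (derive_change _ Vx) (derive_change _ Vx)) _.
rewrite (ic_iso ic _ _ (TU Vx)) !(mul_jacobian _ (dT Vx)).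
by rewrite -[RHS](inner_ebase (fun=> _) x i j) /inner trmx_mul !mulmxA.
Qed.

Lemma inverse_metric_change x : V x ->
  (jacobian T x)^T *m invmx (G' x) *m jacobian T x = invmx (G (T x)).
Proof.
move=> Vx; set J := jacobian T x; have uJ : J \in unitmx := jacobian_change_unit Vx.
apply/esym/invmx_unique; apply: (can_inj (mulKmx uJ)).
rewrite !mulmxA -(metric_change Vx) mulmxV ?(G_unit ic') ?mul1mx ?mulmx1 //; exact: VU'.
Qed.

(** The term containing second derivatives of [T] is tangent and disappears against [xi], so on
    normal vectors second derivatives transform as a tensor. *)
Lemma second_derivative_change x i j xi : V x -> (forall k, lor (pd k X (T x)) xi = 0) ->
  lor (pd i (pd j X') x) xi =
  \sum_k \sum_l jacobian T x j k * jacobian T x i l * lor (pd l (pd k X) (T x)) xi.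
Proof.
move=> Vx kxi.
have dD k : differentiable (pd k X) (T x).
  exact: Ck_on_differentiable (Ck_on_derive (ebase R k) (ic_X ic 2%N)) (TU Vx).
have dDT : differentiable (pd j T) x.
  exact: Ck_on_differentiable (Ck_on_derive (ebase R j) (sT 2%N)) Vx.
have E : \near x, pd j X' x = (\sum_k (fun y => pd j T y 0 k *: (pd k X \o T) y)) x.
  apply: (near_open oV Vx) => y Vy; rewrite fct_sumE; apply: etrans (derive_change _ Vy) _.
  exact: derive_rv (dXT Vy).
have D k := differentiable_scale (differentiable_mx_coord 0 k dDT)
  (differentiable_comp (dT Vx) (dD k)).
apply: etrans (congr1 (fun z => lor z xi) (near_eq_derive (ebase R i) E)) _.
rewrite derive_sum => [|k]; last by apply: diff_derivable; exact: (D k).1.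
rewrite lor_suml; apply: eq_bigr => k _; rewrite (D k).2 lorDl !lorZl /= kxi mulr0 add0r.
rewrite (pd_coord j k Vx).
apply: etrans (congr1 (fun z => _ * lor z xi) (derive_comp (ebase R i) (dT Vx) (dD k))) _.
apply: etrans (congr1 (fun z => _ * lor z xi) (derive_rv _ (dD k))) _.
rewrite lor_suml mulr_sumr; apply: eq_bigr => l _.
by rewrite lorZl mulrA; congr (_ * _ * _); exact: pd_coord.
Qed.

Lemma normal_change x xi : V x -> (forall k, lor (pd k X' x) xi = 0) ->
  forall k, lor (pd k X (T x)) xi = 0.
Proof.
move=> Vx xi0 k; have uJ := jacobian_change_unit Vx.
pose a : 'cV[R]_2 := \col_k lor (pd k X (T x)) xi.
have Ja : jacobian T x *m a = 0.
  apply/colP => i; rewrite mxE [RHS]mxE; apply: etrans (xi0 i); apply/esym.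
  apply: etrans (congr1 (fun z => lor z xi) (derive_change (ebase R i) Vx)) _.
  rewrite (lor_derive_tangent ic _ _ (TU Vx)); apply: eq_bigr => l _.
  by congr (_ * _); [exact: (pd_coord i l Vx)|rewrite mxE].
have : a k 0 = 0 by rewrite -[a](mulKmx uJ) Ja mulmx0 mxE.
by rewrite mxE.
Qed.

(** The difference of the two mean curvature vectors is normal in both charts. Against a normal
    vector each of them is a trace of plain second derivatives, so both have the same product with
    the difference. Its square is therefore zero, and being orthogonal to the timelike [X (T x)] it
    vanishes. *)
Lemma mean_curvature_change x : V x -> mean_curvature X' G' x = mean_curvature X G (T x).
Proof.
move=> Vx; have U'x := VU' Vx; have UTx := TU Vx.
rewrite /mean_curvature; set H' := mean_curvature_field X' G' x.
set H := mean_curvature_field X G (T x); suff -> : H' = H by [].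
have tH k : lor (pd k X (T x)) H = 0 by rewrite lorC (mean_curvature_tangent ic).
have tH' k : lor (pd k X' x) H' = 0 by rewrite lorC (mean_curvature_tangent ic').
have XH : lor H (X (T x)) = 0 by exact (mean_curvature_position ic UTx).
have XH' : lor H' (X (T x)) = 0 by rewrite -(XT Vx); exact (mean_curvature_position ic' U'x).
have mH xi := @mean_curvature_normal _ _ _ _ ic (T x) xi UTx.
have mH' xi := @mean_curvature_normal _ _ _ _ ic' x xi U'x.
rewrite -/H in mH; rewrite -/H' in mH'; clearbody H H'.
have Xxi : lor (H' - H) (X (T x)) = 0 by rewrite lorBl XH XH' subrr.
have tH2 k : lor (pd k X (T x)) H' = 0 := normal_change Vx tH' k.
have tH2' k : lor (pd k X' x) H = 0.
  apply: etrans (congr1 (fun z => lor z H) (derive_change (ebase R k) Vx)) _.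
  by rewrite (lor_derive_tangent ic) // big1 // => l _; rewrite tH mulr0.
have kxi k : lor (pd k X (T x)) (H' - H) = 0.
  by move: (pd k X (T x)) (tH k) (tH2 k) => P a b; rewrite lorBr a b subr0.
have kxi' k : lor (pd k X' x) (H' - H) = 0.
  by move: (pd k X' x) (tH' k) (tH2' k) => P a b; rewrite lorBr a b subr0.
have E : lor H' (H' - H) = lor H (H' - H).
  have Xxi0 : lor (X (T x)) (H' - H) = 0 := etrans (lorC _ _) Xxi.
  have Xxi0' : lor (X' x) (H' - H) = 0 := etrans (congr1 (fun z => lor z _) (XT Vx)) Xxi0.
  apply: etrans (mH' _ Xxi0' kxi') _; apply: etrans _ (esym (mH _ Xxi0 kxi)).
  apply: (congr1 (fun z => 2^-1 * z)).
  apply: etrans (pullback_contraction (invmx (G' x))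
    (fun i j => second_derivative_change i j Vx kxi)) _.
  by rewrite (inverse_metric_change Vx).
apply/eqP; rewrite -subr_eq0; apply: contraT => xi0.
by have := lor_gt0 (lorXX ic UTx) Xxi xi0; rewrite lorBl E subrr ltxx.
Qed.

End ChangeOfChart.

(** * Reparametrized charts, and the mean curvature as a function on the surface *)

Section Charts.
Context {R : realType} {M : topologicalType}.
Implicit Types a b : chart R M.

Lemma par_preimage_nbhs a (O : set M) x : dom a x -> open O -> O (par a x) ->
  nbhs x [set y | dom a y /\ O (par a y)].
Proof.
move=> ax oO Ox.
have n1 : nbhs x (dom a) by apply: open_nbhs_nbhs; split=> //; exact: dom_open.
have n2 : nbhs x (par a @^-1` O).
  by apply: (par_continuous ax); apply: open_nbhs_nbhs; split.
have nn : nbhs x (dom a `&` par a @^-1` O) by exact: (filterI n1 n2).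
exact: nn.
Qed.

Lemma open_overlap a b : open (overlap a b).
Proof.
rewrite openE => x [ax bx]; exact: (par_preimage_nbhs ax (@img_open _ _ b) bx).
Qed.

Lemma open_par_image a (W : set 'rV[R]_2) : open W -> W `<=` dom a -> open (par a @` W).
Proof.
move=> oW Wa; rewrite openE => _ [x Wx <-].
have ax : dom a x by exact: Wa.
have ix : (par a @` dom a) (par a x) by exists x.
have n1 : nbhs (par a x) (par a @` dom a) by apply: open_nbhs_nbhs; split=> //; exact: img_open.
have n2 : nbhs (par a x) (crd a @^-1` W).
  by apply: (crd_continuous ix); rewrite parK //; apply: open_nbhs_nbhs; split.
have nn : nbhs (par a x) ((par a @` dom a) `&` crd a @^-1` W) by exact: (filterI n1 n2).
apply: filterS nn => _ [[y ay <-]] /=; rewrite parK // => Wy.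
by exists y.
Qed.

Lemma transitionE a b x y : dom b y -> par a x = par b y -> transition a b x = y.
Proof. by move=> bY E; rewrite /transition /= E parK. Qed.

Lemma overlap_transition a b x : overlap a b x ->
  [/\ dom b (transition a b x), par b (transition a b x) = par a x &
      overlap b a (transition a b x)].
Proof.
move=> [ax [y bY E]]; rewrite (transitionE bY (esym E)); split=> //.
by split=> //; rewrite E; exists x.
Qed.

Section Reparametrization.
Variables (a : chart R M) (B B' : set 'rV[R]_2) (F h : 'rV[R]_2 -> 'rV[R]_2).
Hypotheses (oB : open B) (oB' : open B') (Ba : B `<=` dom a).
Hypotheses (sF : smooth_on B F) (sh : smooth_on B' h).
Hypothesis Finj : forall x y, B x -> B y -> F x = F y -> x = y.
Hypothesis hB : forall y, B' y -> B (h y).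
Hypothesis Fh : forall y, B' y -> F (h y) = y.

(** By injectivity of [F], the image of [h] is the part of [B] that [F] sends into [B']. It is open
    by continuity of [F], which is how the image of the new chart is seen to be open. *)
Let parh_image : (par a \o h) @` B' = par a @` (B `&` F @^-1` B').
Proof.
apply/seteqP; split=> [_ [y By <-]|_ [x [Bx /= Fx] <-]].
  by exists (h y) => //; split; [exact: hB|rewrite /= Fh].
exists (F x) => //=; congr (par a _); apply: Finj => //; first exact: hB.
exact: Fh.
Qed.

Let open_source : open (B `&` F @^-1` B').
Proof.
rewrite openE => x [Bx Fx].
have n1 : nbhs x B by apply: open_nbhs_nbhs; split.
have cF : {for x, continuous F} := sF 0%N x Bx.
have n2 : nbhs x (F @^-1` B').
  by apply: cF; apply: open_nbhs_nbhs; split.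
by have nn : nbhs x (B `&` F @^-1` B') by exact: (filterI n1 n2).
Qed.

Lemma reparametrized_chart : exists psi : chart R M,
  [/\ dom psi = B', par psi = par a \o h & crd psi = F \o crd a].
Proof.
have io : open ((par a \o h) @` B').
  by rewrite parh_image; apply: open_par_image => // x [Bx _]; exact: Ba.
have K x : B' x -> (F \o crd a) ((par a \o h) x) = x.
  by move=> Bx; rewrite /= parK ?Fh //; apply: Ba; exact: hB.
have pc x : B' x -> {for x, continuous (par a \o h)}.
  move=> Bx; apply: continuous_comp; first exact (sh 0%N x Bx).
  by apply: par_continuous; apply: Ba; exact: hB.
have cc m : ((par a \o h) @` B') m -> {for m, continuous (F \o crd a)}.
  rewrite parh_image => -[x [Bx _] <-]; have ax := Ba Bx.
  apply: continuous_comp; first by apply: crd_continuous; exists x.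
  by rewrite parK //; exact (sF 0%N x Bx).
by exists (Chart oB' io K pc cc).
Qed.

(** The two transitions are those of [a], preceded by [h] or followed by [F]. *)
Lemma reparametrized_compatible (psi b : chart R M) :
  dom psi = B' -> par psi = par a \o h -> crd psi = F \o crd a ->
  compatible a b -> compatible psi b.
Proof.
move=> dE pE cE [sab sba]; split=> k.
  have Opsi x : overlap psi b x -> B' x /\ overlap a b (h x).
    rewrite /overlap /= dE pE => -[Bx bx]; split=> //; split=> //.
    by apply: Ba; exact: hB.
  have -> : transition psi b = transition a b \o h by rewrite /transition pE.
  apply: (Ck_on_comp (U' := overlap a b)); [exact: open_overlap|exact: open_overlap| | |exact: sab].
    by move=> x /Opsi[].
  by apply: (Ck_onS _ (sh k)) => x /Opsi[].
have Opsi x : overlap b psi x -> overlap b a x /\ B (transition b a x).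
  rewrite /overlap /= dE pE => -[bx [y By E]].
  have ay : dom a (h y) by apply: Ba; exact: hB.
  split; first by split=> //; exists (h y).
  by rewrite (transitionE ay (esym E)); exact: hB.
have -> : transition b psi = F \o transition b a by rewrite /transition cE.
apply: (Ck_on_comp (U' := B)); [exact: open_overlap|exact: oB| | |exact: sF].
  by move=> x /Opsi[].
by apply: (Ck_onS _ (sba k)) => x /Opsi[].
Qed.

End Reparametrization.

Variables (S : riemannian_surface R M) (phi : M -> H4 R).
Hypothesis iso : isometric_immersion S phi.

Lemma local_rep_immersed a : atlas S a -> immersed_chart (dom a) (local_rep phi a) (metric S a).
Proof.
move=> Sa; have [sX X1] := iso Sa; split.
- exact: dom_open.
- exact: sX.
- exact: metric_smooth.
- by move=> x _; exact: set_valP.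
- by move=> x v /X1[+ _]; apply.
- by move=> x v w /X1[_ +]; apply.
Qed.

Lemma mean_curvature_transition a b x y : atlas S a -> atlas S b -> dom a x -> dom b y ->
  par a x = par b y ->
  mean_curvature (local_rep phi a) (metric S a) x = mean_curvature (local_rep phi b) (metric S b) y.
Proof.
move=> Sa Sb ax bY E; have Ox : overlap a b x by split=> //; exists y.
rewrite -(transitionE bY E).
apply: (mean_curvature_change (local_rep_immersed Sb) (local_rep_immersed Sa) (@open_overlap a b)) => //.
- by move=> z [].
- by have [] := atlas_compatible Sa Sb.
- by move=> z /overlap_transition[].
- by move=> z /overlap_transition[_ E' _]; rewrite /local_rep /= E'.
Qed.

End Charts.

Unset Implicit Arguments.
Set Strict Implicit.
Set Printing Implicit Defensive.

Theorem theorem2p9 (R : realType) (M : topologicalType)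
    (S : riemannian_surface R M) (phi : M -> H4 R) (c C : R)
    (hphi : pnmc_biconservative S phi) (hcC : attached_constants S phi c C)
    (hC : 0 < C) (m : M) :
  exists (psi : chart R M) (u0 u1 t0 t1 : R) (f : R -> R) (sigma : R -> 'rV[R]_5)
      (b1 b2 : 'rV[R]_5),
    let kappahat := fun u : R => 3 * Num.sqrt C * f u `^ (3 / 4) in
    [/\ forall a, atlas S a -> compatible psi a,
        dom psi = [set x : 'rV[R]_2 | u0 < x 0 0 < u1 /\ t0 < x 0 1 < t1],
        (par psi @` dom psi) m
      & forall u t, u0 < u < u1 -> t0 < t < t1 ->
          iota4 (phi (par psi (\row_i [:: u; t]`_i))) =
          sigma u + (kappahat u)^-1 *: (sin t *: b1 + (cos t - 1) *: b2)] /\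
    (forall u, u0 < u < u1 ->
      [/\ forall t a x, t0 < t < t1 -> atlas S a -> dom a x ->
            par a x = par psi (\row_i [:: u; t]`_i) ->
            mean_curvature (local_rep phi a) (metric S a) x = f u,
          0 < f u,
          derivable (f : R -> R^o) u 1,
          derive1 (f : R -> R^o) u =
            4 / 3 * f u * Num.sqrt (radicand c C (f u))
        & 0 < derive1 (f : R -> R^o) u]) /\
    (forall u, u0 < u < u1 -> 0 < kappahat u) /\
    [/\ lor b1 b2 = 0, lor b1 b1 = 1 & lor b2 b2 = 1] /\
    smooth_on ([set u | u0 < u < u1] : set R^o) (sigma : R^o -> 'rV[R]_5) /\
    (forall u, u0 < u < u1 ->
      [/\ H3 b1 (sigma u),
          lor (derive1 sigma u) (derive1 sigma u) = 1,
          frenet_curvature b1 sigma u = f u * Num.sqrt (1 + c ^+ 2 * f u),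
          frenet_torsion b1 sigma u =
            2 * `|c| * Num.sqrt (f u) / (3 * (1 + c ^+ 2 * f u))
            * Num.sqrt (radicand c C (f u))
        & lor (sigma u) b2 = (kappahat u)^-1]).
Proof.
have [iso [pnmc _]] := hphi; have [c0 att] := hcC.
have [a Sa [x0 ax0 mE]] := atlas_cover S m.
pose X := local_rep phi a; pose f := mean_curvature X (metric S a).
have ic : immersed_chart (dom a) X (metric S a) := local_rep_immersed iso Sa.
have f_gt0 x : dom a x -> 0 < f x by move=> ax; have [] := pnmc a x Sa ax.
have grad0 x : dom a x -> gradient (metric S a) f x != 0.
  by move=> ax; have [] := pnmc a x Sa ax.
have par0 x v : dom a x -> nabla_perp X (metric S a) (E3 X (metric S a)) v x = 0.
  by move=> ax; have [_ _ _ ->] := pnmc a x Sa ax.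
have [v1 [v2 [e3 [e4 af]]]] :=
  adapted_frame_of_pnmc ic c0 f_gt0 grad0 par0 (fun x ax => att a x Sa ax).
have [e1 [e2 [n [w1 [w2 cf]]]]] := canonical_frame_exists hC af.
have [e [r [F [h [[e_gt0 r_gt0 eU sF sh] [Finj hF Dh F01 rot]]]]]] := flat_coordinates cf ax0.
have hU y : ball (F x0) r y -> dom a (h y) by move=> /hF[/eU].
have hrot y : ball (F x0) r y -> e2 (h y) = cos (y 0 1) *: e2 x0 + sin (y 0 1) *: n x0 /\
    n (h y) = cos (y 0 1) *: n x0 - sin (y 0 1) *: e2 x0.
  by move=> yB; have [hy Fy] := hF y yB; have := rot (h y) hy; rewrite Fy.
have oB : open (ball x0 e)  by exact: ball_open.
have oB' : open (ball (F x0) r)  by exact: ball_open.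
have hB y : ball (F x0) r y -> ball x0 e (h y) by move=> /hF[].
have Fh y : ball (F x0) r y -> F (h y) = y by move=> /hF[].
have [psi [dE pE cE]] := reparametrized_chart oB oB' eU sF sh Finj hB Fh.
have uB (u : R) : F x0 0 0 - r < u < F x0 0 0 + r -> `|F x0 0 0 - u| < r.
  by move=> /andP[u1 u2]; rewrite ltr_norml; apply/andP; split; lra.
have utB (u t : R) : F x0 0 0 - r < u < F x0 0 0 + r -> - r < t < r -> ball (F x0) r (row2 u t).
  move=> /uB ur /andP[t1 t2]; apply/ball_row2; rewrite row2_0 row2_1; split=> //.
  by rewrite F01 sub0r normrN ltr_norml t1.
have HX x : dom a x -> H4 R (X x) by exact (@ic_H4 _ _ _ _ ic x).
have curve u (ur : F x0 0 0 - r < u < F x0 0 0 + r) :=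
  base_curve cf hC F01 r_gt0 hU sh Dh hrot (uB u ur) HX.
(* The intervals are the sides of the square on which [h] is defined; the second one is centred at 0
   because the angle vanishes at [x0]. The curve is the slice of angle 0. *)
exists psi, (F x0 0 0 - r), (F x0 0 0 + r), (- r), r, (fun u => f (h (row2 u 0))),
  (fun u => X (h (row2 u 0))), (e2 x0), (- n x0) => kh.
split; [split|split; [|split; [|split; [|split]]]].
- move=> b Sb; apply: (reparametrized_compatible oB eU sF sh hB dE pE cE).
  exact: (atlas_compatible Sa Sb).
- rewrite dE; apply/seteqP; split=> y.
    move=> /ball_row2[]; rewrite F01 sub0r normrN !ltr_norml => /andP[u1 u2] yt.
    by split=> //; apply/andP; split; lra.
  by move=> [yu yt]; rewrite (row2E y); exact: utB.
- rewrite dE pE -mE; exists (F x0); first exact: ballxx.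
  have Bx : ball (F x0) r (F x0) by exact: ballxx.
  by rewrite /=; congr (par a _); apply: Finj => //; [exact: hB|exact: ballxx|exact: Fh].
- move=> u t ur tr; have br := utB u t ur tr.
  rewrite pE; have := parametrization cf hC F01 r_gt0 hU sh Dh hrot br.
  by rewrite row2_0 row2_1.
- move=> u ur; have [_ [dphi phiE]] := curve u ur.
  have bu : ball (F x0) r (row2 u 0) by apply: utB => //; lra.
  have f0 : 0 < f (h (row2 u 0)) by apply/f_gt0/hU.
  have r0 : 0 < radicand c C (f (h (row2 u 0))) := cf_rad_gt0 cf (hU _ bu).
  have E : derive1 ((fun u => f (h (row2 u 0))) : R -> R^o) u =
      4 / 3 * f (h (row2 u 0)) * Num.sqrt (radicand c C (f (h (row2 u 0)))).
    by rewrite derive1E.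
  split; [|exact f0|exact dphi|exact E|]; last first.
    by rewrite E; move: (f (h (row2 u 0))) f0 r0 => z z0 z1; rewrite !mulr_gt0 ?sqrtr_gt0 ?invr_gt0.
  (* The chart [b] is arbitrary in the atlas: the mean curvature is first carried over to [a], where
     it does not depend on the angle. *)
  move=> t b x tr Sb bx; rewrite pE => bE; have br := utB u t ur tr.
  apply: etrans (mean_curvature_transition iso Sb Sa bx (hU _ br) bE) _.
  by have := f_vertical cf hC F01 r_gt0 hU sh Dh br; rewrite row2_0.
- move=> u ur; apply: (kappahat_gt0 hC); apply/f_gt0/hU/utB => //; lra.
- have [nn ne _] := cf_n_frame cf ax0; have [[_ ee _ _ _] _] := cf_frame cf ax0.
  by split=> //; rewrite ?lorNl ?lorNr ?opprK // lorC ne oppr0.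
- have oI : open ([set u | F x0 0 0 - r < u < F x0 0 0 + r] : set R^o).
    by rewrite -set_itvoo; exact: interval_open.
  have sXh : smooth_on (ball (F x0) r) (X \o h).
    by move=> k; exact (Ck_on_comp oB' (ic_open ic) hU (sh k) (ic_X ic k)).
  move=> k; apply: (@Ck_on_comp _ _ _ _ _ _ _ (fun u : R^o => row2 u 0) (X \o h) oI oB' _ _ (sXh k)).
    by move=> u ur; apply: utB => //; lra.
  exact: smooth_row2.
- move=> u ur; have [? _] := curve u ur; done.
Qed.
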